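(* Let $k$ be a non-negative integer and let $\zeta^{(k)}$ denote the $k$-th derivative of the Riemann zeta function ($\zeta^{(0)}=\zeta$). The Lindelöf hypothesis (for every $\epsilon>0$, $\zeta(\tfrac12+it)\ll_\epsilon|t|^\epsilon$ as $|t|\to\infty$) is true if and only if there exist $\alpha>0$ and $\beta\in\mathbb{R}$ such that for every $l\in\mathbb{N}$ the limit $$\lim_{N\to\infty}\frac1N\sum_{n=0}^{N-1}\left|\zeta^{(k)}\bigl(\tfrac12+iT^n_{\alpha,\beta}x\bigr)\right|^{2l}$$ exists for almost all $x\in\mathbb{R}$.
   Context: For $\alpha>0$, $\beta\in\mathbb{R}$, the affine Boolean transformation $T_{\alpha,\beta}:\mathbb{R}\to\mathbb{R}$ is $T_{\alpha,\beta}(x)=\frac{\alpha}{2}\left(\frac{x+\beta}{\alpha}-\frac{\alpha}{x-\beta}\right)$ for $x\ne\beta$ and $T_{\alpha,\beta}(\beta)=\beta$; $T^n_{\alpha,\beta}$ denotes its $n$-th iterate ($T^0$ the identity). ''Almost all'' refers to Lebesgue measure. *)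

(* Defs.v *)
From mathcomp Require Import all_boot all_order all_algebra.
From mathcomp Require Import all_classical all_reals all_analysis.
From mathcomp Require Import complex.

Set Implicit Arguments.
Unset Strict Implicit.
Unset Printing Implicit Defensive.

Import Order.TTheory GRing.Theory Num.Theory.
Import numFieldNormedType.Exports.

Local Open Scope classical_set_scope.
Local Open Scope ring_scope.
Local Open Scope complex_scope.

Definition expC (R : realType) (z : R[i]) : R[i] :=
  (expR (complex.Re z))%:C * (cos (complex.Im z) +i* sin (complex.Im z)).

(* [(n + 1) ^ (- s)], the exponential of [- s * ln (n + 1)]. *)
Definition zeta_term (R : realType) (s : R[i]) (n : nat) : R[i]^o :=
  expC (- s * (ln n.+1%:R)%:C).

(* The alias [R[i]^o] carries the topology of the modulus, and derivability in
   direction 1 over the scalar field [R[i]] is complex differentiability. The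
   identity theorem makes such a [zeta] unique on the complement of 1; its
   value at the pole 1 is unconstrained. *)
Definition is_riemann_zeta (R : realType) (zeta : R[i]^o -> R[i]^o) : Prop :=
  (forall s : R[i], 1 < complex.Re s ->
     series (zeta_term s) @ \oo --> zeta s) /\
  (forall s : R[i], s != 1 -> derivable zeta s 1).

Definition lindelof_hypothesis (R : realType) (zeta : R[i]^o -> R[i]^o) : Prop :=
  forall eps : R, 0 < eps ->
  exists C t0 : R, forall t : R, t0 <= `|t| ->
    ComplexField.Normc.normc (zeta (2^-1 +i* t)) <= C * `|t| `^ eps.

Definition boolean_map (R : realType) (alpha beta : R) (x : R) : R :=
  if x == beta then beta
  else alpha / 2 * ((x + beta) / alpha - alpha / (x - beta)).

(* Main.v *)
(* Through x = b + a cot(pi u) the transformation T_(a, b) becomes the doubling map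
   u |-> 2 u mod 1, which preserves Lebesgue measure on [0, 1[.

   The Lindelof hypothesis is equivalent to the bound O(|t|^eps) for the k-th derivative on
   the critical line: Cauchy's estimate together with convexity in the strip passes to
   derivatives, and integrating from the line Re s = 2 goes back. Under this bound
   |zeta^(k)(1/2 + i (b + a cot(pi u)))|^(2 l) is integrable in u, and Birkhoff's theorem
   gives the convergence of the averages.

   Conversely, convergence of the averages of g >= 0 at x forces g(T^n x) = O(n). For any
   choice of one binary block of length m for each m, the expansions that miss it among
   their first m 4^m digits form a set whose measure is summable in m; hence for m large
   every dyadic interval of length 2^-m contains some u with g(b + a cot(pi u)) < 16^m. If
   the Lindelof hypothesis fails, then |zeta^(k)| > 2 |T|^eps for suitable large T, and, the
   next derivative being O(|T|), |zeta^(k)| > |T|^eps persists on an arc of length at least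
   a constant times |T|^-3 in the u-coordinate; taking g = |zeta^(k)|^(2 l) with
   l >= 13 / (2 eps) contradicts the previous bound. *)
Require Import Defs.
From mathcomp Require Import all_boot all_order all_algebra.
From mathcomp Require Import all_classical all_reals all_analysis.
From mathcomp Require Import complex measurable_realfun.
From mathcomp Require Import ring lra zify.
Import Order.TTheory GRing.Theory Num.Theory.
Import numFieldNormedType.Exports.
Set Implicit Arguments.
Unset Strict Implicit.
Unset Printing Implicit Defensive.
Local Open Scope classical_set_scope.
Local Open Scope ring_scope.
Local Open Scope complex_scope.
Local Notation normc := ComplexField.Normc.normc.
Local Notation Re := complex.Re.
Local Notation Im := complex.Im.

(** * Complex differentiability *)

Section Normc.
Variable R : realType.
Implicit Types (z w : R[i]) (x y : R).

(** [is_riemann_zeta] provides the series for Re s > 1 and differentiability off 1, but no formula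
    in the critical strip. The linear bound there, from which every convexity and Cauchy argument
    starts, comes from comparing each term of the series with an integral: the partial sums [em_sum]
    are bounded by |s| / Re s for all Re s > 0, s != 1, and a quantitative identity theorem shows
    that they approach zeta(s) - 1 / (s - 1) to the left of Re s = 1 as well.

    The complex analysis rests on real inequalities: a unimodular factor turns a modulus into a real
    part, and means over circles, compared by Goursat's theorem in logarithmic coordinates, do the
    work of Cauchy's formula.

    The base 16 has this origin: a block of length m is met among the first 4^m block positions,
    hence at a time below m 4^m <= 8^m. A linear orbit bound then allows only O(8^m) there, and 16^m
    eventually exceeds this whatever the constant. In the forward direction the exponent 1 / (4 l)
    leaves g = O(|x|^(1/2)), which is integrable in u because the cotangent has simple poles. *)

Lemma normcE z : `|z| = (normc z)%:C. Proof. by []. Qed.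

Lemma normc_ge0 z : 0 <= normc z.
Proof. by case: z => a b /=; rewrite sqrtr_ge0. Qed.

Lemma normcM z w : normc (z * w) = normc z * normc w.
Proof. exact: ComplexField.Normc.normcM. Qed.

Lemma normcD z w : normc (z + w) <= normc z + normc w.
Proof. exact: le_normcD. Qed.

Lemma normcB z w : normc (z - w) <= normc z + normc w.
Proof. by rewrite -(normcN w) normcD. Qed.

Lemma normcBC z w : normc (z - w) = normc (w - z).
Proof. by rewrite -normcN opprB. Qed.

Lemma normcV z : normc z^-1 = (normc z)^-1.
Proof. exact: ComplexField.Normc.normcV. Qed.

Lemma normc_eq0 z : (normc z == 0) = (z == 0).
Proof.
apply/eqP/eqP => [/ComplexField.Normc.eq0_normc//|->].
exact: ComplexField.Normc.normc0.
Qed.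

Lemma normc_gt0 z : (0 < normc z) = (z != 0).
Proof. by rewrite lt_neqAle normc_ge0 andbT eq_sym normc_eq0. Qed.

Lemma normc0 : normc (0 : R[i]) = 0. Proof. exact: ComplexField.Normc.normc0. Qed.
Lemma normc1 : normc (1 : R[i]) = 1. Proof. exact: ComplexField.Normc.normc1. Qed.

Lemma normc_real x : normc x%:C = `|x|.
Proof. by rewrite /= expr0n addr0 sqrtr_sqr. Qed.

Lemma normc_Re z : `|Re z| <= normc z.
Proof.
case: z => a b /=; rewrite -sqrtr_sqr ler_wsqrtr// lerDl sqr_ge0//.
Qed.

Lemma normc_Im z : `|Im z| <= normc z.
Proof.
case: z => a b /=; rewrite -sqrtr_sqr ler_wsqrtr// lerDr sqr_ge0//.
Qed.

Lemma normc_le z : normc z <= `|Re z| + `|Im z|.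
Proof.
case: z => a b /=; rewrite -[leRHS]ger0_norm ?addr_ge0// -sqrtr_sqr.
rewrite ler_wsqrtr// sqrrD !real_normK ?num_real//; rewrite addrAC lerDl.
by rewrite mulrn_wge0// mulr_ge0.
Qed.

Lemma normc_sqrE z : normc z ^+ 2 = Re z ^+ 2 + Im z ^+ 2.
Proof. by case: z => a b /=; rewrite sqr_sqrtr// addr_ge0// sqr_ge0. Qed.

Lemma normc_sum (I : Type) (r : seq I) (P : pred I) (F : I -> R[i]) :
  normc (\sum_(i <- r | P i) F i) <= \sum_(i <- r | P i) normc (F i).
Proof.
elim/big_rec2: _ => [|i y z _ h]; first by rewrite normc0.
by apply: (le_trans (normcD _ _)); rewrite lerD2l.
Qed.

Lemma normc_lip z w : `|normc z - normc w| <= normc (z - w).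
Proof.
rewrite ler_norml; apply/andP; split.
  rewrite lerNl opprB lerBlDr normcBC; apply: le_trans (normcD _ _).
  by rewrite subrK.
by rewrite lerBlDr; apply: le_trans (normcD _ _); rewrite subrK.
Qed.

Lemma cRe_real x : Re x%:C = x. Proof. by []. Qed.
Lemma cIm_real x : Im x%:C = 0. Proof. by []. Qed.
Lemma cReD z w : Re (z + w) = Re z + Re w. Proof. by case: z; case: w. Qed.
Lemma cImD z w : Im (z + w) = Im z + Im w. Proof. by case: z; case: w. Qed.
Lemma cReN z : Re (- z) = - Re z. Proof. by case: z. Qed.
Lemma cImN z : Im (- z) = - Im z. Proof. by case: z. Qed.
Lemma cReM z w : Re (z * w) = Re z * Re w - Im z * Im w.
Proof. by case: z; case: w. Qed.
Lemma cImM z w : Im (z * w) = Re z * Im w + Im z * Re w.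
Proof. by case: z => a b; case: w => c d /=. Qed.

Lemma complex_ext z w : Re z = Re w -> Im z = Im w -> z = w.
Proof. by case: z => a b; case: w => c d /= -> ->. Qed.

(** Rotating [z] onto the nonnegative real axis reduces a bound on a modulus to a bound on a real
    part. *)
Lemma unimodular_factor z :
  exists2 l, normc l = 1 & l * z = (normc z)%:C.
Proof.
have [->|z0] := eqVneq z 0; first by exists 1; rewrite ?normc1 ?mulr0 ?normc0.
have nz0 : normc z != 0 by rewrite normc_eq0.
exists ((normc z)%:C / z).
  by rewrite normcM normcV normc_real ger0_norm ?normc_ge0// divff.
by rewrite divfK.
Qed.

End Normc.

Section Cder.
Variable R : realType.
Implicit Types (z w d : R[i]) (f g : R[i] -> R[i]).

(** Stated without a quotient, so that [h = 0] needs no exception and remainders can be estimated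
    directly. *)
Definition cder f z d := forall e : R, 0 < e -> exists2 dl : R, 0 < dl &
  forall h, normc h < dl -> normc (f (z + h) - f z - d * h) <= e * normc h.

Lemma ltcR_ex (e : R[i]) : 0 < e -> exists2 x : R, 0 < x & e = x%:C.
Proof.
case: e => a b; rewrite ltcE /= => /andP[/eqP b0 a0].
by exists a => //; rewrite b0.
Qed.

Lemma cder_is_derive f z d :
  cder f z d <-> is_derive (z : R[i]^o) (1 : R[i]^o) (f : R[i]^o -> R[i]^o) d.
Proof.
have key : cder f z d <-> (fun h : R[i]^o => h^-1 *: (((f : R[i]^o -> R[i]^o) \o shift z) (h *: (1 : R[i]^o)) - f z)) @ 0^' --> (d : R[i]^o).
  split => [fd|].
    apply/cvgrPdist_le => e /ltcR_ex[x x0 ->].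
    have [dl dl0 H] := fd _ x0.
    rewrite near_withinE; exists dl%:C => /=; first by rewrite ltcR.
    move=> h /=; rewrite sub0r normrN normcE ltcR => hdl h0.
    rewrite normcE lecR /GRing.scale/= mulr1 (addrC h).
    have nh : 0 < normc h by rewrite normc_gt0.
    have /H := hdl.
    rewrite -ler_pdivrMr// => /(le_trans _); apply.
    rewrite -normcV -normcM normcBC mulrBl mulfK//.
    by rewrite [in leRHS]mulrC.
  move=> /cvgrPdist_le fd e e0.
  have := fd e%:C; rewrite ltcR => /(_ e0); rewrite near_withinE.
  move=> [x /= /ltcR_ex[dl dl0 ->]] H; exists dl => // h hdl.
  have [->|h0] := eqVneq h 0.
    by rewrite mulr0 subr0 addr0 subrr normc0 mulr0.
  have := H h; rewrite /= sub0r normrN normcE ltcR => /(_ hdl h0).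
  rewrite normcE lecR /GRing.scale/= mulr1 (addrC h).
  have nh : 0 < normc h by rewrite normc_gt0.
  rewrite -(ler_pM2r nh) => /(le_trans _); apply.
  by rewrite -normcM normcBC mulrBl mulrAC mulVf// mul1r.
split=> [/key fd|[fd dE]].
  split; first by apply/cvg_ex; exists d.
  by rewrite /derive; apply/cvg_lim.
apply/key; have /cvg_ex[l lP] := fd.
suff -> : d = l by [].
by rewrite -dE; exact: (cvg_lim (@norm_hausdorff _ _) lP).
Qed.

Lemma cder_ext f g z d : f =1 g -> cder f z d -> cder g z d.
Proof. by move=> /funext ->. Qed.

Lemma cder_cst (a : R[i]) z : cder (fun _ => a) z 0.
Proof. by apply/cder_is_derive; exact: is_derive_cst. Qed.

Lemma cder_id z : cder id z 1.
Proof. by apply/cder_is_derive; exact: is_derive_id. Qed.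

Lemma cderD f g z d d' : cder f z d -> cder g z d' -> cder (fun w => f w + g w) z (d + d').
Proof.
by move=> /cder_is_derive fd /cder_is_derive gd; apply/cder_is_derive; exact: is_deriveD.
Qed.

Lemma cderN f z d : cder f z d -> cder (fun w => - f w) z (- d).
Proof. by move=> /cder_is_derive fd; apply/cder_is_derive; exact: is_deriveN. Qed.

Lemma cderB f g z d d' : cder f z d -> cder g z d' -> cder (fun w => f w - g w) z (d - d').
Proof. by move=> fd gd; apply: cderD => //; exact: cderN. Qed.

Lemma cderM f g z d d' : cder f z d -> cder g z d' ->
  cder (fun w => f w * g w) z (f z * d' + g z * d).
Proof.
by move=> /cder_is_derive fd /cder_is_derive gd; apply/cder_is_derive; exact: is_deriveM.
Qed.

Lemma cderMl (a : R[i]) f z d : cder f z d -> cder (fun w => a * f w) z (a * d).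
Proof.
by move=> fd; have := cderM (cder_cst a z) fd; rewrite mulr0 addr0.
Qed.

Lemma cderV f z d : f z != 0 -> cder f z d -> cder (fun w => (f w)^-1) z (- (f z) ^- 2 * d).
Proof.
move=> fz /cder_is_derive fd; apply/cder_is_derive; split.
  by apply: derivableV.
by rewrite deriveV// derive_val.
Qed.

Lemma cder_sum (I : Type) (r : seq I) (F : I -> R[i] -> R[i]) (D : I -> R[i]) z :
  (forall i, cder (F i) z (D i)) ->
  cder (fun w => \sum_(i <- r) F i w) z (\sum_(i <- r) D i).
Proof.
move=> FD; elim: r => [|i r ih].
  by rewrite big_nil; apply: cder_ext (cder_cst 0 z) => w; rewrite big_nil.
rewrite big_cons; apply: cder_ext (cderD (FD i) ih) => w.
by rewrite big_cons.
Qed.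

Lemma cder_lip f z d : cder f z d -> exists2 dl : R, 0 < dl &
  forall h, normc h < dl -> normc (f (z + h) - f z) <= (normc d + 1) * normc h.
Proof.
move=> fd; have [dl dl0 H] := fd 1 ltr01; exists dl => // h /H.
rewrite mul1r => H1; rewrite -[X in normc X](subrK (d * h)).
by rewrite (le_trans (normcD _ _))// normcM mulrDl mul1r addrC lerD2l.
Qed.

Lemma cder_cont f z d : cder f z d -> forall e : R, 0 < e -> exists2 dl : R, 0 < dl &
  forall h, normc h < dl -> normc (f (z + h) - f z) < e.
Proof.
move=> /cder_lip[dl dl0 H] e e0; have nd : 0 < normc d + 1 by rewrite ltr_wpDl ?normc_ge0.
exists (Num.min dl (e / (normc d + 1))); first by rewrite lt_min dl0 divr_gt0.
move=> h; rewrite lt_min ltr_pdivlMr// => /andP[/H h1 h2].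
by rewrite (le_lt_trans h1)// mulrC.
Qed.

Lemma cder_comp f g z d d' : cder f z d -> cder g (f z) d' -> cder (g \o f) z (d' * d).
Proof.
move=> fd gd e e0.
have nd : 0 < normc d + 1 by rewrite ltr_wpDl ?normc_ge0.
have nd' : 0 < normc d' + 1 by rewrite ltr_wpDl ?normc_ge0.
have [d1 d10 H1] := cder_lip fd.
have [d2 d20 H2] := gd (e / 2 / (normc d + 1)) (divr_gt0 (divr_gt0 e0 (ltr0n _ 2)) nd).
have [d3 d30 H3] := fd (e / 2 / (normc d' + 1)) (divr_gt0 (divr_gt0 e0 (ltr0n _ 2)) nd').
exists (Num.min (Num.min d1 d3) (d2 / (normc d + 1))).
  by rewrite !lt_min d10 d30 divr_gt0.
move=> h; rewrite !lt_min ltr_pdivlMr// => /andP[/andP[/H1 h1 /H3 h3] h2] /=.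
set k := f (z + h) - f z in h1 h3.
have kE : f (z + h) = f z + k by rewrite /k [RHS]addrC subrK.
have kd2 : normc k < d2 by rewrite (le_lt_trans h1)// mulrC.
rewrite kE; have -> : g (f z + k) - g (f z) - d' * d * h =
  (g (f z + k) - g (f z) - d' * k) + d' * (k - d * h) by ring.
rewrite (le_trans (normcD _ _))// (splitr (e * _)) lerD//.
  apply: (le_trans (H2 _ kd2)).
  rewrite -(@ler_pM2l _ (e / 2 / (normc d + 1))) in h1; last by rewrite !divr_gt0.
  apply: (le_trans h1); rewrite mulrA divfK ?gt_eqF//; lra.
rewrite normcM; apply: (@le_trans _ _ ((normc d' + 1) * (e / 2 / (normc d' + 1) * normc h))).
  by rewrite ler_pM// ?normc_ge0// lerDl.
by rewrite mulrA mulrCA divff ?gt_eqF//; lra.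
Qed.

End Cder.

Section ExpC.
Variable R : realType.
Implicit Types (z w : R[i]).

Lemma expCD z w : expC (z + w) = expC z * expC w.
Proof.
rewrite /expC cReD cImD expRD cosD sinD; apply: complex_ext => /=; ring.
Qed.

Lemma expC0 : expC (0 : R[i]) = 1.
Proof. by rewrite /expC /= expR0 cos0 sin0; apply: complex_ext => /=; ring. Qed.

Lemma normc_expC z : normc (expC z) = expR (Re z).
Proof.
rewrite /expC normcM normc_real ger0_norm ?expR_ge0//=.
by rewrite cos2Dsin2 sqrtr1 mulr1.
Qed.

End ExpC.

Section RealDer.
Variable R : realType.
Implicit Types (f : R -> R) (x d : R).

Lemma is_derive_epsP f x d :
  is_derive x (1 : R) f d <-> forall e : R, 0 < e -> exists2 dl : R, 0 < dl &
    forall h, `|h| < dl -> `|f (x + h) - f x - d * h| <= e * `|h|.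
Proof.
have key : (forall e : R, 0 < e -> exists2 dl : R, 0 < dl &
    forall h, `|h| < dl -> `|f (x + h) - f x - d * h| <= e * `|h|) <->
  (fun h : R => h^-1 *: ((f \o shift x) (h *: (1 : R)) - f x)) @ 0^' --> d.
  split => [fd|].
    apply/cvgrPdist_le => e e0.
    have [dl dl0 H] := fd _ e0.
    rewrite near_withinE; exists dl => //=.
    move=> h /=; rewrite sub0r normrN => hdl h0.
    rewrite /GRing.scale/= mulr1 (addrC h).
    have nh : 0 < `|h| by rewrite normr_gt0.
    have /H := hdl.
    rewrite -ler_pdivrMr// => /(le_trans _); apply.
    rewrite -normfV -normrM distrC mulrBl mulfK//.
    by rewrite [in leRHS]mulrC.
  move=> /cvgrPdist_le fd e e0.
  have := fd e e0; rewrite near_withinE.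
  move=> [dl /= dl0] H; exists dl => // h hdl.
  have [->|h0] := eqVneq h 0.
    by rewrite mulr0 subr0 addr0 subrr normr0 mulr0.
  have := H h; rewrite /= sub0r normrN => /(_ hdl h0).
  rewrite /GRing.scale/= mulr1 (addrC h).
  have nh : 0 < `|h| by rewrite normr_gt0.
  rewrite -(ler_pM2r nh) => /(le_trans _); apply.
  by rewrite -normrM distrC mulrBl mulrAC mulVf// mul1r.
split=> [[fd dE]|/key fd].
  apply/key; have /cvg_ex[l lP] := fd.
  suff -> : d = l by [].
  by rewrite -dE; exact: (cvg_lim (@norm_hausdorff _ _) lP).
split; first by apply/cvg_ex; exists d.
by rewrite /derive; apply/cvg_lim.
Qed.

Lemma cder_line (f : R[i] -> R[i]) (a b d : R[i]) (t : R) :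
  cder f (a + t%:C * b) d ->
  is_derive t (1 : R) (fun u : R => Re (f (a + u%:C * b))) (Re (d * b)) /\
  is_derive t (1 : R) (fun u : R => Im (f (a + u%:C * b))) (Im (d * b)).
Proof.
move=> fd.
suff H : forall e : R, 0 < e -> exists2 dl : R, 0 < dl & forall h : R, `|h| < dl ->
    normc (f (a + (t + h)%:C * b) - f (a + t%:C * b) - d * b * h%:C) <= e * `|h|.
  split; apply/is_derive_epsP => e /H[dl dl0 {}H]; exists dl => // h /H; apply: le_trans.
    set w := d * b; set u := f _; set v := f _; clearbody w u v.
    have -> : Re u - Re v - Re w * h = (complex.Re) (u - v - w * h%:C).
      by rewrite !(cReD, cReN, cReM) cRe_real cIm_real; ring.
    exact: normc_Re.
  set w := d * b; set u := f _; set v := f _; clearbody w u v.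
  have -> : Im u - Im v - Im w * h = Im (u - v - w * h%:C).
    by rewrite !(cImD, cImN, cImM) cRe_real cIm_real; ring.
  exact: normc_Im.
move=> e e0; have nb : 0 < normc b + 1 by rewrite ltr_wpDl ?normc_ge0.
have [dl dl0 H] := fd (e / (normc b + 1)) (divr_gt0 e0 nb).
exists (dl / (normc b + 1)); first by rewrite divr_gt0.
move=> h; rewrite ltr_pdivlMr// => hdl.
have hb : normc (h%:C * b) <= `|h| * (normc b + 1).
  by rewrite normcM normc_real ler_wpM2l// lerDl.
have := H (h%:C * b) (le_lt_trans hb hdl).
have -> : a + t%:C * b + h%:C * b = a + (t + h)%:C * b.
  by rewrite rmorphD /=; ring.
rewrite (_ : d * (h%:C * b) = d * b * h%:C); last by ring.
move=> /le_trans; apply.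
rewrite -mulrA ler_pM2l// mulrC ler_pdivrMr//.
Qed.

(** With [l] rotating [g b - g a] onto the real axis, [p - Re (l * g)] has a nonnegative derivative,
    and the real mean value theorem applies. A dominating function [p], rather than a constant speed
    bound, is what makes the estimate of [pw_variation] telescope. *)
Lemma curve_mvt (g dg : R -> R[i]) (p dp : R -> R) (a b : R) : a <= b ->
  (forall t, a <= t <= b -> [/\ is_derive t (1 : R) (fun u => Re (g u)) (Re (dg t)),
     is_derive t (1 : R) (fun u => Im (g u)) (Im (dg t)), is_derive t (1 : R) p (dp t) &
     normc (dg t) <= dp t]) ->
  normc (g b - g a) <= p b - p a.
Proof.
move=> ab H; have [l l1 lE] := unimodular_factor (g b - g a).
pose q t := p t - (Re l * Re (g t) - Im l * Im (g t)).
have qd t : a <= t <= b -> is_derive t (1 : R) q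
    (dp t - (Re l * Re (dg t) - Im l * Im (dg t))).
  move=> /H[h1 h2 h3 _].
  have h4 := is_deriveB h3 (is_deriveB (is_deriveZ (Re l) h1) (is_deriveZ (Im l) h2)).
  exact: h4.
have [c /[!in_itv]/= cab E] : exists2 c, c \in `[a, b]%R & q b - q a = 
    (dp c - (Re l * Re (dg c) - Im l * Im (dg c))) * (b - a).
  apply: (@MVT_segment _ q (fun c => dp c - (Re l * Re (dg c) - Im l * Im (dg c)))) => //.
    move=> x /[!in_itv]/= /andP[ax xb]; apply: qd; by rewrite !ltW.
  apply: derivable_within_continuous => x /[!in_itv]/= xab.
  by case: (qd _ xab).
have : 0 <= q b - q a.
  rewrite E mulr_ge0 ?subr_ge0//.
  have [_ _ _] := H _ cab; apply: le_trans.
  rewrite -cReM -[leRHS]mul1r -l1 -normcM.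
  by rewrite (le_trans _ (normc_Re _))// ler_norm.
have : Re (l * (g b - g a)) = normc (g b - g a) by rewrite lE.
rewrite cReM !(cReD, cReN, cImD, cImN) /q; lra.
Qed.

Lemma cder_mvt (f f' : R[i] -> R[i]) (z h : R[i]) (M : R) :
  (forall t : R, 0 <= t <= 1 -> cder f (z + t%:C * h) (f' (z + t%:C * h)) /\
     normc (f' (z + t%:C * h)) <= M) ->
  normc (f (z + h) - f z) <= M * normc h.
Proof.
move=> H.
have := @curve_mvt (fun t => f (z + t%:C * h)) (fun t => f' (z + t%:C * h) * h)
  (fun t => M * normc h * t) (fun t => M * normc h) 0 1 ler01.
rewrite mul1r mul0r addr0 mulr1 mulr0 subr0; apply => t /H[fd fM].
have [h1 h2] := cder_line fd.
split => //; last by rewrite normcM ler_wpM2r ?normc_ge0.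
have := is_deriveZ (M * normc h) (is_derive_id t (1 : R)).
by rewrite /GRing.scale/= mulr1.
Qed.

Lemma cder_expC0 : cder (@expC R) 0 1.
Proof.
move=> e e0.
(* The remainders below add up to [9 * e' * n], whence the 10; the cap 1 keeps [expR x] at most
   3. *)
have eh : 0 < Num.min (e / 10) 1 by rewrite lt_min divr_gt0//=.
set e' := Num.min _ _ in eh.
have e'1 : e' <= 1 by rewrite ge_min lexx orbT.
have e'e : e' <= e / 10 by rewrite ge_min lexx.
clearbody e'.
have /is_derive_epsP/(_ _ eh)[d1 d10 H1] := is_derive_expR (0 : R).
have /is_derive_epsP/(_ _ eh)[d2 d20 H2] := is_derive_cos (0 : R).
have /is_derive_epsP/(_ _ eh)[d3 d30 H3] := is_derive_sin (0 : R).
exists (Num.min (Num.min d1 e') (Num.min d2 d3)).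
  by rewrite !lt_min d10 d20 d30 eh.
move=> h; rewrite !lt_min -!andbA => /and4P[hd1 he hd2 hd3].
have hx := normc_Re h; have hy := normc_Im h.
have {}H1 := H1 (Re h) (le_lt_trans hx hd1).
have {}H2 := H2 (Im h) (le_lt_trans hy hd2).
have {}H3 := H3 (Im h) (le_lt_trans hy hd3).
rewrite add0r expC0 mul1r.
apply: (le_trans (normc_le _)).
rewrite !(cReD, cReN, cImD, cImN) /= !mul0r subr0 addr0 oppr0 addr0.
move: H1 H2 H3; rewrite !add0r expR0 cos0 sin0 !(oppr0, mul0r, addr0, subr0, mul1r).
move: hx hy he; set x := Re h; set y := Im h; set n := normc h.
set E := expR x; set c := cos y; set s := sin y => hx hy he H1 H2 H3.
have n0 : 0 <= n by rewrite normc_ge0.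
have H1' : `|E - 1 - x| <= e' * n by rewrite (le_trans H1)// ler_pM2l.
have H2' : `|c - 1| <= e' * n by rewrite (le_trans H2)// ler_pM2l.
have H3' : `|s - y| <= e' * n by rewrite (le_trans H3)// ler_pM2l.
have E3 : `|E| <= 3.
  have -> : E = (E - 1 - x) + x + 1 by ring.
  rewrite (le_trans (ler_normD _ _))// normr1.
  rewrite (le_trans (lerD (ler_normD _ _) (lexx _)))//.
  have : e' * n <= 1 by rewrite mulr_ile1// ltW// (lt_le_trans he).
  have : n <= 1 by rewrite ltW// (lt_le_trans he).
  lra.
have E1 : `|E - 1| <= 2 * e'.
  have -> : E - 1 = (E - 1 - x) + x by ring.
  rewrite (le_trans (ler_normD _ _))//.
  have : e' * n <= e' by rewrite ler_piMr// ltW// (lt_le_trans he).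
  lra.
have -> : E * c - 1 - x = (E - 1 - x) + E * (c - 1) by ring.
have -> : E * s - y = E * (s - y) + (E - 1) * y by ring.
apply: (@le_trans _ _ ((e' * n + 3 * (e' * n)) + (3 * (e' * n) + 2 * e' * n))).
  rewrite lerD// (le_trans (ler_normD _ _))// lerD// normrM.
  - by rewrite ler_pM.
  - by rewrite ler_pM.
  - by rewrite ler_pM.
have : e' * n <= e / 10 * n by rewrite ler_wpM2r.
have : 0 <= e * n by apply: mulr_ge0 => //; exact: ltW.
lra.
Qed.

Lemma cder_expC (z : R[i]) : cder (@expC R) z (expC z).
Proof.
have h1 : cder (fun w : R[i] => w - z) z 1.
  by have := cderB (cder_id z) (cder_cst z z); rewrite subr0.
have h2 : cder (@expC R) ((fun w : R[i] => w - z) z) 1.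
  by rewrite /= subrr; exact: cder_expC0.
have := cderMl (expC z) (cder_comp h1 h2); rewrite !mulr1.
by apply: cder_ext => w /=; rewrite -expCD addrC subrK.
Qed.

End RealDer.

(** * Goursat's theorem and Cauchy's estimate *)

Section Rint.
Variable R : realType.
Local Notation mu := (@lebesgue_measure R).
Implicit Types (f g : R -> R) (a b c : R).

Definition rint a b f : R := Rintegral mu `[a, b] f.

Lemma rint_integrable a b f : {in `[a, b], continuous f} ->
  mu.-integrable `[a, b] (EFin \o f).
Proof.
move=> cf; apply: continuous_compact_integrable; first exact: segment_compact.
exact: continuous_subspace_itv.
Qed.

Lemma eq_rint a b f g : (forall x, a <= x <= b -> f x = g x) -> rint a b f = rint a b g.
Proof. by move=> fg; apply: eq_Rintegral => x; rewrite inE/= in_itv/= => /fg. Qed.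

Lemma rintB a b f g : {in `[a, b], continuous f} -> {in `[a, b], continuous g} ->
  rint a b (fun x => f x - g x) = rint a b f - rint a b g.
Proof. by move=> cf cg; rewrite /rint RintegralB//; exact: rint_integrable. Qed.

Lemma rint_cst a b k : a <= b -> rint a b (fun _ => k) = k * (b - a).
Proof.
move=> ab; rewrite /rint Rintegral_cst//= lebesgue_measure_itv/= lte_fin.
rewrite le_eqVlt in ab; case/orP: ab => [/eqP ->|ab]; first by rewrite ltxx subrr.
by rewrite ab.
Qed.

Lemma rint_le a b f g : {in `[a, b], continuous f} -> {in `[a, b], continuous g} ->
  (forall x, a <= x <= b -> f x <= g x) -> rint a b f <= rint a b g.
Proof.
move=> cf cg fg; apply: le_Rintegral => //; exact: rint_integrable.
Qed.

Lemma rint_bound a b f M : a <= b -> {in `[a, b], continuous f} ->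
  (forall x, a <= x <= b -> `|f x| <= M) -> `|rint a b f| <= M * (b - a).
Proof.
move=> ab cf fM; rewrite ler_norml -mulNr -!rint_cst//.
have icst (k : R) : {in `[a, b], continuous (fun _ : R => k)}.
  by move=> ? _; exact: cvg_cst.
have fM' x : a <= x <= b -> - M <= f x <= M by move=> /fM; rewrite ler_norml.
by apply/andP; split; apply: rint_le => // x /fM' /andP[].
Qed.

Lemma rint_split a b c f : a <= c -> c <= b -> {in `[a, b], continuous f} ->
  rint a b f = rint a c f + rint c b f.
Proof.
move=> ac cb cf.
have := @Rintegral_itvB _ f (BLeft a) (BRight b) c (rint_integrable cf).
rewrite !bnd_simp => /(_ ac cb); rewrite Rintegral_itv_obnd_cbnd.
  by rewrite /rint => <-; rewrite addrC subrK.
apply: integrableS (rint_integrable cf) => //.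
by move=> x /=; rewrite !in_itv/= => /andP[cx ->]; rewrite (le_trans ac)// ltW.
Qed.

End Rint.

(** * Bisection of boxes *)

Section BoxInduction.
Variable R : realType.

(** Compactness by bisection: a failing box has a failing quarter, and nested failing quarters
    shrink to a point where they contradict the local hypothesis. Both Goursat's theorem and the
    boundedness of differentiable functions on a box use it. *)
Lemma box_induction (P : R -> R -> R -> R -> Prop) (a b c d : R) :
  a <= b -> c <= d ->
  (forall a b c d, a <= b -> c <= d ->
    let e := (a + b) / 2 in let f := (c + d) / 2 in
    P a e c f -> P e b c f -> P a e f d -> P e b f d -> P a b c d) ->
  (forall x y, a <= x <= b -> c <= y <= d -> exists2 dl : R, 0 < dl &
    forall a' b' c' d', a' <= x <= b' -> c' <= y <= d' -> b' - a' < dl -> d' - c' < dl ->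
      P a' b' c' d') ->
  P a b c d.
Proof.
move=> ab cd merge loc; apply: contrapT => nP.
pose Q (q : R * R * R * R) := [/\ q.1.1.1 <= q.1.1.2, q.1.2 <= q.2 &
  ~ P q.1.1.1 q.1.1.2 q.1.2 q.2].
(* The premise [Q q] sits inside the existential, so that [choice] gives a total successor
   function. *)
have step q : exists q' : R * R * R * R, Q q -> Q q' /\
    [/\ q.1.1.1 <= q'.1.1.1, q'.1.1.2 <= q.1.1.2, q.1.2 <= q'.1.2, q'.2 <= q.2 &
     q'.1.1.2 - q'.1.1.1 = (q.1.1.2 - q.1.1.1) / 2 /\ q'.2 - q'.1.2 = (q.2 - q.1.2) / 2].
  case: q => [[[a' b'] c'] d'].
  have [|nQ] := pselect (Q (a', b', c', d')); last by exists (a', b', c', d').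
  rewrite /Q /= => -[ab' cd' nP'].
  have ae : a' <= (a' + b') / 2 by lra.
  have eb : (a' + b') / 2 <= b' by lra.
  have cf : c' <= (c' + d') / 2 by lra.
  have fd : (c' + d') / 2 <= d' by lra.
  have [p1|n1] := pselect (P a' ((a' + b') / 2) c' ((c' + d') / 2)); last first.
    exists (a', ((a' + b') / 2), c', ((c' + d') / 2)) => /= _.
    by split => //; split => //; [split; lra].
  have [p2|n2] := pselect (P ((a' + b') / 2) b' c' ((c' + d') / 2)); last first.
    exists (((a' + b') / 2), b', c', ((c' + d') / 2)) => /= _.
    by split => //; split => //; [split; lra].
  have [p3|n3] := pselect (P a' ((a' + b') / 2) ((c' + d') / 2) d'); last first.
    exists (a', ((a' + b') / 2), ((c' + d') / 2), d') => /= _.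
    by split => //; split => //; [split; lra].
  have [p4|n4] := pselect (P ((a' + b') / 2) b' ((c' + d') / 2) d'); last first.
    exists (((a' + b') / 2), b', ((c' + d') / 2), d') => /= _.
    by split => //; split => //; [split; lra].
  by exfalso; apply: nP'; apply: merge.
have [s sP] := choice step.
pose q n := iter n s (a, b, c, d).
have Qq n : Q (q n) by elim: n => [//|n ih] /=; have [] := sP _ ih.
have mono n m : [/\ (q n).1.1.1 <= (q (n + m)%N).1.1.1,
   (q (n + m)%N).1.1.2 <= (q n).1.1.2, (q n).1.2 <= (q (n + m)%N).1.2 &
   (q (n + m)%N).2 <= (q n).2].
  elim: m => [|m [h1 h2 h3 h4]]; first by rewrite addn0.
  rewrite addnS /=; have [_ [k1 k2 k3 k4 _]] := sP _ (Qq (n + m)%N).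
  by split; [exact: le_trans k1|exact: le_trans h2|exact: le_trans k3|exact: le_trans h4].
have len n : (q n).1.1.2 - (q n).1.1.1 = (b - a) / 2 ^+ n /\
             (q n).2 - (q n).1.2 = (d - c) / 2 ^+ n.
  elim: n => [|n [h1 h2]]; first by rewrite /= expr0 !divr1.
  rewrite /=; have [_ [_ _ _ _ [-> ->]]] := sP _ (Qq n).
  by rewrite h1 h2 exprS invfM !mulrA ![_ / 2]mulrC !mulrA.
have lelr n m : (q n).1.1.1 <= (q m).1.1.2 /\ (q n).1.2 <= (q m).2.
  have [h1 _ h3 _] := mono n m; have [_ h2 _ h4] := mono m n.
  have [k1 k2 _] := Qq (n + m)%N; rewrite addnC in h2 h4.
  by split; [apply: le_trans h1 (le_trans k1 h2)|apply: le_trans h3 (le_trans k2 h4)].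
have [x xP] : exists x, forall n, (q n).1.1.1 <= x <= (q n).1.1.2.
  exists (sup (range (fun n => (q n).1.1.1))) => n; apply/andP; split.
    apply: ub_le_sup; last by exists n.
    by exists b => _ [m _ <-]; have [] := lelr m 0%N.
  apply: ge_sup; first by exists (q 0%N).1.1.1; exists 0%N.
  by move=> _ [m _ <-]; have [] := lelr m n.
have [y yP] : exists y, forall n, (q n).1.2 <= y <= (q n).2.
  exists (sup (range (fun n => (q n).1.2))) => n; apply/andP; split.
    apply: ub_le_sup; last by exists n.
    by exists d => _ [m _ <-]; have [] := lelr m 0%N.
  apply: ge_sup; first by exists (q 0%N).1.2; exists 0%N.
  by move=> _ [m _ <-]; have [] := lelr m n.
have [dl dl0 H] := loc x y (xP 0%N) (yP 0%N).
have M0 : 0 < (b - a) + (d - c) + 1 by lra.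
have [n nP2] : exists n, ((b - a) + (d - c) + 1) / 2 ^+ n < dl.
  exists (Num.truncn (((b - a) + (d - c) + 1) / dl)).+1.
  rewrite ltr_pdivrMr ?exprn_gt0// mulrC -ltr_pdivrMr//.
  have h := @ltn_expl 2 (Num.truncn (((b - a) + (d - c) + 1) / dl)).+1 isT.
  rewrite -natrX (lt_trans (truncnS_gt _))// ltr_nat//.
have [_ _] := Qq n; apply.
have [l1 l2] := len n.
apply: H => //; rewrite ?l1 ?l2; apply: le_lt_trans nP2;
  rewrite ler_pM2r ?invr_gt0 ?exprn_gt0//; lra.
Qed.

End BoxInduction.

Section Goursat.
Variable R : realType.
Implicit Types (G : R[i] -> R[i]) (a b c d : R).

(* Only the real part of the contour integral over the boundary of [a, b] x [c, d];
   replacing [G] by ['i * G] gives the imaginary part. *)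
Definition boundary_int G a b c d : R :=
  rint a b (fun x => Re (G (x +i* c)) - Re (G (x +i* d))) -
  rint c d (fun y => Im (G (b +i* y)) - Im (G (a +i* y))).

Definition cdiff G z := exists d : R[i], cder G z d.

Lemma cdiff_cont_h G c x : cdiff G (x +i* c) ->
  {for x, continuous (fun u : R => Re (G (u +i* c)))} /\
  {for x, continuous (fun u : R => Im (G (u +i* c)))}.
Proof.
move=> [D].
have E u : u +i* c = 0 +i* c + u%:C * 1 by apply: complex_ext => /=; ring.
rewrite E => /cder_line[h1 h2]; split; apply: differentiable_continuous.
  apply/derivable1_diffP; rewrite (_ : (fun _ => _) = (fun u : R => Re (G (0 +i* c + u%:C * 1)))).
    by case: h1.
  by apply/funext => u; rewrite -E.
apply/derivable1_diffP; rewrite (_ : (fun _ => _) = (fun u : R => Im (G (0 +i* c + u%:C * 1)))).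
  by case: h2.
by apply/funext => u; rewrite -E.
Qed.

Lemma cdiff_cont_v G c x : cdiff G (c +i* x) ->
  {for x, continuous (fun u : R => Re (G (c +i* u)))} /\
  {for x, continuous (fun u : R => Im (G (c +i* u)))}.
Proof.
move=> [D].
have E u : c +i* u = c%:C + u%:C * 'i by apply: complex_ext => /=; ring.
rewrite E => /cder_line[h1 h2]; split; apply: differentiable_continuous.
  apply/derivable1_diffP; rewrite (_ : (fun _ => _) = (fun u : R => Re (G (c%:C + u%:C * 'i)))).
    by case: h1.
  by apply/funext => u; rewrite -E.
apply/derivable1_diffP; rewrite (_ : (fun _ => _) = (fun u : R => Im (G (c%:C + u%:C * 'i)))).
  by case: h2.
by apply/funext => u; rewrite -E.
Qed.

Definition cdiff_on G a b c d :=
  forall x y, a <= x <= b -> c <= y <= d -> cdiff G (x +i* y).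

Lemma cdiff_onS G a b c d a' b' c' d' : cdiff_on G a b c d ->
  a <= a' -> b' <= b -> c <= c' -> d' <= d -> cdiff_on G a' b' c' d'.
Proof.
move=> H aa bb cc dd x y /andP[ax xb] /andP[cy yd]; apply: H.
  by rewrite (le_trans aa ax) (le_trans xb bb).
by rewrite (le_trans cc cy) (le_trans yd dd).
Qed.

Lemma cdiff_on_h G a b c d y : cdiff_on G a b c d -> c <= y <= d ->
  {in `[a, b], continuous (fun x : R => Re (G (x +i* y)))} /\
  {in `[a, b], continuous (fun x : R => Im (G (x +i* y)))}.
Proof.
by move=> H yP; split => x /[!in_itv]/= xP; have [] := cdiff_cont_h (H x y xP yP).
Qed.

Lemma cdiff_on_v G a b c d x : cdiff_on G a b c d -> a <= x <= b ->
  {in `[c, d], continuous (fun y : R => Re (G (x +i* y)))} /\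
  {in `[c, d], continuous (fun y : R => Im (G (x +i* y)))}.
Proof.
by move=> H xP; split => y /[!in_itv]/= yP; have [] := cdiff_cont_v (H x y xP yP).
Qed.

Lemma incontB a b (f g : R -> R) : {in `[a, b], continuous f} -> {in `[a, b], continuous g} ->
  {in `[a, b], continuous (fun x => f x - g x)}.
Proof. by move=> cf cg x xP; apply: cvgB; [exact: cf|exact: cg]. Qed.

Lemma boundary_int_splitx G a b c d e : a <= e <= b -> c <= d -> cdiff_on G a b c d ->
  boundary_int G a b c d = boundary_int G a e c d + boundary_int G e b c d.
Proof.
move=> /andP[ae eb] cd H; have ab := le_trans ae eb; rewrite /boundary_int.
have [c1 _] := @cdiff_on_h _ _ _ _ _ c H (introT andP (conj (lexx c) cd)).
have [d1 _] := @cdiff_on_h _ _ _ _ _ d H (introT andP (conj cd (lexx d))).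
have [_ b1] := @cdiff_on_v _ _ _ _ _ b H (introT andP (conj ab (lexx b))).
have [_ a1] := @cdiff_on_v _ _ _ _ _ a H (introT andP (conj (lexx a) ab)).
have [_ e1] := @cdiff_on_v _ _ _ _ _ e H (introT andP (conj ae eb)).
rewrite (rint_split ae eb); last exact: incontB.
rewrite [rint c d (fun y => Im (G (b +i* y)) - Im (G (a +i* y)))]rintB//.
rewrite [rint c d (fun y => Im (G (e +i* y)) - Im (G (a +i* y)))]rintB//.
rewrite [rint c d (fun y => Im (G (b +i* y)) - Im (G (e +i* y)))]rintB//.
ring.
Qed.

Lemma boundary_int_splity G a b c d e : c <= e <= d -> a <= b -> cdiff_on G a b c d ->
  boundary_int G a b c d = boundary_int G a b c e + boundary_int G a b e d.
Proof.
move=> /andP[ce ed] ab H; have cd := le_trans ce ed; rewrite /boundary_int.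
have [c1 _] := @cdiff_on_h _ _ _ _ _ c H (introT andP (conj (lexx c) cd)).
have [d1 _] := @cdiff_on_h _ _ _ _ _ d H (introT andP (conj cd (lexx d))).
have [e1 _] := @cdiff_on_h _ _ _ _ _ e H (introT andP (conj ce ed)).
have [_ b1] := @cdiff_on_v _ _ _ _ _ b H (introT andP (conj ab (lexx b))).
have [_ a1] := @cdiff_on_v _ _ _ _ _ a H (introT andP (conj (lexx a) ab)).
rewrite (rint_split ce ed); last exact: incontB.
rewrite [rint a b (fun x => Re (G (x +i* c)) - Re (G (x +i* d)))]rintB//.
rewrite [rint a b (fun x => Re (G (x +i* c)) - Re (G (x +i* e)))]rintB//.
rewrite [rint a b (fun x => Re (G (x +i* e)) - Re (G (x +i* d)))]rintB//.
ring.
Qed.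

(** The linear part of [G] contributes [Im D] times the area to both integrals and cancels. What
    remains is of smaller order than the diameter, integrated over the perimeter. *)
Lemma boundary_int_local G x y : cdiff G (x +i* y) ->
  forall e : R, 0 < e -> exists2 dl : R, 0 < dl &
    forall a b c d, a <= x <= b -> c <= y <= d -> b - a < dl -> d - c < dl ->
      cdiff_on G a b c d ->
      `|boundary_int G a b c d| <= e * ((b - a) ^+ 2 + (d - c) ^+ 2).
Proof.
(* The error [e / 4] at one point becomes [e / 2] between two points of the boundary, and
   [(l + m) ^+ 2 <= 2 * (l ^+ 2 + m ^+ 2)] uses up the rest. *)
move=> [D GD] e e0; have [dl dl0 H] := GD _ (divr_gt0 e0 (ltr0n _ 4)).
exists (dl / 2); first by rewrite divr_gt0.
move=> a b c d xP yP lb ld on.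
have [ax xb] := andP xP; have [cy yd] := andP yP.
have ab := le_trans ax xb; have cd := le_trans cy yd.
set l := b - a in lb *; set m := d - c in ld *.
have l0 : 0 <= l by rewrite subr_ge0.
have m0 : 0 <= m by rewrite subr_ge0.
have near z : a <= Re z <= b -> c <= Im z <= d ->
   normc (G z - G (x +i* y) - D * (z - (x +i* y))) <= e / 4 * (l + m).
  move=> /andP[z1 z2] /andP[z3 z4].
  have nz : normc (z - (x +i* y)) <= l + m.
    apply: (le_trans (normc_le _)).
    rewrite cReD cImD cReN cImN /= lerD// ler_norml /l /m; lra.
  have -> : G z = G (x +i* y + (z - (x +i* y))) by congr G; ring.
  rewrite (le_trans (H _ _))//; first by rewrite (le_lt_trans nz)//; lra.
  by rewrite ler_pM2l// divr_gt0.
have Re2 z w : a <= Re z <= b -> c <= Im z <= d -> a <= Re w <= b -> c <= Im w <= d ->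
   normc (G z - G w - D * (z - w)) <= e / 2 * (l + m).
  move=> z1 z2 w1 w2.
  have -> : G z - G w - D * (z - w) = (G z - G (x +i* y) - D * (z - (x +i* y)))
    - (G w - G (x +i* y) - D * (w - (x +i* y))) by ring.
  apply: (le_trans (normcB _ _)).
  have := near z z1 z2; have := near w w1 w2; lra.
have [c1 _] := @cdiff_on_h _ _ _ _ _ c on (introT andP (conj (lexx c) cd)).
have [d1 _] := @cdiff_on_h _ _ _ _ _ d on (introT andP (conj cd (lexx d))).
have [_ b1] := @cdiff_on_v _ _ _ _ _ b on (introT andP (conj ab (lexx b))).
have [_ a1] := @cdiff_on_v _ _ _ _ _ a on (introT andP (conj (lexx a) ab)).
have icst a' b' (k : R) : {in `[a', b'], continuous (fun _ : R => k)}.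
  by move=> ? _; exact: cvg_cst.
have I1 : `|rint a b (fun x => Re (G (x +i* c)) - Re (G (x +i* d))) - (Im D * m) * l| <=
    e / 2 * (l + m) * l.
  rewrite -[(Im D * m) * l]rint_cst// -rintB//; last exact: incontB.
  apply: rint_bound => //; first by apply: incontB => //; exact: incontB.
  move=> u uP.
  have := Re2 (u +i* c) (u +i* d) uP (introT andP (conj (lexx c) cd)) uP (introT andP (conj cd (lexx d))).
  apply: le_trans; apply: le_trans (normc_Re _).
  rewrite !(cReD, cReN, cReM) !(cImD, cImN)/=.
  rewrite subrr mulr0 sub0r opprK /m mulrBr opprB.
  rewrite le_eqVlt; apply/orP; left; apply/eqP; congr `| _ |; ring.
have I2 : `|rint c d (fun y => Im (G (b +i* y)) - Im (G (a +i* y))) - (Im D * l) * m| <=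
    e / 2 * (l + m) * m.
  rewrite -[(Im D * l) * m]rint_cst// -rintB//; last exact: incontB.
  apply: rint_bound => //; first by apply: incontB => //; exact: incontB.
  move=> u uP.
  have := Re2 (b +i* u) (a +i* u) (introT andP (conj ab (lexx b))) uP (introT andP (conj (lexx a) ab)) uP.
  apply: le_trans; apply: le_trans (normc_Im _).
  rewrite !(cImD, cImN, cImM) !(cReD, cReN, cImD, cImN)/=.
  rewrite le_eqVlt; apply/orP; left; apply/eqP; congr `| _ |; rewrite /l; ring.
rewrite /boundary_int; set A := rint _ _ _ in I1 *; set B := rint _ _ _ in I2 *.
have -> : A - B = (A - Im D * m * l) - (B - Im D * l * m) by ring.
apply: (le_trans (ler_normB _ _)); apply: (le_trans (lerD I1 I2)).
rewrite -subr_ge0.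
have -> : e * (l ^+ 2 + m ^+ 2) - (e / 2 * (l + m) * l + e / 2 * (l + m) * m) =
  e / 2 * (l - m) ^+ 2 by field.
by rewrite mulr_ge0 ?sqr_ge0// divr_ge0 ?ltW.
Qed.

Lemma goursat G a b c d : a <= b -> c <= d -> cdiff_on G a b c d ->
  boundary_int G a b c d = 0.
Proof.
move=> ab cd on.
suff H (e : R) : 0 < e -> `|boundary_int G a b c d| <= e * ((b - a) ^+ 2 + (d - c) ^+ 2).
  apply/eqP; rewrite -normr_le0; apply/ler_addgt0Pr => e e0; rewrite add0r.
  set K := (b - a) ^+ 2 + (d - c) ^+ 2 in H.
  have K0 : 0 <= K by rewrite addr_ge0 ?sqr_ge0.
  have K1 : 0 < K + 1 by lra.
  apply: (le_trans (H (e / (K + 1)) (divr_gt0 e0 K1))).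
  by rewrite mulrAC ler_pdivrMr// ler_pM2l//; lra.
move=> e0.
(* Containment in the original box travels inside [P], because box induction speaks of arbitrary
   boxes. The bound is exactly additive: the squared sides of four quarters sum to those of the
   whole. *)
pose P a' b' c' d' := a <= a' -> b' <= b -> c <= c' -> d' <= d ->
  `|boundary_int G a' b' c' d'| <= e * ((b' - a') ^+ 2 + (d' - c') ^+ 2).
suff : P a b c d by apply.
apply: box_induction => //.
  move=> a' b' c' d' ab' cd' /= p1 p2 p3 p4 aa bb cc dd.
  have ae : a' <= (a' + b') / 2 by lra.
  have eb : (a' + b') / 2 <= b' by lra.
  have cf : c' <= (c' + d') / 2 by lra.
  have fd : (c' + d') / 2 <= d' by lra.
  have on' : cdiff_on G a' b' c' d' by exact: cdiff_onS on _ _ _ _.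
  rewrite (@boundary_int_splitx _ _ _ _ _ ((a' + b') / 2))//; last by rewrite ae eb.
  rewrite (@boundary_int_splity _ _ ((a' + b') / 2) _ _ ((c' + d') / 2))//; first last.
  - by apply: (cdiff_onS on').
  - by rewrite cf fd.
  rewrite (@boundary_int_splity _ ((a' + b') / 2) _ _ _ ((c' + d') / 2))//; first last.
  - by apply: (cdiff_onS on').
  - by rewrite cf fd.
  have {}p1 := p1 aa (le_trans eb bb) cc (le_trans fd dd).
  have {}p2 := p2 (le_trans aa ae) bb cc (le_trans fd dd).
  have {}p3 := p3 aa (le_trans eb bb) (le_trans cc cf) dd.
  have {}p4 := p4 (le_trans aa ae) bb (le_trans cc cf) dd.
  apply: (le_trans (ler_normD _ _)).
  apply: (le_trans (lerD (ler_normD _ _) (ler_normD _ _))).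
  apply: (le_trans (lerD (lerD p1 p3) (lerD p2 p4))).
  rewrite le_eqVlt; apply/orP; left; apply/eqP; field => //.
move=> x y xP yP.
have [dl dl0 H] := boundary_int_local (on x y xP yP) e0.
exists dl => // a' b' c' d' x' y' lb ld aa bb cc dd.
by apply: H => //; exact: (cdiff_onS on).
Qed.

End Goursat.

(** * Means over circles and Cauchy's estimate *)

Section Circle.
Variable R : realType.
Implicit Types (H f : R[i] -> R[i]) (c z : R[i]) (r M : R).

Lemma cdiff_expC_comp H c u : cdiff H (c + expC u) -> cdiff (fun w => 'i * H (c + expC w)) u.
Proof.
move=> [D HD].
have h1 : cder (fun w => c + expC w) u (expC u).
  by have := cderD (cder_cst c u) (cder_expC u); rewrite add0r.
by exists ('i * (D * expC u)); apply: cderMl; exact: (cder_comp h1 HD).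
Qed.

(** The exponential wraps the rectangle [[a, b] x [0, 2 pi]] around an annulus centred at [c].
    Goursat's theorem on the rectangle, whose horizontal sides cancel by periodicity, equates the
    means over the two circles. The centre is never reached, so [H] may be singular there. *)
Lemma circle_mean_invariant H c (R0 : R) (a b : R) :
  (forall z, 0 < normc (z - c) < R0 -> cdiff H z) -> a <= b -> expR b < R0 ->
  rint 0 (2 * pi) (fun y => Re (H (c + expC (b +i* y)))) =
  rint 0 (2 * pi) (fun y => Re (H (c + expC (a +i* y)))) /\
  {in `[0, 2 * pi], continuous (fun y => Re (H (c + expC (b +i* y))))}.
Proof.
move=> cH ab bR0; set G := fun w => 'i * H (c + expC w).
have pi0 : 0 <= 2 * (pi : R) by rewrite mulr_ge0 ?pi_ge0.
have on : cdiff_on G a b 0 (2 * pi).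
  move=> x y /andP[ax xb] _; apply: cdiff_expC_comp; apply: cH.
  rewrite addrC addKr normc_expC expR_gt0/=.
  by rewrite (le_lt_trans _ bR0)// ler_expR.
have ReH z : Re (H (c + expC z)) = Im (G z).
  by rewrite /G cImM /=; ring.
have [_ b1] := @cdiff_on_v _ _ _ _ _ _ b on (introT andP (conj ab (lexx b))).
have [_ a1] := @cdiff_on_v _ _ _ _ _ _ a on (introT andP (conj (lexx a) ab)).
under eq_rint do rewrite ReH.
under [in X in _ = X]eq_rint do rewrite ReH.
split; last by move=> y yP; rewrite (_ : (fun _ => _) = (fun y => Im (G (b +i* y)))); [exact: b1|apply/funext => u; rewrite ReH].
have := goursat ab pi0 on; rewrite /boundary_int.
rewrite (@eq_rint _ _ _ _ (fun _ => 0)); last first.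
  move=> x _; rewrite (_ : G (x +i* 0) = G (x +i* (2 * pi))) ?subrr//.
  rewrite /G; congr (_ * H (c + _)); rewrite /expC /=.
  by rewrite cos0 sin0 mulr_natl cos2pi sin2pi.
rewrite (rint_cst _ ab) mul0r sub0r (rintB b1 a1) => /eqP.
by rewrite oppr_eq0 subr_eq0 => /eqP.
Qed.

(** The mean over a small circle is within [e] of [Re L] and equals the mean over the circle of
    radius [r]. Asking only for a limit at [c] lets difference quotients enter without removing
    their singularity. *)
Lemma circle_le H c (R0 r M : R) (L : R[i]) : 0 < r -> r < R0 ->
  (forall z, 0 < normc (z - c) < R0 -> cdiff H z) ->
  (forall e : R, 0 < e -> exists2 dl : R, 0 < dl &
     forall h, 0 < normc h < dl -> normc (H (c + h) - L) <= e) ->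
  (forall z, normc (z - c) = r -> Re (H z) <= M) -> Re L <= M.
Proof.
move=> r0 rR0 cH HL HM.
have tp : 0 < 2 * (pi : R) by rewrite mulr_gt0 ?pi_gt0.
have icst (k : R) : {in `[0, 2 * pi], continuous (fun _ : R => k)}.
  by move=> ? _; exact: cvg_cst.
apply/ler_addgt0Pr => e /HL[dl dl0 He].
have [s [s0 sr sd]] : exists s : R, [/\ 0 < s, s <= r & s < dl].
  exists (Num.min r (dl / 2)); split; first by rewrite lt_min r0 divr_gt0.
    by rewrite ge_min lexx.
  by rewrite (@le_lt_trans _ _ (dl / 2))//; [rewrite ge_min lexx orbT|lra].
have [Fr [Fs [E [cr cs] [HFr HFs]]]] : exists Fr Fs : R -> R,
   [/\ rint 0 (2 * pi) Fr = rint 0 (2 * pi) Fs,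
     {in `[0, 2 * pi], continuous Fr} /\ {in `[0, 2 * pi], continuous Fs} &
     (forall y, Fr y <= M) /\ (forall y, Re L - e <= Fs y)].
  exists (fun y => Re (H (c + expC (ln r +i* y)))), (fun y => Re (H (c + expC (ln s +i* y)))).
  have ab : ln s <= ln r by rewrite ler_ln ?posrE.
  have er : expR (ln r) < R0 by rewrite lnK ?posrE.
  have es : expR (ln s) < R0 by rewrite lnK ?posrE; first exact: le_lt_trans sr rR0.
  have [E cr] := circle_mean_invariant cH ab er.
  have [_ cs] := circle_mean_invariant cH (lexx (ln s)) es.
  split; [exact: E|split; [exact: cr|exact: cs]|split => y].
    by apply: HM; rewrite addrC addKr normc_expC /= lnK ?posrE.
  have sE : expR (ln s) = s by rewrite lnK ?posrE.
  have := He (expC (ln s +i* y)); rewrite normc_expC /= sE s0 sd => /(_ isT).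
  set X := H _; clearbody X.
  move=> /(le_trans (normc_Re _)); rewrite cReD cReN ler_norml => /andP[].
  clear; lra.
have h1 : rint 0 (2 * pi) Fr <= M * (2 * pi - 0).
  rewrite -rint_cst; last exact: ltW.
  by apply: rint_le.
have h2 : (Re L - e) * (2 * pi - 0) <= rint 0 (2 * pi) Fs.
  rewrite -rint_cst; last exact: ltW.
  by apply: rint_le.
rewrite E in h1; have := le_trans h2 h1; rewrite subr0 ler_pM2r//; lra.
Qed.

Lemma cder_punctured f c d : cder f c d -> forall e : R, 0 < e -> exists2 dl : R, 0 < dl &
  forall h, 0 < normc h < dl -> normc ((f (c + h) - f c) / (c + h - c) - d) <= e.
Proof.
move=> fd e e0; have [dl dl0 H] := fd e e0; exists dl => // h /andP[h0 /H].
rewrite (_ : c + h - c = h); last by rewrite addrAC subrr add0r.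
move=> {}H.
rewrite -(ler_pM2r h0) -normcM mulrBl divfK//.
by rewrite -normc_gt0.
Qed.

Lemma cdiffD f g z : cdiff f z -> cdiff g z -> cdiff (fun w => f w + g w) z.
Proof. by move=> [d fd] [d' gd]; exists (d + d'); exact: cderD. Qed.

Lemma cdiffB f g z : cdiff f z -> cdiff g z -> cdiff (fun w => f w - g w) z.
Proof. by move=> [d fd] [d' gd]; exists (d - d'); exact: cderB. Qed.

Lemma cdiffM f g z : cdiff f z -> cdiff g z -> cdiff (fun w => f w * g w) z.
Proof. by move=> [d fd] [d' gd]; eexists; exact: cderM fd gd. Qed.

Lemma cdiffV f z : f z != 0 -> cdiff f z -> cdiff (fun w => (f w)^-1) z.
Proof. by move=> fz [d fd]; eexists; exact: cderV fd. Qed.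

Lemma cdiff_cst (a : R[i]) z : cdiff (fun _ => a) z.
Proof. by exists 0; exact: cder_cst. Qed.

Lemma cdiff_id z : cdiff id z.
Proof. by exists 1; exact: cder_id. Qed.

Lemma cdiff_exp f z : cdiff f z -> cdiff (fun w => expC (f w)) z.
Proof. by move=> [d fd]; eexists; exact: cder_comp fd (cder_expC _). Qed.

Lemma cdiff_sum (I : Type) (s : seq I) (F : I -> R[i] -> R[i]) z :
  (forall i, cdiff (F i) z) -> cdiff (fun w => \sum_(i <- s) F i w) z.
Proof. by move=> /choice[D FD]; eexists; exact: cder_sum. Qed.

(** The rotated difference quotient [l * ((f z - f c) / (z - c))] tends to [normc d] at [c], and on
    the circle of radius [R0 / 2] its modulus is at most [2 * M / (R0 / 2)]. *)
Lemma cauchy_estimate f c (d : R[i]) (R0 M : R) : 0 < R0 ->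
  (forall z, normc (z - c) < R0 -> cdiff f z /\ normc (f z) <= M) ->
  cder f c d -> normc d <= 4 * M / R0.
Proof.
move=> R00 H fd; have [l l1 lE] := unimodular_factor d.
have -> : normc d = Re (l * d) by rewrite lE.
apply: (@circle_le (fun z => l * ((f z - f c) / (z - c))) c R0 (R0 / 2)).
- by rewrite divr_gt0.
- lra.
- move=> z /andP[z0 zR]; apply: cdiffM; first exact: cdiff_cst.
  apply: cdiffM; first by apply: cdiffB; [exact: (H z zR).1|exact: cdiff_cst].
  apply: cdiffV; first by rewrite -normc_gt0.
  by apply: cdiffB; [exact: cdiff_id|exact: cdiff_cst].
- move=> e /(cder_punctured fd)[dl dl0 {}H]; exists dl => // h /H.
  by rewrite -mulrBr normcM l1 mul1r.
move=> z zr; apply: (le_trans (ler_norm _)); apply: (le_trans (normc_Re _)).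
have zR : normc (z - c) < R0 by rewrite zr; lra.
have cR : normc (c - c) < R0 by rewrite subrr normc0.
rewrite normcM l1 mul1r normcM normcV zr invf_div mulrA.
rewrite ler_pM2r ?invr_gt0//.
have := normcB (f z) (f c); have := (H _ zR).2; have := (H _ cR).2; lra.
Qed.

Lemma cder_continuous_bounded f c : cdiff f c -> exists2 dl : R, 0 < dl &
  forall z, normc (z - c) < dl -> normc (f z) <= normc (f c) + 1.
Proof.
move=> [d /cder_cont/(_ 1 ltr01)[dl dl0 H]]; exists dl => // z /H.
rewrite (_ : c + (z - c) = z) => [/ltW h|]; last by rewrite addrC subrK.
have -> : f z = f c + (f z - f c) by rewrite addrC subrK.
by apply: (le_trans (normcD _ _)); rewrite lerD2l.
Qed.

(* The difference quotients [(f (z + h) - f z) / h] converge uniformly to [f'] near [c],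
   so by Cauchy's estimate their derivatives at [c] form a Cauchy family. *)
Lemma cdiff_derivative f f' c (R0 : R) : 0 < R0 ->
  (forall z, normc (z - c) < R0 -> cder f z (f' z)) -> cdiff f' c.
Proof.
move=> R00 ff'.
have [dl dl0 fM] : exists2 dl : R, 0 < dl &
  forall z, normc (z - c) < dl -> normc (f z) <= normc (f c) + 1.
  by apply: cder_continuous_bounded; exists (f' c); apply: ff'; rewrite subrr normc0.
(* Eight radii leave room for successive estimates on discs of radius [r]: [f] is controlled within
   [8 * r] of [c], [f'] within [7 * r], and the increments of [f'] within [5 * r]. *)
pose r := Num.min R0 dl / 8; set M := normc (f c) + 1 in fM.
have r0 : 0 < r by rewrite divr_gt0// lt_min R00.
have rR z : normc (z - c) < 8 * r -> normc (z - c) < R0 /\ normc (z - c) < dl.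
  by rewrite /r mulrC divfK// lt_min => /andP[].
have M0 : 0 <= M by rewrite addr_ge0 ?normc_ge0.
have tri z w : normc (z - c) <= normc (w - c) + normc (z - w).
  have -> : z - c = (w - c) + (z - w) by ring.
  exact: normcD.
pose M1 := 4 * M / r.
have f'M z : normc (z - c) < 7 * r -> normc (f' z) <= M1.
  move=> zr; apply: (@cauchy_estimate f z); first exact: r0.
    move=> w wz; have wc : normc (w - c) < 8 * r by have := tri w z; lra.
    have [h1 h2] := rR _ wc.
    by split; [exists (f' w); exact: ff'|exact: fM].
  by apply: ff'; have [] := rR z; lra.
have segment (z h : R[i]) (t : R) : 0 <= t <= 1 -> normc (z + t%:C * h - c) <= normc (z - c) + normc h.
  move=> /andP[t0 t1]; have -> : z + t%:C * h - c = (z - c) + t%:C * h by ring.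
  apply: (le_trans (normcD _ _)); rewrite lerD2l normcM normc_real ger0_norm//.
  by rewrite ler_piMl ?normc_ge0.
have fL z h : normc (z - c) + normc h < 7 * r -> normc (f (z + h) - f z) <= M1 * normc h.
  move=> zh; apply: (@cder_mvt _ f f') => t t01; have := segment z h t t01 => k.
  have k7 := le_lt_trans k zh.
  by split; [apply: ff'; have [] := rR (z + t%:C * h) _; lra|exact: f'M].
pose M2 := 4 * M1 / r.
have M10 : 0 <= M1 by apply: divr_ge0; [apply: mulr_ge0|exact: ltW].
have M20 : 0 <= M2 by apply: divr_ge0; [apply: mulr_ge0|exact: ltW].
have cder_shift (z h : R[i]) : normc (z + h - c) < 8 * r -> cder (fun w => f (w + h)) z (f' (z + h)).
  move=> zh; have h1 : cder (fun w : R[i] => w + h) z 1.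
    by have := cderD (cder_id z) (cder_cst h z); rewrite addr0.
  have h2 : cder f ((fun w : R[i] => w + h) z) (f' (z + h)) by apply: ff'; have [] := rR _ zh.
  by have := cder_comp h1 h2; rewrite mulr1.
have normc_shift (z h : R[i]) : normc (z + h - c) <= normc (z - c) + normc h.
  by rewrite addrAC normcD.
have f'L z h : normc (z - c) + normc h < 5 * r -> normc (f' (z + h) - f' z) <= M2 * normc h.
  move=> zh.
  have := @cauchy_estimate (fun w => f (w + h) - f w) z (f' (z + h) - f' z) r (M1 * normc h) r0.
  rewrite (_ : 4 * (M1 * normc h) / r = M2 * normc h); last by rewrite /M2; ring.
  apply.
    move=> w wz; have := tri w z; have := normc_shift w h => k1 k2; split.
      eexists; apply: cderB; first by apply: cder_shift; lra.
      by apply: ff'; have [] := rR w _; have := normc_ge0 h; lra.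
    by apply: fL; lra.
  apply: cderB; first by apply: cder_shift; have := normc_shift z h; lra.
  by apply: ff'; have [] := rR z _; have := normc_ge0 h; lra.
have fT z h : normc (z - c) + normc h < 5 * r ->
    normc (f (z + h) - f z - f' z * h) <= M2 * normc h * normc h.
  move=> zh.
  have := @cder_mvt _ (fun w => f w - f' z * w) (fun w => f' w - f' z) z h (M2 * normc h).
  have -> : f (z + h) - f' z * (z + h) - (f z - f' z * z) = f (z + h) - f z - f' z * h by ring.
  apply=> t t01; have := segment z h t t01 => k; split.
    apply: cderB; first by apply: ff'; have [] := rR (z + t%:C * h) _; lra.
    by have := cderMl (f' z) (cder_id (z + t%:C * h)); rewrite mulr1.
  case/andP: t01 => t0 t1.
  have th : normc (t%:C * h) <= normc h.
    by rewrite normcM normc_real ger0_norm// ler_piMl ?normc_ge0.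
  by apply: (le_trans (f'L _ _ _)); [lra|rewrite ler_wpM2l].
pose q h := (f' (c + h) - f' c) / h.
pose K := 4 * M2 / r.
have K0 : 0 <= K by apply: divr_ge0; [apply: mulr_ge0|exact: ltW].
(* [q h - q k] is the derivative at [c] of the difference of two difference quotients of [f]; by
   [fT] these are within [M2 * normc h] and [M2 * normc k] of [f']. *)
have qC h k : h != 0 -> k != 0 -> normc h < r -> normc k < r ->
   normc (q h - q k) <= K * normc h + K * normc k.
  move=> h0 k0 hr kr; rewrite -mulrDr.
  have := @cauchy_estimate (fun w => h^-1 * (f (w + h) - f w) - k^-1 * (f (w + k) - f w)) c
     (q h - q k) r (M2 * (normc h + normc k)) r0.
  rewrite /K (_ : 4 * (M2 * (normc h + normc k)) / r = 4 * M2 / r * (normc h + normc k)); last by ring.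
  apply.
    move=> w wc; have k1 := normc_shift w h; have k2 := normc_shift w k; split.
      have cd : cdiff f w by exists (f' w); apply: ff'; have [] := rR w _; lra.
      apply: cdiffB; (apply: cdiffM; first exact: cdiff_cst); apply: cdiffB => //.
        by eexists; apply: cder_shift; lra.
      by eexists; apply: cder_shift; lra.
    have -> : h^-1 * (f (w + h) - f w) - k^-1 * (f (w + k) - f w) =
      h^-1 * (f (w + h) - f w - f' w * h) - k^-1 * (f (w + k) - f w - f' w * k).
      by field; rewrite h0 k0.
    apply: (le_trans (normcB _ _)); rewrite (mulrDr M2) (normcM h^-1) (normcM k^-1) !normcV.
    apply: lerD; rewrite mulrC ler_pdivrMr ?normc_gt0//; apply: fT; lra.
  have cd : cder f c (f' c) by apply: ff'; rewrite subrr normc0.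
  have sh (x : R[i]) : normc x < r -> cder (fun w => f (w + x)) c (f' (c + x)).
    by move=> xr; apply: cder_shift; rewrite addrAC subrr add0r; lra.
  apply: cderB; rewrite /q mulrC; apply: cderMl; apply: cderB => //; exact: sh.
pose h0 : R[i] := (r / 2)%:C.
have h00 : h0 != 0 by rewrite -normc_gt0 normc_real normr_gt0 gt_eqF// divr_gt0.
have h0r : normc h0 < r.
  rewrite normc_real ger0_norm; first by clear -r0; lra.
  by apply: divr_ge0 => //; exact: ltW.
(* Each coordinate of the limit is the supremum of the lower bounds [p (q h) - K * normc h]; by [qC]
   these all lie below every upper bound [p (q k) + K * normc k]. *)
have lim (p : R[i] -> R) : (forall x y, p (x - y) = p x - p y) -> (forall z, `|p z| <= normc z) ->
  exists L : R, forall h, h != 0 -> normc h < r -> `|p (q h) - L| <= K * normc h.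
  move=> pB pN; pose S := [set x | exists h, [/\ h != 0, normc h < r & x = p (q h) - K * normc h]].
  exists (sup S) => h hn0 hr.
  have Sub x k : S x -> k != 0 -> normc k < r -> x <= p (q k) + K * normc k.
    move=> [k' [k'0 k'r ->]] kn0 kr; have := le_trans (pN _) (qC _ _ k'0 kn0 k'r kr).
    by rewrite pB ler_norml => /andP[]; lra.
  have S1 : sup S <= p (q h) + K * normc h.
    apply: ge_sup => [|x Sx]; last exact: Sub.
    by exists (p (q h) - K * normc h), h.
  have S2 : p (q h) - K * normc h <= sup S.
    apply: ub_le_sup; last by exists h.
    by exists (p (q h0) + K * normc h0) => x /Sub; apply.
  rewrite ler_norml; lra.
have [A AP] : exists L : R, forall h, h != 0 -> normc h < r -> `|Re (q h) - L| <= K * normc h.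
  by apply: lim => [x y|z]; [rewrite cReD cReN|exact: normc_Re].
have [B BP] : exists L : R, forall h, h != 0 -> normc h < r -> `|Im (q h) - L| <= K * normc h.
  by apply: lim => [x y|z]; [rewrite cImD cImN|exact: normc_Im].
exists (A +i* B) => e e0.
have K1 : 0 < 2 * K + 1 by lra.
exists (Num.min r (e / (2 * K + 1))); first by rewrite lt_min r0 divr_gt0.
move=> h; rewrite lt_min => /andP[hr]; rewrite ltr_pdivlMr// => he.
have [->|hn0] := eqVneq h 0; first by rewrite addr0 subrr mulr0 subr0 normc0 mulr0.
have -> : f' (c + h) - f' c - (A +i* B) * h = (q h - (A +i* B)) * h.
  by rewrite /q mulrBl divfK.
rewrite normcM ler_wpM2r ?normc_ge0//.
apply: (le_trans (normc_le _)); rewrite cReD cReN cImD cImN /=.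
have := AP _ hn0 hr; have := BP _ hn0 hr; have := normc_ge0 h; lra.
Qed.

End Circle.

(** * Maximum modulus principle *)

Section MaxModulus.
Variable R : realType.
Implicit Types (G f : R[i] -> R[i]) (a b c d M : R).

Lemma cdiff_cont2 G x y : cdiff G (x +i* y) ->
  {for (x, y), continuous (fun p : R * R => Re (G (p.1 +i* p.2)))}.
Proof.
move=> [D /cder_cont HD]; apply/cvgrPdist_lt => e e0 /=.
have [dl dl0 H] := HD e e0.
have d2 : 0 < dl / 2 by rewrite divr_gt0.
near=> p.
have p1 : `|x - p.1| < dl / 2.
  by near: p; exists (ball x (dl / 2), setT) => /=; [split; [exact: nbhsx_ballx|exact: filterT]|move=> [u v] /= []].
have p2 : `|y - p.2| < dl / 2.
  by near: p; exists (setT, ball y (dl / 2)) => /=; [split; [exact: filterT|exact: nbhsx_ballx]|move=> [u v] /= []].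
have hE : p.1 +i* p.2 = (x +i* y) + ((p.1 - x) +i* (p.2 - y)).
  by apply: complex_ext => /=; ring.
rewrite distrC -cReN -cReD (le_lt_trans (normc_Re _))//.
rewrite hE; apply: H; apply: (le_lt_trans (normc_le _)) => /=.
rewrite (distrC p.1) (distrC p.2); lra.
Unshelve. all: by end_near.
Qed.

Definition boundary a b c d (x y : R) := [|| x == a, x == b, y == c | y == d].

(** Adding [e * |z|^2] makes the rotated real part strictly subharmonic, so an interior maximum over
    the box would violate [circle_le]. Letting [e] tend to 0 removes the perturbation. *)
Lemma max_modulus G a b c d M : cdiff_on G a b c d ->
  (forall x y, a <= x <= b -> c <= y <= d -> boundary a b c d x y ->
     normc (G (x +i* y)) <= M) ->
  forall x y, a <= x <= b -> c <= y <= d -> normc (G (x +i* y)) <= M.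
Proof.
move=> on bM x0 y0 xP0 yP0; have [l l1 lE] := unimodular_factor (G (x0 +i* y0)).
pose B := `|a| ^+ 2 + `|b| ^+ 2 + `|c| ^+ 2 + `|d| ^+ 2.
have sqB x y : a <= x <= b -> c <= y <= d -> x ^+ 2 + y ^+ 2 <= B.
  have key (u v w : R) : u <= w <= v -> w ^+ 2 <= `|u| ^+ 2 + `|v| ^+ 2.
    move=> /andP[uw wv]; rewrite !real_normK ?num_real//.
    have [w0|w0] := leP 0 w.
      by rewrite (@le_trans _ _ (v ^+ 2))// ?lerDr ?sqr_ge0//; nra.
    by rewrite (@le_trans _ _ (u ^+ 2))// ?lerDl ?sqr_ge0//; nra.
  by move=> /key h1 /key h2; rewrite /B; lra.
have B0 : 0 <= B by rewrite /B !addr_ge0// exprn_ge0.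
suff key (e : R) : 0 < e -> normc (G (x0 +i* y0)) <= M + e * (B + 1).
  apply/ler_addgt0Pr => e e0.
  have := key (e / (B + 1)); rewrite divfK ?gt_eqF ?ltr_wpDl//.
  by apply; rewrite divr_gt0// ltr_wpDl.
move=> e0.
pose u (p : R * R) := Re (l * G (p.1 +i* p.2)) + e * (p.1 ^+ 2 + p.2 ^+ 2).
have lG z : cdiff G z -> cdiff (fun w => l * G w) z.
  by apply: cdiffM; exact: cdiff_cst.
have [[x1 y1] inA umax] : exists2 p, p \in (`[a, b] `*` `[c, d]) &
    forall q, q \in (`[a, b] `*` `[c, d]) -> u q <= u p.
  apply: compact_EVT_max.
  - by exists (x0, y0); split; rewrite /= in_itv.
  - by apply: compact_setX; exact: segment_compact.
  apply: continuous_in_subspaceT => -[x y]; rewrite inE => -[/=].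
  rewrite !in_itv/= => xP yP; apply: cvgD.
    exact: (@cdiff_cont2 (fun w => l * G w) x y (lG _ (on x y xP yP))).
  apply: cvgM; first exact: cvg_cst.
  by apply: cvgD; apply: cvgM; (exact: cvg_fst || exact: cvg_snd).
move: inA; rewrite inE => -[/=]; rewrite !in_itv/= => xP1 yP1.
have uG x y : a <= x <= b -> c <= y <= d -> u (x, y) <= u (x1, y1).
  by move=> xP yP; apply: umax; rewrite inE; split; rewrite /= in_itv.
have G0 : normc (G (x0 +i* y0)) <= u (x1, y1).
  apply: le_trans (uG _ _ xP0 yP0); rewrite /u /= lE /= lerDl.
  by rewrite mulr_ge0 ?addr_ge0 ?sqr_ge0// ltW.
have [bd|] := boolP (boundary a b c d x1 y1).
  apply: (le_trans G0); rewrite /u /= lerD//.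
    apply: le_trans (bM _ _ xP1 yP1 bd).
    apply: (le_trans (ler_norm _)); apply: (le_trans (normc_Re _)).
    by rewrite normcM l1 mul1r.
  by rewrite ler_pM2l//; have := sqB _ _ xP1 yP1; lra.
rewrite !negb_or => /and4P[xa xb yc yd]; exfalso.
have {xa}ax : a < x1 by rewrite lt_neqAle eq_sym xa; case/andP: xP1.
have {xb}xb : x1 < b by rewrite lt_neqAle xb; case/andP: xP1.
have {yc}cy : c < y1 by rewrite lt_neqAle eq_sym yc; case/andP: yP1.
have {yd}yd : y1 < d by rewrite lt_neqAle yd; case/andP: yP1.
pose r := Num.min (Num.min (x1 - a) (b - x1)) (Num.min (y1 - c) (d - y1)).
have r0 : 0 < r by rewrite !lt_min !subr_gt0 ax xb cy yd.
pose p := x1 +i* y1.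
have inbox z : normc (z - p) <= r -> a <= Re z <= b /\ c <= Im z <= d.
  rewrite !le_min => /andP[/andP[h1 h2] /andP[h3 h4]].
  have := normc_Re (z - p); have := normc_Im (z - p).
  rewrite cReD cReN cImD cImN /= !ler_norml; split; lra.
(* [q] is [2 * e] times the conjugate of [p], so that up to a constant [Re (K z)] is [u] minus
   [e * |z - p|^2]: at a maximum [p] of [u], it drops by a fixed amount on a circle around [p]. *)
pose q : R[i] := (2 * e * x1) -i* (2 * e * y1).
pose K z := l * G z + q * z.
have onK z : normc (z - p) <= r -> cdiff K z.
  move=> /inbox[h1 h2]; apply: cdiffD; last by apply: cdiffM; [exact: cdiff_cst|exact: cdiff_id].
  by apply: lG; case: z h1 h2 => x y; exact: on.
have KE z : Re (K z) = u (Re z, Im z) + e * (x1 ^+ 2 + y1 ^+ 2) - e * normc (z - p) ^+ 2.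
  rewrite /K /u /= (_ : Re z +i* Im z = z); last by case: z.
  rewrite normc_sqrE !(cReD, cReM, cReN, cImD, cImN) /=; ring.
suff : Re (K p) <= Re (K p) - e * (r / 2) ^+ 2.
  by rewrite lerDl oppr_ge0 leNgt mulr_gt0// exprn_gt0// divr_gt0.
apply: (@circle_le _ K p r (r / 2)); [by rewrite divr_gt0|lra| | |].
- by move=> z /andP[_ /ltW]; exact: onK.
- move=> e' e'0; have [|D /cder_cont/(_ e' e'0)[dl dl0 H]] := onK p.
    by rewrite subrr normc0 ltW.
  by exists dl => // h /andP[_ /H /ltW].
move=> z zr; rewrite [leLHS]KE [in leRHS]KE zr subrr normc0 expr0n /= mulr0 subr0.
rewrite lerD2r lerD2r; have [|h1 h2] := inbox z; first by rewrite zr; lra.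
exact: uG.
Qed.

(** The maximum principle for [f] times the exponential of [L * w + k * w^2], where
    [w = z - (s +i* t)]. The factor is 1 at the point of interest; [L] shifts weight between the
    vertical sides and a positive [k] damps the horizontal ones. *)
Lemma three_lines f a b c d (s t L k M : R) : cdiff_on f a b c d ->
  a <= s <= b -> c <= t <= d ->
  (forall x y, a <= x <= b -> c <= y <= d -> boundary a b c d x y ->
    normc (f (x +i* y)) * expR (L * (x - s) + k * ((x - s) ^+ 2 - (y - t) ^+ 2)) <= M) ->
  normc (f (s +i* t)) <= M.
Proof.
move=> on sP tP bM.
pose E (w : R[i]) : R[i] := expC (L%:C * (w - (s +i* t)) + k%:C * ((w - (s +i* t)) * (w - (s +i* t)))).
have NE x y : normc (E (x +i* y)) = expR (L * (x - s) + k * ((x - s) ^+ 2 - (y - t) ^+ 2)).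
  rewrite normc_expC; congr expR; rewrite !(cReD, cReM, cReN, cImD, cImN, cRe_real, cIm_real) /=.
  ring.
have -> : normc (f (s +i* t)) = normc ((fun w => f w * E w) (s +i* t)).
  by rewrite normcM NE !subrr !mulr0 addr0 expR0 mulr1.
apply: (@max_modulus (fun w => f w * E w) a b c d M _ _ s t) => //; last first.
  by move=> x y xP yP bd; rewrite normcM NE; exact: bM.
have cB z : cdiff (fun w => w - (s +i* t)) z by apply: cdiffB; [exact: cdiff_id|exact: cdiff_cst].
move=> x y xP yP; apply: cdiffM; first exact: on.
apply: cdiff_exp; apply: cdiffD; apply: cdiffM => //; try exact: cdiff_cst.
by apply: cdiffM.
Qed.

End MaxModulus.

(** * Growth of the zeta function and of its derivatives *)

Section Power.
Variable R : realType.
Implicit Types (s : R[i]) (x : R).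

(** The power [x ^ (- s)] for real [x > 0]; [zeta_term s n] is its value at [n + 1]. *)
Definition pw s x : R[i] := expC (- s * (ln x)%:C).

Lemma normc_pw s x : normc (pw s x) = expR (- Re s * ln x).
Proof. by rewrite normc_expC cReM cRe_real cIm_real mulr0 subr0 cReN. Qed.

Lemma pw_shift s x : 0 < x -> pw (s - 1) x = x%:C * pw s x.
Proof.
move=> x0; rewrite /pw.
have -> : - (s - 1) * (ln x)%:C = (ln x)%:C + - s * (ln x)%:C by ring.
rewrite expCD; congr (_ * _); rewrite /expC /= cos0 sin0 lnK ?posrE//.
by apply: complex_ext => /=; ring.
Qed.

Lemma pw1 s : pw s 1 = 1.
Proof. by rewrite /pw ln1 mulr0 expC0. Qed.

Lemma is_derive_pw s x : 0 < x ->
  is_derive x (1 : R) (fun u => Re (pw s u)) (Re (- s * pw s x * (x^-1)%:C)) /\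
  is_derive x (1 : R) (fun u => Im (pw s u)) (Im (- s * pw s x * (x^-1)%:C)).
Proof.
move=> x0.
have h1 : cder (fun w => expC (- s * w)) (0 + (ln x)%:C * 1) (expC (- s * (ln x)%:C) * - s).
  rewrite add0r mulr1.
  have h2 : cder (fun w => - s * w) (ln x)%:C (- s).
    by have := cderMl (- s) (cder_id (ln x)%:C); rewrite mulr1.
  exact: (cder_comp h2 (cder_expC _)).
have E : (fun u : R => expC (- s * (0 + u%:C * 1))) = (fun u => expC (- s * u%:C)).
  by apply/funext => u; rewrite add0r mulr1.
have [h2 h3] := cder_line h1.
have dl := is_derive1_ln x0.
have EV : expC (- s * (ln x)%:C) * - s * 1 * (x^-1)%:C = - s * pw s x * (x^-1)%:C.
  by rewrite /pw; ring.
split.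
- have := is_derive1_comp h2 dl.
  rewrite -EV [in X in _ -> X]cReM cRe_real cIm_real mulr0 subr0.
  rewrite (_ : _ \o _ = fun u => Re (pw s u)) //.
  by apply/funext => u; rewrite /= add0r mulr1.
- have := is_derive1_comp h3 dl.
  rewrite -EV [in X in _ -> X]cImM cRe_real cIm_real mulr0 add0r.
  rewrite (_ : _ \o _ = fun u => Im (pw s u)) //.
  by apply/funext => u; rewrite /= add0r mulr1.
Qed.

Lemma is_derive_rpow (r k x : R) : 0 < x ->
  is_derive x (1 : R) (fun u => k * expR (- r * ln u)) (k * (- r * expR (- r * ln x) / x)).
Proof.
move=> x0; have dl := is_derive1_ln x0.
have d1 := is_deriveZ (- r) dl.
have d2 := @is_derive1_comp _ expR (- r \*: @ln R) x _ _ (is_derive_expR (- r * ln x)) d1.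
have := is_deriveZ k d2; rewrite /GRing.scale /=.
by congr is_derive; ring.
Qed.

(** The derivative of [x ^ (- s)] has modulus [normc s * x ^ (- Re s - 1)], which is
    [normc s / Re s] times the rate of decrease of [x ^ (- Re s)]. *)
Lemma pw_variation s x y : 0 < Re s -> 0 < x -> x <= y ->
  normc (pw s y - pw s x) <=
  normc s / Re s * (expR (- Re s * ln x) - expR (- Re s * ln y)).
Proof.
move=> s0 x0 xy.
pose p u := - (normc s / Re s) * expR (- Re s * ln u).
have -> : normc s / Re s * (expR (- Re s * ln x) - expR (- Re s * ln y)) = p y - p x.
  by rewrite /p; ring.
apply: (@curve_mvt R (pw s) (fun t => - s * pw s t * (t^-1)%:C) p
  (fun u => - (normc s / Re s) * (- Re s * expR (- Re s * ln u) / u)) x y xy).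
move=> t /andP[xt ty].
have t0 : 0 < t by exact: lt_le_trans xt.
have [h1 h2] := is_derive_pw s t0.
split; [exact: h1|exact: h2|exact: is_derive_rpow|].
rewrite normcM normcM normcN normc_pw normc_real ger0_norm ?invr_ge0 ?(ltW t0)//.
rewrite le_eqVlt; apply/orP; left; apply/eqP.
set E := expR _; clearbody E; field; rewrite !gt_eqF//.
Qed.

Lemma is_derive_affine_curve (A B q' : R[i]) (q : R -> R[i]) (t : R) :
  is_derive t (1 : R) (fun u => Re (q u)) (Re q') ->
  is_derive t (1 : R) (fun u => Im (q u)) (Im q') ->
  is_derive t (1 : R) (fun u => Re (u%:C * A - B * q u)) (Re (A - B * q')) /\
  is_derive t (1 : R) (fun u => Im (u%:C * A - B * q u)) (Im (A - B * q')).
Proof.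
move=> h1 h2; have d := is_derive_id t (1 : R); split.
- have D := is_deriveB (is_deriveZ (Re A) d)
    (is_deriveB (is_deriveZ (Re B) h1) (is_deriveZ (Im B) h2)).
  rewrite (_ : (fun u => _) = (Re A \*: id) - (Re B \*: (fun u => Re (q u)) - Im B \*: (fun u => Im (q u)))).
    apply: is_derive_eq D _.
    rewrite cReD cReN cReM -[LHS]/(Re A * 1 - (Re B * Re q' - Im B * Im q')); ring.
  apply/funext => u; rewrite cReD cReN !cReM cRe_real cIm_real.
  rewrite -[RHS]/(Re A * u - (Re B * Re (q u) - Im B * Im (q u))); ring.
- have D := is_deriveB (is_deriveZ (Im A) d)
    (is_deriveD (is_deriveZ (Re B) h2) (is_deriveZ (Im B) h1)).
  rewrite (_ : (fun u => _) = (Im A \*: id) - (Re B \*: (fun u => Im (q u)) + Im B \*: (fun u => Re (q u)))).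
    apply: is_derive_eq D _.
    rewrite cImD cImN cImM -[LHS]/(Im A * 1 - (Re B * Im q' + Im B * Re q')); ring.
  apply/funext => u; rewrite cImD cImN !cImM cRe_real cIm_real.
  rewrite -[RHS]/(Im A * u - (Re B * Im (q u) + Im B * Re (q u))); ring.
Qed.

(* [(n + 1) ^ (- s)] minus the integral of [x ^ (- s)] over [n + 1, n + 2]. *)
Definition em_term s (n : nat) : R[i] :=
  pw s n.+1%:R - (pw (s - 1) n.+2%:R - pw (s - 1) n.+1%:R) / (1 - s).

(** With [a = n + 1], the term is the increment over [[a, a + 1]] of
    [t * a ^ (- s) - t ^ (1 - s) / (1 - s)], whose derivative [a ^ (- s) - t ^ (- s)] is controlled
    by [pw_variation]. The bound telescopes and asks only for [0 < Re s], which opens the way past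
    the line Re s = 1. *)
Lemma em_term_bound s n : 0 < Re s -> s != 1 ->
  normc (em_term s n) <= normc s / Re s *
    (expR (- Re s * ln n.+1%:R) - expR (- Re s * ln n.+2%:R)).
Proof.
move=> s0 s1; set a : R := n.+1%:R; set b : R := n.+2%:R.
have a0 : 0 < a by rewrite ltr0n.
have ab : b = a + 1 by rewrite /b /a -[in LHS]addn1 natrD.
have ab' : a <= b by rewrite ab lerDl.
set K := _ * _.
have s1' : 1 - s != 0 by rewrite subr_eq0 eq_sym.
pose g t := t%:C * pw s a - (1 - s)^-1 * pw (s - 1) t.
have -> : em_term s n = g b - g a.
  rewrite /em_term /g -/a -/b ab rmorphD /=; ring.
have -> : K = K * b - K * a by rewrite -mulrBr ab addrAC subrr add0r mulr1.
apply: (@curve_mvt R g (fun t => pw s a - pw s t) (fun t => K * t) (fun => K) a b ab').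
move=> t /andP[at' tb].
have t0 : 0 < t by exact: lt_le_trans at'.
have [h1 h2] := is_derive_pw (s - 1) t0.
have E : pw s a - pw s t = pw s a - (1 - s)^-1 * (- (s - 1) * pw (s - 1) t * (t^-1)%:C).
  rewrite (pw_shift _ t0) opprB.
  have -> : (1 - s)^-1 * ((1 - s) * (t%:C * pw s t) * (t^-1)%:C) =
     ((1 - s)^-1 * (1 - s)) * (pw s t * (t%:C * (t^-1)%:C)) by ring.
  by rewrite mulVf// -rmorphM /= divff ?gt_eqF// mul1r rmorph1 mulr1.
split.
- rewrite E; exact: (is_derive_affine_curve _ _ h1 h2).1.
- rewrite E; exact: (is_derive_affine_curve _ _ h1 h2).2.
- have := is_deriveZ K (is_derive_id t (1 : R)).
  by rewrite /GRing.scale/= mulr1.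
rewrite normcBC; apply: (le_trans (pw_variation s0 a0 at')).
rewrite /K ler_wpM2l ?divr_ge0 ?normc_ge0 ?(ltW s0)//.
rewrite lerD2l lerN2 ler_expR !mulNr lerN2 ler_pM2l//.
by rewrite ler_ln ?posrE// (lt_le_trans t0).
Qed.

Definition em_sum (N : nat) s := \sum_(0 <= n < N) em_term s n.

Lemma em_sum_diff N M s : 0 < Re s -> s != 1 -> (N <= M)%N ->
  normc (em_sum M s - em_sum N s) <= normc s / Re s * expR (- Re s * ln N.+1%:R).
Proof.
move=> s0 s1 NM; rewrite /em_sum (big_cat_nat (leq0n N) NM)/= addrAC subrr add0r.
apply: (le_trans (normc_sum _ _ _)).
apply: (@le_trans _ _ (\sum_(N <= n < M) (normc s / Re s *
    (expR (- Re s * ln n.+1%:R) - expR (- Re s * ln n.+2%:R))))).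
  by apply: ler_sum => n _; exact: em_term_bound.
rewrite -mulr_sumr ler_wpM2l ?divr_ge0 ?normc_ge0 ?(ltW s0)//.
have := telescope_sumr (fun n : nat => - expR (- Re s * ln n.+1%:R)) NM.
rewrite (eq_bigr (fun n : nat => expR (- Re s * ln n.+1%:R) - expR (- Re s * ln n.+2%:R))).
  by move=> ->; rewrite opprK gerDr oppr_le0 expR_ge0.
by move=> i _; rewrite opprK addrC.
Qed.

Lemma em_sum_bound N s : 0 < Re s -> s != 1 -> normc (em_sum N s) <= normc s / Re s.
Proof.
move=> s0 s1; have := em_sum_diff s0 s1 (leq0n N).
have E0 : em_sum 0 s = 0 by rewrite /em_sum big_geq.
by rewrite E0 subr0 ln1 mulr0 expR0 mulr1.
Qed.

Lemma em_sumE N s : s != 1 ->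
  em_sum N s = series (zeta_term s) N - (pw (s - 1) N.+1%:R - 1) / (1 - s).
Proof.
move=> s1; rewrite /em_sum sumrB /series; congr (_ - _).
have := telescope_sumr (fun n : nat => pw (s - 1) n.+1%:R) (leq0n N).
rewrite pw1 => <-; by rewrite mulr_suml.
Qed.

Lemma cdiff_pw x z : cdiff (fun s => pw s x) z.
Proof.
apply: cdiff_exp; apply: cdiffM; last exact: cdiff_cst.
by exists (-1); apply: cderN; exact: cder_id.
Qed.

Lemma cdiff_em_sum N z : z != 1 -> cdiff (em_sum N) z.
Proof.
move=> z1; apply: cdiff_sum => n.
have sB : cdiff (fun s : R[i] => s - 1) z by apply: cdiffB; [exact: cdiff_id|exact: cdiff_cst].
have pB x : cdiff (fun s => pw (s - 1) x) z.
  have [d hd] := sB; have [d' hd'] := cdiff_pw x (z - 1).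
  by exists (d' * d); exact: (cder_comp hd hd').
apply: cdiffB; first exact: cdiff_pw.
apply: cdiffM; first exact: cdiffB.
apply: cdiffV; first by rewrite subr_eq0 eq_sym.
by apply: cdiffB; [exact: cdiff_cst|exact: cdiff_id].
Qed.

End Power.

Section LocallyBounded.
Variable R : realType.

Lemma cdiff_on_bounded (f : R[i] -> R[i]) (a b c d : R) : a <= b -> c <= d ->
  cdiff_on f a b c d -> exists M : R, forall x y, a <= x <= b -> c <= y <= d ->
    normc (f (x +i* y)) <= M.
Proof.
move=> ab cd on.
pose P a' b' c' d' := exists M : R, forall x y : R, a <= x <= b -> c <= y <= d ->
  a' <= x <= b' -> c' <= y <= d' -> normc (f (x +i* y)) <= M.
suff [M MP] : P a b c d by exists M => x y xP yP; exact: MP.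
apply: box_induction => //.
  move=> a' b' c' d' ab' cd' /= [M1 h1] [M2 h2] [M3 h3] [M4 h4].
  exists (Num.max (Num.max M1 M2) (Num.max M3 M4)) => x y xP yP /andP[ax xb] /andP[cy yd].
  rewrite !le_max.
  have [xe|ex] := leP x ((a' + b') / 2); have [ye|ey] := leP y ((c' + d') / 2).
  - by rewrite h1 ?ax ?cy ?xe ?ye.
  - by rewrite h3 ?orbT ?ax ?yd ?xe// ltW.
  - by rewrite h2 ?orbT ?xb ?cy ?ye ?andbT// ltW.
  - by rewrite h4 ?orbT// ?xb ?yd ?andbT ltW.
move=> x y xP yP; have [dl dl0 H] := cder_continuous_bounded (on x y xP yP).
exists (dl / 2); first by rewrite divr_gt0.
move=> a' b' c' d' xP' yP' lb ld; exists (normc (f (x +i* y)) + 1).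
move=> u v uP vP uP' vP'; apply: H; apply: (le_lt_trans (normc_le _)).
rewrite cReD cReN cImD cImN /=.
have h1 : `|u - x| <= b' - a' by rewrite ler_norml; lra.
have h2 : `|v - y| <= d' - c' by rewrite ler_norml; lra.
lra.
Qed.

Lemma rpow_small (c e : R) : 0 < c -> 0 < e ->
  exists N0 : nat, forall N, (N0 <= N)%N -> expR (- c * ln N.+1%:R) <= e.
Proof.
move=> c0 e0; exists (Num.truncn (expR (- ln e / c))).+1 => N h.
rewrite -[leRHS]lnK ?posrE// ler_expR mulNr lerNl mulrC -ler_pdivrMr//.
rewrite -[leLHS]expRK ler_ln ?posrE ?expR_gt0 ?ltr0n//.
apply: ltW; apply: (lt_trans (truncnS_gt _)).
by rewrite ltr_nat ltnS.
Qed.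

End LocallyBounded.

Section ZetaBounds.
Variables (R : realType) (zeta : R[i]^o -> R[i]^o).
Hypothesis zetaP : is_riemann_zeta zeta.
Implicit Types s : R[i].

Lemma cdiff_zeta s : s != 1 -> cdiff zeta s.
Proof.
case: zetaP => _ /[apply] /derivableP h.
by exists ('D_1 zeta s); apply/cder_is_derive.
Qed.

Lemma zeta_series_approx s (e : R) : 1 < Re s -> 0 < e ->
  exists N0 : nat, forall N, (N0 <= N)%N -> normc (zeta s - series (zeta_term s) N) <= e.
Proof.
case: zetaP => H _ /H/cvgrPdist_le /(_ e%:C); rewrite ltcR => {}H /H[N0 _ HN].
by exists N0 => N /HN h; rewrite -lecR; exact: h.
Qed.

(** By [em_sumE], [em_sum M s] tends to [zeta s - (s - 1)^-1], since the power of [M + 1] vanishes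
    in the limit for [1 < Re s]; the bound is [em_sum_diff] in the limit. *)
Lemma zeta_em_tail s N : 1 < Re s ->
  normc (zeta s - (s - 1)^-1 - em_sum N s) <= normc s / Re s * expR (- Re s * ln N.+1%:R).
Proof.
move=> s1; have s0 : 0 < Re s by rewrite (lt_trans _ s1).
have sn1 : s != 1 by apply: contraTneq s1 => -> /=; rewrite ltxx.
have sn1' : 1 - s != 0 by rewrite subr_eq0 eq_sym.
apply/ler_addgt0Pr => e e0; have e2 : 0 < e / 2 by rewrite divr_gt0.
have [N1 H1] := zeta_series_approx s1 e2.
have d0 : 0 < Re s - 1 by rewrite subr_gt0.
have e3 : 0 < e / 2 * normc (1 - s) by rewrite mulr_gt0// normc_gt0.
have [N2 H2] := rpow_small d0 e3.
pose M := maxn N (maxn N1 N2).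
have NM : (N <= M)%N by rewrite leq_maxl.
have {}H1 : normc (zeta s - series (zeta_term s) M) <= e / 2.
  by apply: H1; rewrite /M !leq_max leqnn !orbT.
have {H2}H3 : normc (pw (s - 1) M.+1%:R / (1 - s)) <= e / 2.
  rewrite normcM normcV ler_pdivrMr ?normc_gt0// normc_pw cReD cReN /=.
  by apply: H2; rewrite /M !leq_max leqnn !orbT.
have -> : zeta s - (s - 1)^-1 - em_sum N s = (zeta s - series (zeta_term s) M) +
    pw (s - 1) M.+1%:R / (1 - s) + (em_sum M s - em_sum N s).
  rewrite (_ : (s - 1)^-1 = - (1 - s)^-1); last by rewrite -invrN opprB.
  rewrite (em_sumE M sn1); ring.
apply: (le_trans (normcD _ _)); rewrite addrC lerD//; first exact: em_sum_diff.
apply: (le_trans (normcD _ _)); rewrite (splitr e) lerD//.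
Qed.

(** The terms are dominated by those at the real point [Re s], where [em_sum] is at most 1 and the
    telescoped integrals at most [2 / (Re s - 1)]. *)
Lemma zeta_right_bound s : 1 < Re s -> normc (zeta s) <= 1 + 2 / (Re s - 1).
Proof.
move=> s1; apply/ler_addgt0Pr => e e0.
have [N HN] := zeta_series_approx s1 e0.
have -> : zeta s = (zeta s - series (zeta_term s) N) + series (zeta_term s) N by rewrite subrK.
apply: (le_trans (normcD _ _)); rewrite addrC lerD//; last exact: HN.
set r := Re s in s1 *; have r1 : r%:C != 1 :> R[i].
  by rewrite eq_complex /= negb_and gt_eqF.
have h : normc (series (zeta_term s) N) <= normc (series (zeta_term r%:C) N).
  rewrite /series /=; apply: (le_trans (normc_sum _ _ _)).
  have E n : zeta_term r%:C n = (expR (- r * ln n.+1%:R))%:C.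
    rewrite /zeta_term /expC cReM cImM cReN cImN !cRe_real !cIm_real.
    rewrite !(mulr0, mul0r, oppr0, subr0, addr0) cos0 sin0; apply: complex_ext => /=; ring.
  rewrite (eq_bigr (fun n => (expR (- r * ln n.+1%:R))%:C)) => [|n _]; last exact: E.
  rewrite -(rmorph_sum (real_complex R)) [leRHS]normc_real.
  rewrite ger0_norm; last by apply: sumr_ge0 => n _; exact: expR_ge0.
  apply: ler_sum => n _; rewrite /zeta_term normc_expC cReM cRe_real cIm_real mulr0 subr0 cReN.
  exact: lexx.
apply: (le_trans h).
have -> : series (zeta_term r%:C) N = em_sum N r%:C + (pw (r%:C - 1) N.+1%:R - 1) / (1 - r%:C).
  by rewrite em_sumE// subrK.
apply: (le_trans (normcD _ _)); apply: lerD.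
  have r0 : 0 < r by exact: lt_trans s1.
  have := @em_sum_bound R N r%:C r0 r1; rewrite cRe_real normc_real.
  by rewrite gtr0_norm// divff// gt_eqF.
rewrite normcM normcV (_ : 1 - r%:C = (1 - r)%:C); last by rewrite rmorphB rmorph1.
have -> : normc (1 - r)%:C = r - 1 by rewrite normc_real distrC gtr0_norm// subr_gt0.
rewrite ler_pM2r ?invr_gt0 ?subr_gt0//; apply: (le_trans (normcB _ _)).
have -> : (2 : R) = 1 + 1 by [].
rewrite lerD//; last by rewrite normc1.
rewrite normc_pw cReD cReN cRe_real -[leRHS]expR0 ler_expR mulNr oppr_le0 mulr_ge0//.
  by rewrite subr_ge0 ltW.
by apply: ln_ge0; rewrite -[leLHS]/(1%:R) ler_nat.
Qed.

(* The identity theorem made quantitative: [zeta z - (z - 1)^-1 - em_sum N z] is bounded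
   on a box around [s] and tends to 0 on its part [1 < Re z]; the exponential weight in
   [three_lines] carries the smallness over to [s]. *)
Lemma zeta_em_approx s (e : R) : 1 / 4 <= Re s <= 1 -> 3 <= `|Im s| -> 0 < e ->
  exists N, normc (zeta s - (s - 1)^-1 - em_sum N s) <= e.
Proof.
case: s => s t /= sP tP e0.
have ne1 x y : t - 2 <= y <= t + 2 -> x +i* y != 1 :> R[i].
  move=> yP; rewrite eq_complex /= negb_and; apply/orP; right.
  apply/eqP => y0; rewrite y0 in yP; move: tP; rewrite leNgt => /negP; apply.
  rewrite ltr_norml; lra.
pose g z := zeta z - (z - 1)^-1.
have cg z : z != 1 -> cdiff g z.
  move=> z1; apply: cdiffB; first exact: cdiff_zeta.
  apply: cdiffV; first by rewrite subr_eq0.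
  by apply: cdiffB; [exact: cdiff_id|exact: cdiff_cst].
have ong : cdiff_on g (1/8) 2 (t - 2) (t + 2).
  by move=> x y _ yP; apply: cg; exact: ne1.
have [M MP] : exists M : R, forall x y, 1/8 <= x <= 2 -> t - 2 <= y <= t + 2 ->
   normc (g (x +i* y)) <= M.
  by apply: cdiff_on_bounded => //; lra.
pose S : R := 8 * (2 + (`|t| + 2)).
have SP x y : 1/8 <= x <= 2 -> t - 2 <= y <= t + 2 -> normc (x +i* y) / x <= S.
  move=> xP yP; have x0 : 0 < x by lra.
  have h1 : normc (x +i* y) <= 2 + (`|t| + 2).
    apply: (le_trans (normc_le _)) => /=; apply: lerD.
      by rewrite ger0_norm; lra.
    have -> : y = t + (y - t) by ring.
    by apply: (le_trans (ler_normD _ _)); rewrite lerD2l ler_norml; lra.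
  rewrite ler_pdivrMr// (le_trans h1)// /S.
  have : 0 <= 2 + (`|t| + 2) by have := normr_ge0 t; lra.
  nra.
have S0 : 0 < S by rewrite /S; have := normr_ge0 t; lra.
have M0 : 0 <= M by apply: le_trans (MP 1 t _ _); [exact: normc_ge0|lra|lra].
have MS : 0 < M + S by lra.
(* On the part [x <= 11/10] of the boundary the weight has exponent at most [- X / 16]: on the left
   side [x - s <= - 1 / 8], and on the horizontal sides [(y - t) ^+ 2 = 4]. *)
have [X X0 XP] : exists2 X : R, 0 <= X & (M + S) * expR (- X / 16) <= e.
  exists (16 * `|ln (e / (M + S))|); first by rewrite mulr_ge0.
  rewrite mulrC -ler_pdivlMr// -[leRHS]lnK ?posrE ?divr_gt0// ler_expR.
  set l := ln _; clearbody l; have -> : - (16 * `|l|) / 16 = - `|l| by field.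
  by rewrite lerNl -normrN ler_norm.
(* [N] is chosen after [X]: for [x > 11/10] the weight may reach [expR (4 * X)], which the tail, at
   most [S / (N + 1)], has to beat. *)
have [N NP] : exists N, S * expR (- ln N.+1%:R) * expR (4 * X) <= e.
  have d0 : 0 < e / (S * expR (4 * X)) by rewrite divr_gt0// mulr_gt0// expR_gt0.
  have [N0 HN] := rpow_small ltr01 d0.
  exists N0; have := HN _ (leqnn N0); rewrite mulN1r ler_pdivlMr ?mulr_gt0 ?expR_gt0//.
  by rewrite mulrCA mulrA.
exists N.
have s1 : s +i* t != 1 :> R[i] by apply: ne1; lra.
pose f z := g z - em_sum N z.
have onf : cdiff_on f (1/8) 2 (t - 2) (t + 2).
  by move=> x y xP yP; apply: cdiffB; [exact: ong|apply: cdiff_em_sum; exact: ne1].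
apply: (@three_lines R f (1/8) 2 (t - 2) (t + 2) s t X (X / 2)) => //; [lra|lra|].
move=> x y xP yP bd.
have [x1|x1] := leP x (11/10).
  apply: le_trans XP; apply: ler_pM; rewrite ?normc_ge0 ?expR_ge0//.
    apply: (le_trans (normcB _ _)); apply: lerD; first exact: MP.
    apply: (le_trans _ (SP x y xP yP)).
    by apply: em_sum_bound => /=; [lra|exact: ne1].
  rewrite ler_expR.
  have -> : X * (x - s) + X / 2 * ((x - s) ^+ 2 - (y - t) ^+ 2) =
    X * ((x - s) + ((x - s) ^+ 2 - (y - t) ^+ 2) / 2) by field.
  rewrite mulNr -mulrN ler_wpM2l//.
  case/or4P: bd => /eqP E.
  - by rewrite E; have := sqr_ge0 (y - t); nra.
  - by rewrite E in x1; lra.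
  - by rewrite E; nra.
  - by rewrite E; nra.
apply: le_trans NP; apply: ler_pM; rewrite ?normc_ge0 ?expR_ge0//.
  have x1' : 1 < Re (x +i* y) by rewrite /=; lra.
  apply: (le_trans (zeta_em_tail N x1')); apply: ler_pM; [|exact: expR_ge0|exact: SP|].
    by apply: divr_ge0; [exact: normc_ge0|rewrite /=; lra].
  rewrite ler_expR -[leRHS]mulN1r; apply: ler_wpM2r; last by rewrite /=; lra.
  by apply: ln_ge0; rewrite -[leLHS]/(1%:R) ler_nat.
rewrite ler_expR.
have -> : X * (x - s) + X / 2 * ((x - s) ^+ 2 - (y - t) ^+ 2) =
    X * ((x - s) + ((x - s) ^+ 2 - (y - t) ^+ 2) / 2) by field.
rewrite mulrC ler_wpM2r//; have := sqr_ge0 (y - t); nra.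
Qed.

(** The bound [normc s / Re s] on [em_sum] is uniform in [N], hence passes to the limit, and is at
    most [8 * |Im s|] here; the pole term adds at most 1. *)
Lemma zeta_growth s : 1 / 4 <= Re s <= 3 -> 3 <= `|Im s| -> normc (zeta s) <= 9 * `|Im s|.
Proof.
move=> sP tP.
have s1 : s != 1 by apply: contraTneq tP => -> /=; rewrite normr0; lra.
have s0 : 0 < Re s by lra.
have inv1 : normc (s - 1)^-1 <= 1.
  rewrite normcV invf_le1; last by rewrite normc_gt0 subr_eq0.
  by apply: le_trans (normc_Im _); rewrite cImD cImN /= subr0; lra.
have ns : normc s / Re s <= 8 * `|Im s|.
  rewrite ler_pdivrMr//; apply: (le_trans (normc_le _)); rewrite gtr0_norm//; nra.
suff : normc (zeta s - (s - 1)^-1) <= normc s / Re s.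
  move=> h; rewrite -(subrK (s - 1)^-1 (zeta s)).
  by apply: (le_trans (normcD _ _)); lra.
apply/ler_addgt0Pr => e e0.
have [N HN] : exists N, normc (zeta s - (s - 1)^-1 - em_sum N s) <= e.
  have [s1'|s1'] := leP (Re s) 1; first by apply: zeta_em_approx => //; lra.
  have q0 : 0 < normc s / Re s.
    by rewrite divr_gt0// normc_gt0; apply: contraTneq s0 => ->; rewrite ltxx.
  have [N0 HN] := rpow_small s0 (divr_gt0 e0 q0); exists N0.
  apply: (le_trans (zeta_em_tail N0 s1')); have := HN _ (leqnn N0).
  by rewrite ler_pdivlMr// mulrC.
rewrite -(subrK (em_sum N s) (_ - _)); apply: (le_trans (normcD _ _)).
by rewrite addrC lerD//; exact: em_sum_bound.
Qed.

End ZetaBounds.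

Section Strip.
Variable R : realType.

(* Phragmen-Lindelof on a strip, reduced to a box around [t]: the weight
   [expR (c * ln |t| * (x - s))] interpolates between the vertical sides, and the Gaussian
   factor makes the horizontal sides negligible. *)
Lemma strip_bound (f : R[i] -> R[i]) (a b t0 A p q c m : R) : a <= b -> 1 <= t0 ->
  0 <= A -> 0 <= p -> 0 <= q -> 0 <= c -> 0 <= m ->
  (forall x y : R, a <= x <= b -> t0 <= `|y| -> cdiff f (x +i* y)) ->
  (forall x y : R, a <= x <= b -> t0 <= `|y| -> normc (f (x +i* y)) <= A * expR (ln `|y|)) ->
  (forall y, t0 <= `|y| -> normc (f (a +i* y)) <= A * expR (p * ln `|y|)) ->
  (forall y, t0 <= `|y| -> normc (f (b +i* y)) <= A * expR (q * ln `|y|)) ->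
  exists2 A' : R, 0 <= A' & forall s t : R, a <= s <= b -> 2 * t0 <= `|t| ->
    p - c * (s - a) <= m -> q + c * (b - s) <= m ->
    normc (f (s +i* t)) <= A' * expR (m * ln `|t|).
Proof.
move=> ab t01 A0 p0 q0 c0 m0 cf growth left right.
pose D := (b - a) ^+ 2; pose P := 1 + c * (b - a).
have D0 : 0 <= D by exact: sqr_ge0.
have P0 : 0 <= P by rewrite addr_ge0// mulr_ge0// subr_ge0.
(* The exponent collects all losses: [ln |y| <= ln |t| + 1] costs [p], [q] or 1, and [(x - s) ^+ 2]
   costs [D]. On the horizontal sides, [ln |t| <= 2 * h] and [2 * P * h - h ^+ 2 <= P ^+ 2]. *)
exists (A * expR (p + q + D + 1 + P ^+ 2)); first by rewrite mulr_ge0// expR_ge0.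
move=> s t sP tP pm qm.
pose h := `|t| / 2.
have h0 : 0 < h by rewrite divr_gt0//; lra.
have yh (y : R) : t - h <= y <= t + h -> t0 <= `|y| /\ `|y| <= 2 * `|t|.
  move=> yP; have yt : `|y - t| <= h by rewrite ler_norml; lra.
  have := ler_normD (y - t) t; rewrite subrK.
  have := ler_normD (t - y) y; rewrite subrK distrC; rewrite /h in yt *; lra.
have t1 : 1 <= `|t| by lra.
have T0 : 0 <= ln `|t| by exact: ln_ge0.
have Tt : ln `|t| <= `|t|.
  have := @le_ln1Dx R (`|t| - 1); rewrite (_ : 1 + (`|t| - 1) = `|t|); last by ring.
  by move=> h1; apply: (le_trans (h1 _)); lra.
have lny (y : R) : t0 <= `|y| -> `|y| <= 2 * `|t| -> 0 <= ln `|y| <= ln `|t| + 1.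
  move=> y1 y2; apply/andP; split; first by apply: ln_ge0; lra.
  apply: (@le_trans _ _ (ln (2 * `|t|))); first by rewrite ler_ln ?posrE//; lra.
  rewrite lnM ?posrE//; last by lra.
  rewrite addrC lerD2l; have := @le_ln1Dx R 1; apply; lra.
apply: (@three_lines R f a b (t - h) (t + h) s t (c * ln `|t|) 1) => //.
- move=> x y xP /yh[y1 _]; exact: cf.
- lra.
move=> x y xP yP bd; have [y1 y2] := yh y yP; have lP := lny y y1 y2.
have YT := (andP lP).2.
set T := ln `|t| in T0 Tt lP YT *; set Y := ln `|y| in lP YT *.
have fin B E : normc (f (x +i* y)) <= A * expR B -> B + E <= p + q + D + 1 + P ^+ 2 + m * T ->
   normc (f (x +i* y)) * expR E <= A * expR (p + q + D + 1 + P ^+ 2) * expR (m * T).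
  move=> h1 h2; apply: (@le_trans _ _ (A * expR B * expR E)).
    by rewrite ler_wpM2r ?expR_ge0.
  by rewrite -!mulrA -!expRD ler_wpM2l// ler_expR.
have xs : (x - s) ^+ 2 <= D by rewrite /D; nra.
have ys := sqr_ge0 (y - t).
have P2 := sqr_ge0 P.
case/or4P: bd => /eqP E.
- apply: (fin (p * Y)); first by rewrite E; exact: left.
  rewrite {1}E.
  have h1 : p * Y <= p * (T + 1) by rewrite ler_wpM2l.
  have h2 : (p - c * (s - a)) * T <= m * T by rewrite ler_wpM2r.
  clear -h1 h2 xs ys q0 P2; clearbody D P T Y; lra.
- apply: (fin (q * Y)); first by rewrite E; exact: right.
  rewrite {1}E.
  have h1 : q * Y <= q * (T + 1) by rewrite ler_wpM2l.
  have h2 : (q + c * (b - s)) * T <= m * T by rewrite ler_wpM2r.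
  clear -h1 h2 xs ys p0 P2; clearbody D P T Y; lra.
- apply: (fin Y); first exact: growth.
  have h1 : c * T * (x - s) <= c * T * (b - a).
    by rewrite ler_wpM2l ?mulr_ge0// lerB ?(andP xP).2 ?(andP sP).1.
  have h2 : (y - t) ^+ 2 = h ^+ 2 by rewrite E; ring.
  have h3 : P * T <= P * (2 * h) by rewrite ler_wpM2l// /h mulrC divfK.
  have h4 : 0 <= (P - h) ^+ 2 by exact: sqr_ge0.
  have h5 : 0 <= m * T by rewrite mulr_ge0.
  rewrite h2; rewrite /P in h3 h4 *.
  clear -h1 h3 h4 h5 xs YT p0 q0; clearbody D T Y h; nra.
- apply: (fin Y); first exact: growth.
  have h1 : c * T * (x - s) <= c * T * (b - a).
    by rewrite ler_wpM2l ?mulr_ge0// lerB ?(andP xP).2 ?(andP sP).1.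
  have h2 : (y - t) ^+ 2 = h ^+ 2 by rewrite E; ring.
  have h3 : P * T <= P * (2 * h) by rewrite ler_wpM2l// /h mulrC divfK.
  have h4 : 0 <= (P - h) ^+ 2 by exact: sqr_ge0.
  have h5 : 0 <= m * T by rewrite mulr_ge0.
  rewrite h2; rewrite /P in h3 h4 *.
  clear -h1 h3 h4 h5 xs YT p0 q0; clearbody D T Y h; nra.
Qed.

End Strip.

(** * Lindelof bounds for zeta and for its derivatives *)

Section ZetaDerivatives.
Variables (R : realType) (zeta : R[i]^o -> R[i]^o).
Hypothesis zetaP : is_riemann_zeta zeta.
Implicit Types s z : R[i].

Definition zder k : R[i] -> R[i] := derive1n k zeta.

Lemma derive1_cder (f : R[i]^o -> R[i]^o) z : cdiff f z -> cder f z (derive1 f z).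
Proof.
by move=> [d fd]; have /cder_is_derive[_ dE] := fd; rewrite derive1E dE.
Qed.

Lemma cder_zder k z : z != 1 -> cder (zder k) z (zder k.+1 z).
Proof.
elim: k z => [|k ih] z z1; first by apply: derive1_cder; exact: cdiff_zeta.
apply: derive1_cder; rewrite -/(zder k.+1).
apply: (@cdiff_derivative R (zder k) (zder k.+1) z (normc (z - 1))).
  by rewrite normc_gt0 subr_eq0.
move=> w wz; apply: ih; apply: contraTneq wz => ->.
by rewrite normcBC ltxx.
Qed.

(** Cauchy's estimate is applied [k] times, each time on half of the remaining radius. [C] depends
    on [k] and [r] only, so that one constant serves along a whole line. *)
Lemma zder_cauchy k (r : R) : 0 < r -> exists2 C : R, 0 <= C &
  forall z (M : R), (forall w, normc (w - z) < r -> w != 1 /\ normc (zeta w) <= M) ->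
    normc (zder k z) <= C * M.
Proof.
elim: k r => [|k ih] r r0.
  by exists 1 => // z M /(_ z); rewrite subrr normc0 mul1r => /(_ r0)[].
have r2 : 0 < r / 2 by rewrite divr_gt0.
have [C C0 HC] := ih _ r2; exists (4 * C / (r / 2)).
  by apply: divr_ge0; [apply: mulr_ge0|exact: ltW].
move=> z M H.
rewrite (_ : 4 * C / (r / 2) * M = 4 * (C * M) / (r / 2)); last by ring.
have z1 : z != 1 by apply: (H z _).1; rewrite subrr normc0.
apply: (@cauchy_estimate R (zder k) z _ _ _ r2) (cder_zder k z1).
move=> w wz; split.
  by exists (zder k.+1 w); apply: cder_zder; apply: (H w _).1; lra.
apply: HC => v vw; apply: H.
have -> : v - z = (v - w) + (w - z) by ring.
by apply: (le_lt_trans (normcD _ _)); lra.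
Qed.

Lemma neq1_Im z : 0 < `|Im z| -> z != 1.
Proof. by apply: contraTneq => ->; rewrite normr0 ltxx. Qed.

(** Discs of radius 1/4 stay in the range of [zeta_growth], and [|Im w| <= 2 * |t|] on them, whence
    the factor 18. *)
Lemma zder_growth k : exists2 C : R, 0 <= C &
  forall s t : R, 2^-1 <= s <= 2 -> 4 <= `|t| -> normc (zder k (s +i* t)) <= C * `|t|.
Proof.
have r0 : (0 : R) < 1 / 4 by lra.
have [C C0 HC] := zder_cauchy k r0; exists (C * 18); first by rewrite mulr_ge0.
move=> s t sP tP; rewrite -mulrA; apply: HC => w wz.
have h1 := normc_Re (w - (s +i* t)); have h2 := normc_Im (w - (s +i* t)).
rewrite cReD cReN cImD cImN /= in h1 h2.
have h3 := le_lt_trans h1 wz; have h4 := le_lt_trans h2 wz.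
have k1 := ler_normD (t - Im w) (Im w); rewrite subrK distrC in k1.
have k2 := ler_normD (Im w - t) t; rewrite subrK in k2.
split; first by apply: neq1_Im; lra.
apply: (le_trans (zeta_growth zetaP _ _)); [|lra|lra].
by move: h3; rewrite ltr_norml; lra.
Qed.

Lemma zder_right k : exists2 C : R, 0 <= C &
  forall t : R, 1 <= `|t| -> normc (zder k (2 +i* t)) <= C.
Proof.
have r0 : (0 : R) < 1 / 2 by lra.
have [C C0 HC] := zder_cauchy k r0; exists (C * 5); first by rewrite mulr_ge0.
move=> t tP; apply: HC => w wz.
have h1 := normc_Re (w - (2 +i* t)); have h2 := normc_Im (w - (2 +i* t)).
rewrite cReD cReN cImD cImN /= in h1 h2.
have h3 := le_lt_trans h1 wz; have h4 := le_lt_trans h2 wz.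
have k1 := ler_normD (t - Im w) (Im w); rewrite subrK distrC in k1.
move: h3; rewrite ltr_norml => h3.
split; first by apply: neq1_Im; lra.
have w1 : 1 < Re w by lra.
apply: (le_trans (zeta_right_bound zetaP w1)).
have : 2 / (Re w - 1) <= 4 by rewrite ler_pdivrMr; lra.
lra.
Qed.

Definition lindelof_der k := forall eps : R, 0 < eps -> exists C t0 : R,
  forall t : R, t0 <= `|t| -> normc (zder k (2^-1 +i* t)) <= C * `|t| `^ eps.

Lemma powR_expR (t eps : R) : 0 < `|t| -> `|t| `^ eps = expR (eps * ln `|t|).
Proof. by move=> t0; rewrite /powR gt_eqF. Qed.

Lemma lindelof_derE k : lindelof_der k <-> forall eps : R, 0 < eps ->
  exists C t0 : R, [/\ 0 <= C, 4 <= t0 & forall t : R, t0 <= `|t| ->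
    normc (zder k (2^-1 +i* t)) <= C * expR (eps * ln `|t|)].
Proof.
split=> H eps e0; have [C [t0]] := H eps e0; last first.
  move=> [C0 t4 h]; exists C, t0 => t tP; rewrite powR_expR; first exact: h.
  by lra.
move=> h; exists (Num.max C 0), (Num.max t0 4); split; [by rewrite le_max lexx orbT|by rewrite le_max lexx orbT|].
move=> t; rewrite ge_max => /andP[t1 t2]; apply: (le_trans (h t t1)).
rewrite powR_expR; last by lra.
by rewrite ler_wpM2r ?expR_ge0// le_max lexx.
Qed.

(** Convexity without tilt ([c = 0]): the derivative is bounded on Re s = 2, so the exponent [eps]
    of the critical line serves throughout the strip. *)
Lemma lindelof_strip k : lindelof_der k -> forall eps : R, 0 < eps ->
  exists C t0 : R, [/\ 0 <= C, 4 <= t0 & forall s t : R, 2^-1 <= s <= 2 -> t0 <= `|t| ->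
    normc (zder k (s +i* t)) <= C * expR (eps * ln `|t|)].
Proof.
move=> /lindelof_derE H eps e0; have [C [t0 [C0 t4 HC]]] := H eps e0.
have [C1 C10 H1] := zder_growth k; have [C2 C20 H2] := zder_right k.
pose A := Num.max (Num.max C C1) C2.
have AC : C <= A by rewrite !le_max lexx.
have AC1 : C1 <= A by rewrite !le_max lexx orbT.
have AC2 : C2 <= A by rewrite !le_max lexx orbT.
have A0 : 0 <= A by exact: le_trans AC.
clearbody A.
have [| | | | | | | | | | |A' A'0 HA] := @strip_bound R (zder k) 2^-1 2 t0 A eps 0 0 eps.
- by lra.
- lra.
- exact: A0.
- exact: ltW.
- exact: lexx.
- exact: lexx.
- exact: ltW.
- move=> x y xP yP; exists (zder k.+1 (x +i* y)); apply: cder_zder.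
  by apply: neq1_Im => /=; lra.
- move=> x y xP yP; rewrite lnK ?posrE; last by lra.
  apply: (le_trans (H1 _ _ xP _)); first by lra.
  by rewrite ler_wpM2r.
- move=> y yP; apply: (le_trans (HC _ yP)).
  by rewrite ler_wpM2r ?expR_ge0.
- move=> y yP; rewrite mul0r expR0 mulr1; apply: le_trans AC2.
  by apply: H2; lra.
exists A', (2 * t0); split => //; first by lra.
by move=> s t sP tP; apply: HA => //; lra.
Qed.

Lemma lindelof_der_pred k : lindelof_der k.+1 -> lindelof_der k.
Proof.
move=> H; apply/lindelof_derE => eps e0.
have [C [t0 [C0 t4 HC]]] := lindelof_strip H e0.
have [C2 C20 H2] := zder_right k.
exists (2 * C + C2), t0; split => //; first by lra.
move=> t tP; set E := expR _.
have E1 : 1 <= E.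
  rewrite /E -[leLHS]expR0 ler_expR mulr_ge0 ?(ltW e0)//; apply: ln_ge0; lra.
have h1 : normc (zder k (2^-1 +i* t + (3 / 2)%:C) - zder k (2^-1 +i* t)) <= C * E * normc (3 / 2)%:C.
  apply: (@cder_mvt R (zder k) (zder k.+1)) => u uP.
  have -> : 2^-1 +i* t + u%:C * (3 / 2)%:C = (2^-1 + u * (3 / 2)) +i* t.
    by apply: complex_ext => /=; ring.
  split; first by apply: cder_zder; apply: neq1_Im => /=; lra.
  by apply: HC => //; lra.
have e2 : 2^-1 +i* t + (3 / 2)%:C = 2 +i* t by apply: complex_ext => /=; field.
rewrite e2 normc_real ger0_norm in h1; last by lra.
have h2 : normc (zder k (2 +i* t)) <= C2 by apply: H2; lra.
have -> : zder k (2^-1 +i* t) = zder k (2 +i* t) - (zder k (2 +i* t) - zder k (2^-1 +i* t)) by ring.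
apply: (le_trans (normcB _ _)); apply: (le_trans (lerD h2 h1)).
have : C2 <= C2 * E by rewrite ler_peMr.
have : 0 <= C * E by rewrite mulr_ge0//; lra.
clearbody E; lra.
Qed.

Lemma lindelof_der_zeta k : lindelof_der k -> lindelof_der 0.
Proof. by elim: k => // k ih /lindelof_der_pred. Qed.

Lemma lindelof_zeta_der k : lindelof_der 0 -> lindelof_der k.
Proof.
move=> H; apply/lindelof_derE => eps e0.
have e2 : 0 < eps / 2 by rewrite divr_gt0.
have [C [t0 [C0 t4 HC]]] := lindelof_strip H e2.
(* Cauchy discs around the critical line reach into Re s < 1/2, where the exponent rises with slope
   8. The cap [eps / 16] keeps [eps / 2 + 8 * d] below [eps]; the cap [1 / 8] makes the contribution
   of the side Re s = 1/4, [1 - 8 * (Re w - 1 / 4)], nonpositive. *)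
pose d := Num.min (1 / 8) (eps / 16).
have d0 : 0 < d by rewrite lt_min; apply/andP; split; lra.
have d8 : d <= 1 / 8 by rewrite ge_min lexx.
have de : d <= eps / 16 by rewrite ge_min lexx orbT.
clearbody d.
pose A := Num.max C 9.
have AC : C <= A by rewrite le_max lexx.
have A9 : 9 <= A by rewrite le_max lexx orbT.
clearbody A.
have [| | | | | | | | | | |A' A'0 HA] := @strip_bound R (zder 0) (1 / 4) 2^-1 t0 A 1 (eps / 2) 8 eps.
- by lra.
- lra.
- lra.
- lra.
- lra.
- lra.
- lra.
- move=> x y xP yP; exists (zder 1 (x +i* y)); apply: cder_zder.
  by apply: neq1_Im => /=; lra.
- move=> x y xP yP; rewrite lnK ?posrE; last by lra.
  apply: (le_trans (zeta_growth zetaP _ _)) => /=; [lra|lra|].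
  by rewrite ler_wpM2r.
- move=> y yP; rewrite [1 * ln _]mul1r lnK ?posrE; last by lra.
  apply: (le_trans (zeta_growth zetaP _ _)) => /=; [lra|lra|].
  by rewrite ler_wpM2r.
- move=> y yP; apply: (le_trans (HC _ _ _ yP)); first lra.
  by rewrite ler_wpM2r ?expR_ge0.
have [C1 C10 HC1] := zder_cauchy k d0.
pose B := A' + C.
have B0 : 0 <= B by rewrite /B; lra.
exists (C1 * (B * expR eps)), (2 * t0 + 1); split; [by rewrite !mulr_ge0 ?expR_ge0|lra|].
move=> t tP; rewrite -!mulrA -expRD; apply: HC1 => w wz.
have h1 := normc_Re (w - (2^-1 +i* t)); have h2 := normc_Im (w - (2^-1 +i* t)).
rewrite cReD cReN cImD cImN /= in h1 h2.
have h3 := le_lt_trans h1 wz; have h4 := le_lt_trans h2 wz.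
have k1 := ler_normD (t - Im w) (Im w); rewrite subrK distrC in k1.
have k2 := ler_normD (Im w - t) t; rewrite subrK in k2.
move: h3; rewrite ltr_norml => h3.
split; first by apply: neq1_Im; lra.
have r1 : 1 / 4 <= Re w by lra.
have r2 : Re w <= 2 by lra.
have w0 : 1 <= `|Im w| by lra.
have wt0 : 2 * t0 <= `|Im w| by lra.
have w2t : `|Im w| <= 2 * `|t| by lra.
have tt : 0 < `|t| by lra.
have t0w : t0 <= `|Im w| by lra.
have m1 : 1 - 8 * (Re w - 1 / 4) <= eps by lra.
have m2 : eps / 2 + 8 * (2^-1 - Re w) <= eps by lra.
have CB : C <= B by rewrite /B lerDr.
have AB : A' <= B by rewrite /B lerDl.
clear h1 h2 h3 h4 k1 k2 wz tP AC A9; clearbody B.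
have lw : 0 <= ln `|Im w| <= ln `|t| + 1.
  rewrite ln_ge0//=; apply: (@le_trans _ _ (ln (2 * `|t|))).
    by rewrite ler_ln ?posrE ?mulr_gt0 ?(lt_le_trans ltr01 w0).
  by rewrite lnM ?posrE// addrC lerD2l; have := @le_ln1Dx R 1; apply; lra.
have wE : w = Re w +i* Im w by case: w {r1 r2 w0 wt0 t0w w2t lw m1 m2}.
apply: (@le_trans _ _ (B * expR (eps * ln `|Im w|))); last first.
  rewrite ler_wpM2l// ler_expR -[eps in eps + _]mulr1 -mulrDr ler_wpM2l ?(ltW e0)//.
  by rewrite addrC; case/andP: lw.
have [w2|w2] := leP (Re w) 2^-1.
  rewrite {1}wE; apply: (le_trans (HA _ _ _ wt0 m1 m2)); first by rewrite r1.
  by rewrite ler_wpM2r ?expR_ge0.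
rewrite {1}wE; apply: (le_trans (HC _ _ _ t0w)); first by rewrite r2 ltW.
apply: ler_pM; rewrite ?expR_ge0// ler_expR ler_wpM2r ?(andP lw).1//.
by rewrite ler_pdivrMr// ler_peMr ?ler1n// ltW.
Qed.

Lemma lindelof_hypothesisE k : lindelof_hypothesis zeta <-> lindelof_der k.
Proof. by split; [exact: lindelof_zeta_der|exact: lindelof_der_zeta]. Qed.

End ZetaDerivatives.

(** * Birkhoff's ergodic theorem *)

Section Birkhoff.
Context d (X : measurableType d) (R : realType) (mu : {measure set X -> \bar R}).
Variable T : X -> X.
Hypothesis mu_fin : (mu setT < +oo)%E.
Hypothesis mT : measurable_fun setT T.
Hypothesis T_mu : forall A, measurable A -> mu (T @^-1` A) = mu A.
Implicit Types f h : X -> R.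

Definition intg h := mu.-integrable setT (EFin \o h).

Lemma intg_measurable h : intg h -> measurable_fun setT h.
Proof. by move=> /(measurable_int mu) /measurable_EFinP. Qed.

Lemma intg_comp h : intg h -> intg (h \o T).
Proof.
move=> ih; have mh := intg_measurable ih; apply/integrableP; split.
  by apply/measurable_EFinP; exact: measurableT_comp.
have /integrableP[_] := ih; congr (_ < _)%E; symmetry.
have -> : (\int[mu]_(x in setT) `|(EFin \o (h \o T)) x| = \int[pushforward mu T]_(x in setT) `|(EFin \o h) x|)%E.
  rewrite ge0_integral_pushforward// ?preimage_setT//.
  by apply: measurableT_comp => //; exact/measurable_EFinP.
apply: eq_measure_integral => A mA _; exact: T_mu.
Qed.

Lemma Rintegral_comp h : intg h -> Rintegral mu setT (h \o T) = Rintegral mu setT h.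
Proof.
move=> ih; have mh := intg_measurable ih; rewrite /Rintegral; congr fine.
have := @integral_pushforward _ _ X X R T mT mu setT (EFin \o h).
rewrite preimage_setT => /(_ _ _ _)/esym E.
rewrite (_ : (\int[mu]_x ((h \o T) x)%:E = \int[mu]_x ((EFin \o h) \o T) x)%E)//.
rewrite E; [|exact/measurable_EFinP|exact: intg_comp|exact: measurableT].
apply: eq_measure_integral => A mA _; exact: T_mu.
Qed.

Lemma le_intg h g : measurable_fun setT h -> intg g -> (forall x, `|h x| <= `|g x|) -> intg h.
Proof.
move=> mh ig hg; apply: le_integrable ig => //; first exact/measurable_EFinP.
by move=> x _; rewrite /= lee_fin.
Qed.

Lemma intgD h g : intg h -> intg g -> intg (fun x => h x + g x).
Proof.
move=> ih ig; rewrite /intg (_ : _ \o _ = (EFin \o h) \+ (EFin \o g))%E; first exact: integrableD.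
by apply/funext => x /=; rewrite EFinD.
Qed.

Lemma intgB h g : intg h -> intg g -> intg (fun x => h x - g x).
Proof.
move=> ih ig; rewrite /intg (_ : _ \o _ = (EFin \o h) \- (EFin \o g))%E; first exact: integrableB.
by apply/funext => x /=; rewrite EFinB.
Qed.

Lemma intg_cst (c : R) : intg (fun _ => c).
Proof.
apply/integrableP; split; first exact/measurable_EFinP.
rewrite /= integral_cst// lte_mul_pinfty//.
Qed.

Lemma intg_indic h (E : set X) : measurable E -> intg h -> intg (fun x => h x * \1_E x).
Proof.
move=> mE ih; apply: (le_intg _ ih) => [|x].
  by apply: measurable_funM; [exact: intg_measurable|exact: measurable_indic].
rewrite normrM indicE; case: (x \in E); rewrite ?normr1 ?mulr1// normr0 mulr0 //.
Qed.

Fixpoint birkhoff_sum h n x := if n is n'.+1 then h x + birkhoff_sum h n' (T x) else 0.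

(** The maximum of [birkhoff_sum h i x] over [i <= n]; the recursion along the orbit is the form in
    which the maximal inequality is read off. *)
Fixpoint birkhoff_max h n x := if n is n'.+1 then Num.max 0 (h x + birkhoff_max h n' (T x)) else 0.

Lemma birkhoff_max_ge0 h n x : 0 <= birkhoff_max h n x.
Proof. by case: n => //= n; rewrite le_max lexx. Qed.

Lemma birkhoff_max_mono h n x : birkhoff_max h n x <= birkhoff_max h n.+1 x.
Proof.
elim: n x => [|n ih] x; first exact: birkhoff_max_ge0.
rewrite [leLHS]/= [leRHS]/= ge_max !le_max lexx /=; apply/orP; right.
by rewrite lerD2l; exact: ih.
Qed.

Lemma birkhoff_sum_le_max h n x : birkhoff_sum h n x <= birkhoff_max h n x.
Proof. by elim: n x => //= n ih x; rewrite le_max lerD2l ih orbT. Qed.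

Lemma birkhoff_max_le h n m x : (n <= m)%N -> birkhoff_max h n x <= birkhoff_max h m x.
Proof.
elim: m => [|m ih]; first by rewrite leqn0 => /eqP ->.
rewrite leq_eqVlt ltnS => /predU1P[->//|/ih h1].
exact: le_trans h1 (birkhoff_max_mono _ _ _).
Qed.

Lemma intg_birkhoff_max h n : intg h -> intg (birkhoff_max h n).
Proof.
move=> ih; elim: n => [|n IH]; first exact: intg_cst.
have k := intgD ih (intg_comp IH).
apply: (le_intg _ k).
  by apply: measurable_maxr => //; exact: intg_measurable k.
move=> x /=; set y := h x + _.
by rewrite ger0_norm ?le_max ?lexx// ge_max normr_ge0 ler_norm.
Qed.

(** Garsia's argument. Where the maximum [M] is positive, [M <= h + M \o T]; elsewhere
    [M = 0 <= M \o T]. So [M - M \o T], whose integral vanishes by invariance, lies below the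
    integrand. *)
Lemma maximal_ergodic_step h n : intg h ->
  0 <= Rintegral mu setT (fun x => h x * \1_[set x | 0 < birkhoff_max h n x] x).
Proof.
move=> ih; have iM := intg_birkhoff_max n ih; have iMT := intg_comp iM.
set E := [set x | _].
have mE : measurable E.
  have := intg_measurable iM measurableT (measurable_itv `]0, +oo[).
  rewrite setTI; congr measurable; apply/seteqP; split => x /=; by rewrite in_itv/= andbT.
have <- : Rintegral mu setT (fun x => birkhoff_max h n x - (birkhoff_max h n \o T) x) = 0.
  by rewrite RintegralB// Rintegral_comp// subrr.
apply: le_Rintegral => //; [exact: intgB|exact: intg_indic|].
move=> x _; rewrite indicE; have [|] := boolP (x \in E).
  rewrite inE /E /= mulr1 lerBlDr.
  case: n {iM iMT E mE} => [|n]; first by rewrite /= ltxx.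
  rewrite [ltRHS]/= lt_max ltxx /= => p.
  by rewrite (max_r (ltW p)) lerD2l; exact: birkhoff_max_mono.
rewrite notin_setE /E /= => /negP; rewrite -leNgt => M0.
have -> : birkhoff_max h n x = 0 by apply/eqP; rewrite eq_le M0 birkhoff_max_ge0.
by rewrite mulr0 sub0r oppr_le0 birkhoff_max_ge0.
Qed.

(** The sets where [birkhoff_max h n] is positive increase with [n] and exhaust the support of [h];
    dominated convergence gives the rest. *)
Lemma maximal_ergodic h : intg h ->
  (forall x, h x != 0 -> exists n, 0 < birkhoff_sum h n x) ->
  0 <= Rintegral mu setT h.
Proof.
move=> ih hP; pose E n := [set x | 0 < birkhoff_max h n x].
have mE n : measurable (E n).
  have := intg_measurable (intg_birkhoff_max n ih) measurableT (measurable_itv `]0, +oo[).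
  rewrite setTI; congr measurable; apply/seteqP; split => x /=; by rewrite in_itv/= andbT.
pose hn n x := (h x * \1_(E n) x)%:E.
have [] := @dominated_convergence _ _ _ mu setT measurableT hn (EFin \o h) (fun x => `|h x|%:E).
- by move=> n; apply/measurable_EFinP; exact: intg_measurable (intg_indic (mE n) ih).
- by apply/measurable_EFinP; exact: intg_measurable.
- apply: aeW => x _; apply: cvg_near_cst.
  have [h0|/hP[n np]] := eqVneq (h x) 0.
    by apply: nearW => n; rewrite /hn h0 mul0r /= h0.
  exists n => // m /= nm; rewrite /hn indicE mem_set ?mulr1//.
  by apply: (lt_le_trans np); apply: le_trans (birkhoff_max_le h x nm); exact: birkhoff_sum_le_max.
- apply: (@le_integrable _ _ _ mu setT measurableT _ (EFin \o h)) => //.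
    by apply/measurable_EFinP; apply: measurableT_comp => //; exact: intg_measurable.
  by move=> x _; rewrite /= lee_fin normr_id.
- apply: aeW => x n _; rewrite /hn /= lee_fin normrM indicE.
  by case: (_ \in _); rewrite ?normr1 ?mulr1// normr0 mulr0.
move=> _ _ cv; rewrite /Rintegral; apply: fine_ge0.
have <- := cvg_lim (@ereal_hausdorff R) cv.
apply: lime_ge; first by apply/cvg_ex; eexists; exact: cv.
apply: nearW => n; rewrite /hn.
have := maximal_ergodic_step n ih; rewrite /Rintegral.
rewrite -lee_fin fineK//.
exact: integrable_fin_num (intg_indic (mE n) ih).
Qed.

(** The upper limit of [birkhoff_sum h n x / n] is at least [b], written with countably many
    conditions for measurability and without dividing by [n]. *)
Definition limsup_ge h (b : R) := [set x | forall k m : nat,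
  exists2 n : nat, (m <= n)%N & (b - k.+1%:R^-1) * n%:R < birkhoff_sum h n x].

Lemma measurable_birkhoff_sum h n : measurable_fun setT h -> measurable_fun setT (birkhoff_sum h n).
Proof.
move=> mh; elim: n => [|n ih]; first exact: measurable_cst.
by apply: measurable_funD => //; exact: measurableT_comp.
Qed.

Lemma measurable_limsup_ge h b : measurable_fun setT h -> measurable (limsup_ge h b).
Proof.
move=> mh.
have -> : limsup_ge h b = \bigcap_k \bigcap_m \bigcup_(n in [set n | (m <= n)%N])
   [set x | (b - k.+1%:R^-1) * n%:R < birkhoff_sum h n x].
  apply/seteqP; split => x /=.
    by move=> H k _ m _; have [n mn nP] := H k m; exists n.
  by move=> H k m; have [n mn nP] := H k I m I; exists n.
apply: bigcapT_measurable => k; apply: bigcapT_measurable => m.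
apply: bigcup_measurable => n _.
have := measurable_birkhoff_sum n mh measurableT (measurable_itv `](b - k.+1%:R^-1) * n%:R, +oo[).
rewrite setTI; congr measurable; apply/seteqP; split => x /=; by rewrite in_itv/= andbT.
Qed.

Lemma limsup_geP h b x : limsup_ge h b x <-> forall c : R, c < b -> forall m : nat,
  exists2 n : nat, (m <= n)%N & c * n%:R < birkhoff_sum h n x.
Proof.
split=> [H c cb m|H k m]; last by apply: H; rewrite gtrBl invr_gt0 ltr0n.
pose k := Num.truncn (b - c)^-1.
have [n mn nP] := H k m; exists n => //; apply: le_lt_trans nP.
rewrite ler_wpM2r// lerBrDl -lerBrDr -[leRHS]invrK lef_pV2 ?posrE ?ltr0n ?invr_gt0 ?subr_gt0//.
exact/ltW/truncnS_gt.
Qed.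

(** Moving one step along the orbit changes the sum by [h x] and the length by 1. Passing from [c]
    to the midpoint [c'] of [c] and [b] gains [(c' - c) * n], which absorbs both for large [n]. *)
Lemma limsup_ge_inv h b x : limsup_ge h b x <-> limsup_ge h b (T x).
Proof.
split=> /limsup_geP H; apply/limsup_geP => c cb m.
  pose c' := (c + b) / 2; have c'b : c' < b by rewrite /c'; lra.
  have cc' : 0 < c' - c by rewrite /c'; lra.
  pose M := Num.truncn (`|h x - c'| / (c' - c)).
  have [[|n]] := H c' c'b (maxn m.+1 M.+2); first by rewrite geq_max.
  rewrite geq_max ltnS => /andP[mn Mn] nP; exists n => //.
  move: nP => /=; rewrite -ltrBlDl; apply: le_lt_trans.
  have : `|h x - c'| <= (c' - c) * n%:R.
    rewrite mulrC -ler_pdivrMr//; apply: ltW; apply: (lt_le_trans (truncnS_gt _)).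
    by rewrite ler_nat -ltnS.
  rewrite ler_norml => /andP[_]; rewrite -natr1; lra.
pose c' := (c + b) / 2; have c'b : c' < b by rewrite /c'; lra.
have cc' : 0 < c' - c by rewrite /c'; lra.
pose M := Num.truncn (`|c - h x| / (c' - c)).
have [n] := H c' c'b (maxn m M.+1).
rewrite geq_max => /andP[mn Mn] nP; exists n.+1; first exact: leqW.
rewrite [ltRHS]/=.
have : `|c - h x| <= (c' - c) * n%:R.
  rewrite mulrC -ler_pdivrMr//; apply: ltW; apply: (lt_le_trans (truncnS_gt _)).
  by rewrite ler_nat.
rewrite ler_norml => /andP[_]; rewrite -natr1; lra.
Qed.

Lemma birkhoff_sum_indic h (c : R) (E : set X) n x : (forall x, E x <-> E (T x)) -> E x ->
  birkhoff_sum (fun x => (h x - c) * \1_E x) n x = birkhoff_sum h n x - c * n%:R.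
Proof.
move=> invE; elim: n x => [|n ih] x Ex /=; first by rewrite mulr0 subr0.
rewrite ih; last exact: (invE x).1.
have -> : \1_E x = 1 :> R by rewrite indicE mem_set.
by rewrite -natr1; ring.
Qed.

(** By invariance of [E], the Birkhoff sums of [(h - c) * \1_E] at a point of [E] are those of [h]
    minus [c * n]. One of them is positive since [c < b], so [maximal_ergodic] applies. *)
Lemma Rintegral_indic_ge h (c b : R) (E : set X) : intg h -> measurable E ->
  (forall x, E x <-> E (T x)) -> E `<=` limsup_ge h b -> c < b ->
  0 <= Rintegral mu setT (fun x => (h x - c) * \1_E x).
Proof.
move=> ih mE invE Eb cb; apply: maximal_ergodic.
  by apply: intg_indic => //; apply: intgB => //; exact: intg_cst.
move=> x; rewrite indicE; have [|_] := boolP (x \in E); last by rewrite mulr0 eqxx.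
rewrite inE => Ex _; have /limsup_geP/(_ _ cb 0%N)[n _ nP] := Eb _ Ex.
by exists n; rewrite birkhoff_sum_indic// subr_gt0.
Qed.

Lemma birkhoff_sumN h n x : birkhoff_sum (fun x => - h x) n x = - birkhoff_sum h n x.
Proof. by elim: n x => [|n ih] x /=; rewrite ?oppr0// ih opprD. Qed.

Lemma Rintegral_cst_indic (c : R) (E : set X) : measurable E ->
  Rintegral mu setT (fun x => c * \1_E x) = c * fine (mu E).
Proof.
move=> mE; rewrite RintegralZl//; last first.
  have := intg_indic mE (intg_cst 1); rewrite /intg.
  by congr (mu.-integrable _ _); apply/funext => x /=; rewrite mul1r.
by rewrite /Rintegral integral_indic// setIT.
Qed.

Lemma mu_fin_num E : measurable E -> mu E \is a fin_num.
Proof.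
move=> mE; rewrite ge0_fin_numE//; apply: le_lt_trans mu_fin.
by apply: le_measure; rewrite ?inE.
Qed.

(** On the invariant set [E] the averages come near [a] or below and near [b] or above infinitely
    often. With [a < e < c < b], adding the two integral inequalities leaves
    [0 <= (e - c) * mu E]. *)
Lemma oscillation_null h (a b : R) : intg h -> a < b ->
  mu (limsup_ge h b `&` limsup_ge (fun x => - h x) (- a)) = 0%E.
Proof.
move=> ih ab; set E := _ `&` _.
have iNh : intg (fun x => - h x).
  have := intgB (intg_cst 0) ih; rewrite /intg; congr (mu.-integrable _ _).
  by apply/funext => x /=; rewrite sub0r.
have mE : measurable E.
  by apply: measurableI; apply: measurable_limsup_ge; exact: intg_measurable.
have invE x : E x <-> E (T x).
  have e1 := limsup_ge_inv h b x; have e2 := limsup_ge_inv (fun x => - h x) (- a) x.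
  by split=> -[h1 h2]; split; [exact/e1|exact/e2|exact/e1|exact/e2].
pose c := (a + 2 * b) / 3; pose e := (2 * a + b) / 3.
have h1 : 0 <= Rintegral mu setT (fun x => (h x - c) * \1_E x).
  by apply: (@Rintegral_indic_ge h c b) => //; [move=> x []|rewrite /c; lra].
have h2 : 0 <= Rintegral mu setT (fun x => (- h x - - e) * \1_E x).
  by apply: (@Rintegral_indic_ge (fun x => - h x) (- e) (- a)) => //; [move=> x []|rewrite /e; lra].
have : 0 <= Rintegral mu setT (fun x => (e - c) * \1_E x).
  have -> : (fun x => (e - c) * \1_E x) = (fun x => (h x - c) * \1_E x + (- h x - - e) * \1_E x).
    by apply/funext => x; ring.
  rewrite RintegralD//; first exact: addr_ge0.
    by apply: intg_indic => //; apply: intgB => //; exact: intg_cst.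
  by apply: intg_indic => //; apply: intgB => //; exact: intg_cst.
rewrite Rintegral_cst_indic//.
have ec : e - c < 0 by rewrite /e /c; lra.
have m0 : 0 <= fine (mu E) by exact: fine_ge0.
rewrite nmulr_rge0// => m1; rewrite -(fineK (mu_fin_num mE)).
by congr (_%:E); apply/eqP; rewrite eq_le m0 m1.
Qed.

(** On this invariant set the integral of [h] is at least [k * mu E] for every [k], which forces
    [mu E = 0]. *)
Lemma limsup_infinite_null h : intg h -> mu (\bigcap_(k : nat) limsup_ge h k%:R) = 0%E.
Proof.
move=> ih; set E := \bigcap_(_ in _) _.
have mE : measurable E.
  by apply: bigcapT_measurable => k; apply: measurable_limsup_ge; exact: intg_measurable.
have invE x : E x <-> E (T x).
  by split=> H k _; have := H k I; have e := limsup_ge_inv h k%:R x => /e.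
have iE := intg_indic mE ih.
have i1 (c : R) : intg (fun x => c * \1_E x) by apply: intg_indic => //; exact: intg_cst.
have key (k : nat) : k%:R * fine (mu E) <= Rintegral mu setT (fun x => h x * \1_E x).
  rewrite -subr_ge0 -Rintegral_cst_indic// -RintegralB//; last exact: i1.
  have -> : (fun x => h x * \1_E x - k%:R * \1_E x) = (fun x => (h x - k%:R) * \1_E x).
    by apply/funext => x; rewrite mulrBl.
  apply: (@Rintegral_indic_ge h k%:R k.+1%:R) => //; last by rewrite ltr_nat.
  by move=> x; apply.
have m0 : 0 <= fine (mu E) by exact: fine_ge0.
rewrite -(fineK (mu_fin_num mE)); congr (_%:E); apply/eqP; rewrite eq_le m0 andbT leNgt.
apply/negP => mp; set I := Rintegral _ _ _ in key.
have := key (Num.truncn (`|I| / fine (mu E))).+1; apply/negP; rewrite -ltNge.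
rewrite -ltr_pdivrMr//; apply: le_lt_trans (truncnS_gt _).
by rewrite ler_pM2r ?invr_gt0// ler_norm.
Qed.

(** The limit is the infimum of [U], the slopes that eventually dominate the sums. If the averages
    fell below [inf U - e] infinitely often, two rationals between [inf U - e] and [inf U] would
    witness a forbidden oscillation. *)
Lemma birkhoff_cvg h x :
  (forall p q : rat, ratr p < ratr q :> R ->
     ~ (limsup_ge h (ratr q) `&` limsup_ge (fun x => - h x) (- ratr p)) x) ->
  ~ (\bigcap_(k : nat) limsup_ge h k%:R) x ->
  ~ (\bigcap_(k : nat) limsup_ge (fun x => - h x) k%:R) x ->
  cvg ((fun n : nat => n%:R^-1 * birkhoff_sum h n x) @ \oo).
Proof.
move=> osc up lo.
have bnd g : ~ (\bigcap_(k : nat) limsup_ge g k%:R) x -> exists c : R, exists m : nat,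
    forall n, (m <= n)%N -> birkhoff_sum g n x <= c * n%:R.
  move=> H; apply: contrapT => nE; apply: H => k _; apply/limsup_geP => c _ m.
  apply: contrapT => nE2; apply: nE; exists c, m => n mn; rewrite leNgt.
  by apply/negP => lt; apply: nE2; exists n.
have [c1 [m1 H1]] := bnd _ up; have [c2 [m2 H2]] := bnd _ lo.
pose U := [set c : R | exists m : nat, forall n, (m <= n)%N -> birkhoff_sum h n x <= c * n%:R].
have Ulb : has_inf U.
  split; first by exists c1, m1.
  exists (- c2) => c [m Hm]; pose n := (maxn (maxn m m2) 1)%N.
  have n0 : 0 < n%:R :> R by rewrite ltr0n /n leq_max orbT.
  have h1 : birkhoff_sum h n x <= c * n%:R by apply: Hm; rewrite !leq_max leqnn.
  have h2 : - birkhoff_sum h n x <= c2 * n%:R.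
    by rewrite -birkhoff_sumN; apply: H2; rewrite !leq_max leqnn orbT.
  by rewrite -(ler_pM2r n0); lra.
apply/cvg_ex; exists (inf U); apply/cvgrPdist_le => e e0.
have [c [m Hm] cL] := inf_adherent e0 Ulb.
have [m' Hm'] : exists m' : nat, forall n, (m' <= n)%N -> (inf U - e) * n%:R <= birkhoff_sum h n x.
  apply: contrapT => nE.
  have eU : inf U - e < inf U by rewrite gtrBl.
  have [q /[!in_itv]/= /andP[q1 q2]] := rat_in_itvoo eU.
  have [p /[!in_itv]/= /andP[p1 p2]] := rat_in_itvoo q1.
  apply: (osc p q p2); split; apply/limsup_geP => c' cc m0; apply: contrapT => nE2.
    have : U c'.
      exists m0 => n mn; rewrite leNgt; apply/negP => lt; apply: nE2; by exists n.
    move=> /(ge_inf Ulb.2); apply/negP; rewrite -ltNge; lra.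
  apply: nE; exists (maxn m0 1) => n; rewrite geq_max => /andP[mn n1]; rewrite leNgt; apply/negP => lt.
  apply: nE2; exists n => //; rewrite birkhoff_sumN ltrNr -mulNr; apply: (lt_le_trans lt).
  by rewrite ler_wpM2r//; lra.
exists (maxn (maxn m m') 1) => // n /=; rewrite !geq_max => /andP[/andP[mn m'n] n1].
have n0 : 0 < n%:R :> R by rewrite ltr0n.
have h1 := Hm _ mn; have h2 := Hm' _ m'n.
rewrite mulrC; set S := birkhoff_sum h n x in h1 h2 *.
have : S / n%:R <= c by rewrite ler_pdivrMr.
have : inf U - e <= S / n%:R by rewrite ler_pdivlMr.
rewrite ler_norml; lra.
Qed.

Theorem birkhoff h : intg h ->
  {ae mu, forall x, cvg ((fun n : nat => n%:R^-1 * birkhoff_sum h n x) @ \oo)}.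
Proof.
move=> ih.
have iNh : intg (fun x => - h x).
  have := intgB (intg_cst 0) ih; rewrite /intg; congr (mu.-integrable _ _).
  by apply/funext => x /=; rewrite sub0r.
have mh := intg_measurable ih; have mNh := intg_measurable iNh.
pose F (pq : rat * rat) := if ratr pq.1 < ratr pq.2 :> R then
  limsup_ge h (ratr pq.2) `&` limsup_ge (fun x => - h x) (- ratr pq.1) else set0.
pose G (n : nat) := if unpickle n is Some pq then F pq else set0.
have negF pq : mu.-negligible (F pq).
  rewrite /F; case: ifP => [lt|_]; last exact: negligible_set0.
  apply/negligibleP; last exact: oscillation_null.
  by apply: measurableI; exact: measurable_limsup_ge.
have negG : mu.-negligible (\bigcup_n G n).
  by apply: negligible_bigcup => n; rewrite /G; case: unpickle => // ; exact: negligible_set0.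
have neg1 : mu.-negligible (\bigcap_(k : nat) limsup_ge h k%:R).
  apply/negligibleP; last exact: limsup_infinite_null.
  by apply: bigcapT_measurable => k; exact: measurable_limsup_ge.
have neg2 : mu.-negligible (\bigcap_(k : nat) limsup_ge (fun x => - h x) k%:R).
  apply/negligibleP; last exact: limsup_infinite_null.
  by apply: bigcapT_measurable => k; exact: measurable_limsup_ge.
apply: negligibleS (negligibleU negG (negligibleU neg1 neg2)) => x /= nc.
apply: contrapT => H; apply: nc; apply: birkhoff_cvg => [p q pq Fx|Fx|Fx].
- apply: H; left; exists (pickle (p, q)); first exact: I.
  by rewrite /G pickleK /F /= pq.
- by apply: H; right; left.
- by apply: H; right; right.
Qed.

End Birkhoff.

(** * The affine Boolean transformation as angle doubling *)

Section LebesgueNull.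
Variable R : realType.
Local Notation mu := (@lebesgue_measure R).

(** The image of a cover by short intervals is covered by intervals of length [2 * L * l] around
    image points; [2 * L + 1] keeps the factor positive when [L = 0]. *)
Lemma negligible_lipschitz_image (f : R -> R) (L : R) (N A : set R) : 0 <= L ->
  (forall x y, A x -> A y -> `|f x - f y| <= L * `|x - y|) ->
  mu.-negligible N -> mu.-negligible (f @` (N `&` A)).
Proof.
move=> L0 fL /negligible_outer_measure N0.
apply/negligible_outer_measure; apply/eqP; rewrite eq_le outer_measure_ge0 andbT.
apply/lee_addgt0Pr => e e0; rewrite add0e.
have K0 : 0 < 2 * L + 1 by lra.
pose e' := e / (2 * L + 1); have e'0 : 0 < e' by rewrite divr_gt0.
have [F [FI NF] Fe] : exists2 I_, open_itv_cover N I_ &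
    (\sum_(0 <= k <oo) (wlength idfun (I_ k)) <= e'%:E :> \bar R)%E.
  have : (wlength (@idfun R))^*%mu N \is a fin_num by rewrite N0.
  rewrite outer_measure_open_itv_cover.
  move=> /lb_ereal_inf_adherent-/(_ _ e'0)[_/= [F]] AF <- Fe.
  exists F => //; apply/ltW; move: Fe.
  by rewrite -outer_measure_open_itv_cover N0 add0e.
pose G i := f @` (N `&` A `&` F i).
have sub : f @` (N `&` A) `<=` \bigcup_i G i.
  move=> _ [x [Nx Ax] <-]; have [i _ Fi] := NF _ Nx.
  by exists i => //; exists x.
apply: (le_trans (le_outer_measure (wlength (@idfun R))^*%mu _ _ sub)).
apply: (le_trans (outer_measure_sigma_subadditive (wlength (@idfun R))^*%mu G)).
have Gi i : ((wlength (@idfun R))^*%mu (G i) <= (2 * L + 1)%:E * wlength idfun (F i))%E.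
  have l0 : (0 <= wlength (@idfun R) (F i))%E by exact: wlength_ge0.
  have [ab FE] := FI i.
  have [[y0 [[Ny0 Ay0] Fy0]]|/set0P/negP] := pselect ((N `&` A `&` F i) !=set0); last first.
    rewrite negbK => /eqP E; rewrite /G E image_set0 outer_measure0.
    by rewrite mule_ge0// lee_fin ltW.
  have ab12 : ab.1 < ab.2 by move: Fy0; rewrite FE /= in_itv/= => /andP[]; exact: lt_trans.
  have lE : wlength idfun (F i) = (ab.2 - ab.1)%:E.
    by rewrite FE wlength_itv/= lte_fin ab12.
  pose l := ab.2 - ab.1.
  have sub2 : G i `<=` `[f y0 - L * l, f y0 + L * l].
    move=> _ [x [[Nx Ax] Fx] <-]; rewrite /= in_itv/=.
    have : `|f x - f y0| <= L * l.
      apply: (le_trans (fL _ _ Ax Ay0)); rewrite ler_wpM2l//.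
      move: Fx Fy0; rewrite FE /= !in_itv/= /l ler_norml; lra.
    rewrite ler_norml; lra.
  apply: (le_trans (le_outer_measure (wlength (@idfun R))^*%mu _ _ sub2)).
  rewrite -[leLHS]/(mu `[f y0 - L * l, f y0 + L * l]) lebesgue_measure_itv/= lte_fin.
  case: ifP => _; last by rewrite mule_ge0// lee_fin ltW.
  rewrite lE -EFinD -EFinM lee_fin -/l.
  have : 0 < l by rewrite subr_gt0.
  nra.
apply: (@le_trans _ _ (\sum_(0 <= i <oo) ((2 * L + 1)%:E * wlength idfun (F i)))%E).
  by apply: lee_nneseries => [i _ _|i _]; [exact: outer_measure_ge0|exact: Gi].
rewrite nneseriesZl; last by move=> i _; exact: wlength_ge0.
apply: (@le_trans _ _ ((2 * L + 1)%:E * e'%:E)%E).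
  by rewrite lee_pmul2l// lte_fin.
by rewrite -EFinM lee_fin /e' mulrC divfK// gt_eqF.
Qed.

Lemma lebesgue_measure_affine (c d : R) (A : set R) : 0 < c -> measurable A ->
  (mu ((fun x => (c * x + d)%R) @^-1` A) = (c^-1)%:E * mu A)%E.
Proof.
move=> c0 mA.
have mphi : measurable_fun setT (fun x : R => c * x + d).
  apply: measurable_funD => //; exact: measurable_funM.
pose f : measurableTypeR R -> measurableTypeR R := fun x => c * x + d.
have c1 : 0 <= c by exact: ltW.
have mf : measurable_fun [set: measurableTypeR R] f by exact: mphi.
have -> : (mu A = c%:E * pushforward mu f A)%E.
  have := @lebesgue_measure_unique R (mscale (NngNum c1) (pushforward mu f)).
  move=> /(_ mf)/(_ _ A mA); apply => _ [[a b] _ <-].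
  rewrite -[LHS]/(mu `]a, b]) -[RHS]/(c%:E * mu (f @^-1` `]a, b]%classic))%E.
  have -> : f @^-1` `]a, b] = `](a - d) / c, (b - d) / c]%classic.
    apply/seteqP; split => x /=; rewrite !in_itv/= /f ltr_pdivrMr// ler_pdivlMr//; lra.
  rewrite !lebesgue_measure_itv/= !lte_fin ltr_pM2r ?invr_gt0// ltrD2r.
  case: ifP => _; last by rewrite mule0.
  rewrite -!EFinD -EFinM; congr (_%:E); field; exact: lt0r_neq0.
by rewrite muleA -EFinM mulVf ?gt_eqF// mul1e.
Qed.

End LebesgueNull.

Section Cotangent.
Variable R : realType.
Variables (a b : R).
Hypothesis a0 : 0 < a.

(* Conjugates [boolean_map a b] to angle doubling; [cot 0] is the junk value [0],
   which matches the convention [T b = b]. *)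
Definition cot_param (u : R) : R := b + a * (cos (pi * u) / sin (pi * u)).

Definition cot_angle (x : R) : R := 2^-1 - atan ((x - b) / a) / pi.

Lemma boolean_map_cot u : boolean_map a b (cot_param u) = cot_param (2 * u).
Proof.
rewrite /cot_param (_ : pi * (2 * u) = pi * u *+ 2); last by rewrite mulr2n; ring.
rewrite cos_mulr2n sin_mulr2n /boolean_map.
set s := sin (pi * u); set c := cos (pi * u).
have a1 : a != 0 by rewrite gt_eqF.
have cs : c ^+ 2 + s ^+ 2 = 1 by exact: cos2Dsin2.
(* Where [s] or [c] vanishes, the convention for division by 0 makes both [cot_param u] and
   [cot_param (2 * u)] equal to the fixed point [b], so the conjugacy holds for every [u]. *)
have [s0|s0] := eqVneq s 0.
  by rewrite s0 invr0 !mulr0 mul0rn invr0 !mulr0 addr0 eqxx.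
have [c0|c0] := eqVneq c 0.
  by rewrite c0 !mul0r mulr0 addr0 eqxx mul0rn invr0 !mulr0 addr0.
have n0 : a * (c / s) != 0 by rewrite !mulf_neq0 ?invr_eq0.
rewrite -subr_eq0 addrAC subrr add0r (negPf n0).
have -> : c ^+ 2 *+ 2 - 1 = c ^+ 2 - s ^+ 2 by rewrite -cs mulr2n; ring.
by field; rewrite a1 c0 s0.
Qed.

Lemma cot_param1 u : cot_param (u - 1) = cot_param u.
Proof.
rewrite /cot_param (_ : pi * (u - 1) = pi * u - pi); last by ring.
have e1 : sin (pi * u) = - sin (pi * u - pi) by rewrite -sinDpi subrK.
have e2 : cos (pi * u) = - cos (pi * u - pi) by rewrite -cosDpi subrK.
by rewrite e1 e2 invrN mulrNN.
Qed.

Lemma cot_paramN_int (n : int) u : cot_param (u - n%:~R) = cot_param u.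
Proof.
elim/int_ind: n u => [|n ih|n ih] u; first by rewrite subr0.
  by rewrite -addn1 PoszD rmorphD /= opprD addrA cot_param1 ih.
by rewrite -(cot_param1 (u - _)) -[RHS]ih; congr cot_param; rewrite -addn1 PoszD opprD rmorphD /=; ring.
Qed.

Lemma iter_boolean_map_cot n u : iter n (boolean_map a b) (cot_param u) = cot_param (2 ^+ n * u).
Proof.
by elim: n => [|n ih]; rewrite ?mul1r// iterS ih boolean_map_cot exprS mulrA.
Qed.

Lemma cot_angle_itv x : 0 < cot_angle x < 1.
Proof.
rewrite /cot_angle; set y := (x - b) / a.
have p0 := @pi_gt0 R; have h1 := atan_gtNpi2 y; have h2 := atan_ltpi2 y.
have : atan y / pi < 2^-1 by rewrite ltr_pdivrMr// mulrC.
have : - 2^-1 < atan y / pi by rewrite ltr_pdivlMr// mulNr mulrC.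
lra.
Qed.

Lemma cot_tan (v : R) : cos (pi / 2 - v) / sin (pi / 2 - v) = tan v.
Proof.
by rewrite cosB sinB cos_pihalf sin_pihalf !(mul0r, mul1r, add0r, subr0) /tan.
Qed.

Lemma cot_angleK : cancel cot_angle cot_param.
Proof.
move=> x; rewrite /cot_param /cot_angle; have p0 := @pi_gt0 R.
have -> : pi * (2^-1 - atan ((x - b) / a) / pi) = pi / 2 - atan ((x - b) / a).
  by move: (pi : R) p0 => P P0; field; exact: lt0r_neq0.
by rewrite cot_tan atanK mulrC divfK ?gt_eqF// addrC subrK.
Qed.

Lemma cot_paramK u : 0 < u < 1 -> cot_angle (cot_param u) = u.
Proof.
move=> /andP[u0 u1]; rewrite /cot_param /cot_angle; have p0 := @pi_gt0 R.
have -> : pi * u = pi / 2 - (pi / 2 - pi * u) by ring.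
rewrite cot_tan addrAC subrr add0r mulrAC divff ?gt_eqF// mul1r tanK.
  by move: (pi : R) p0 => P P0; field; exact: lt0r_neq0.
rewrite in_itv/=; move: (pi : R) p0 => P P0; apply/andP; split; nra.
Qed.

Lemma atan_mvt (x y : R) : x <= y -> exists2 c : R, x <= c <= y &
  atan y - atan x = (1 + c ^+ 2)^-1 * (y - x).
Proof.
move=> xy; have [c /[!in_itv]/= cxy E] : exists2 c, c \in `[x, y]%R &
    atan y - atan x = (1 + c ^+ 2)^-1 * (y - x).
  apply: (@MVT_segment _ atan (fun c => (1 + c ^+ 2)^-1)) => //.
  by apply: continuous_subspaceT => z; exact: continuous_atan.
by exists c.
Qed.

Lemma atan_le (y : R) : 0 <= y -> atan y <= y.
Proof.
move=> y0; have [c _] := atan_mvt y0; rewrite atan0 !subr0 => ->.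
rewrite ler_piMl// invf_le1 ?lerDl ?sqr_ge0//.
by rewrite ltr_pwDl// sqr_ge0.
Qed.

Lemma cot_angle_mvt (x y : R) : x <= y -> exists2 c : R, x <= c <= y &
  cot_angle x - cot_angle y = (y - x) / (a * pi * (1 + ((c - b) / a) ^+ 2)).
Proof.
move=> xy; have xy' : (x - b) / a <= (y - b) / a by rewrite ler_pM2r ?invr_gt0// lerD2r.
have [c /andP[c1 c2] E] := atan_mvt xy'.
exists (b + a * c).
  by move: c1 c2; rewrite ler_pdivrMr// ler_pdivlMr//; lra.
have -> : (b + a * c - b) / a = c by field; exact: lt0r_neq0.
have -> : cot_angle x - cot_angle y = (atan ((y - b) / a) - atan ((x - b) / a)) / pi.
  by rewrite /cot_angle; ring.
have c0 : 1 + c ^+ 2 != 0 by rewrite gt_eqF// ltr_pwDl// sqr_ge0.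
have p0 := @pi_gt0 R; rewrite E; move: (pi : R) p0 => P P0; field.
by rewrite c0 !lt0r_neq0.
Qed.

Lemma cot_angle_decr (x y : R) : x <= y -> cot_angle y <= cot_angle x.
Proof.
move=> xy; rewrite -subr_ge0; have [c _ ->] := cot_angle_mvt xy.
rewrite divr_ge0 ?subr_ge0// !mulr_ge0 ?pi_ge0 ?ltW//.
by rewrite ltr_pwDl// sqr_ge0.
Qed.

Lemma cot_angle_lip (x y : R) : `|cot_angle x - cot_angle y| <= (a * pi)^-1 * `|x - y|.
Proof.
have ap : 0 < a * pi by rewrite mulr_gt0 ?pi_gt0.
wlog xy : x y / x <= y.
  move=> H; have [/H//|/ltW/H] := leP x y; by rewrite distrC (distrC y).
have [c _ ->] := cot_angle_mvt xy.
have c1 : 1 <= 1 + ((c - b) / a) ^+ 2 by rewrite lerDl sqr_ge0.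
have c0 : 0 < 1 + ((c - b) / a) ^+ 2 by exact: lt_le_trans c1.
rewrite distrC !ger0_norm ?subr_ge0//; last by rewrite divr_ge0 ?subr_ge0// mulr_ge0 ?ltW.
rewrite mulrC ler_wpM2r ?subr_ge0// lef_pV2 ?posrE ?mulr_gt0 ?pi_gt0//.
by rewrite ler_peMr// ltW.
Qed.

(** Away from the poles [cot_param] is Lipschitz as well; this carries null sets of angles back to
    the line, while [cot_angle_lip] carries them the other way. *)
Lemma cot_angle_expand (M x y : R) : `|x - b| <= M -> `|y - b| <= M ->
  `|x - y| <= a * pi * (1 + (M / a) ^+ 2) * `|cot_angle x - cot_angle y|.
Proof.
have ap : 0 < a * pi by rewrite mulr_gt0 ?pi_gt0.
wlog xy : x y / x <= y.
  move=> H xM yM; have [xy|/ltW xy] := leP x y; first exact: H.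
  by rewrite distrC (distrC (cot_angle x)); exact: H.
move=> xM yM; have [c /andP[c1 c2] ->] := cot_angle_mvt xy.
have cM : `|c - b| <= M by move: xM yM; rewrite !ler_norml; lra.
have c0 : 0 < 1 + ((c - b) / a) ^+ 2 by rewrite ltr_pwDl// sqr_ge0.
have K0 : 1 + ((c - b) / a) ^+ 2 <= 1 + (M / a) ^+ 2.
  rewrite lerD2l !expr_div_n ler_pM2r ?invr_gt0 ?exprn_gt0//.
  by rewrite -[leLHS]real_normK ?num_real// lerXn2r ?nnegrE ?(le_trans _ cM).
rewrite distrC !ger0_norm ?subr_ge0//; last by rewrite divr_ge0 ?subr_ge0// mulr_ge0 ?ltW.
rewrite mulrCA ler_peMr ?subr_ge0// ler_pdivlMr ?mulr_gt0 ?pi_gt0// mul1r.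
by rewrite ler_pM2l.
Qed.

(* |cot (pi u)| <= 1 / (pi u) near [0] since [tan t >= t]. *)
Lemma cot_param_bound u : 0 < u < 1 -> `|cot_param u - b| <= a / Num.min u (1 - u).
Proof.
move=> uP; have xE := cot_paramK uP; set x := cot_param u in xE *.
have p0 := @pi_gt0 R; have p2 := @pi_ge2 R.
have key (t : R) : 0 < t -> 2^-1 - atan t / pi <= t^-1.
  move=> t0; have ti : 0 < t^-1 by rewrite invr_gt0.
  have h1 : tan (pi / 2 - atan t^-1) = t.
    rewrite /tan cosB sinB cos_pihalf sin_pihalf !(mul0r, mul1r, add0r, subr0).
    by rewrite -[X in _ = X]invrK -{3}(atanK t^-1) /tan invf_div.
  have h2 : atan t = pi / 2 - atan t^-1.
    rewrite -{1}h1 tanK// in_itv/=.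
    have := atan_ltpi2 t^-1; have := @lt_atan R 0 t^-1 ti; rewrite atan0; lra.
  rewrite h2; have := atan_le (ltW ti) => h3.
  have -> : 2^-1 - (pi / 2 - atan t^-1) / pi = atan t^-1 / pi.
    by move: (pi : R) p0 => P P0; field; exact: lt0r_neq0.
  rewrite ler_pdivrMr// (le_trans h3)// ler_peMr//; first exact: ltW.
  lra.
have m0 : 0 < Num.min u (1 - u) by rewrite lt_min; lra.
rewrite ler_pdivlMr//.
set y := (x - b) / a; have yE : x - b = a * y by rewrite /y mulrC divfK// gt_eqF.
rewrite yE normrM gtr0_norm// -mulrA ler_piMr ?(ltW a0)//.
have [y0|y0|y0] := ltrgt0P y.
- have h := key y y0.
  have hu : u <= y^-1 by rewrite -xE.
  rewrite -[leRHS](divff (lt0r_neq0 y0)) ler_pM2l//; apply: le_trans hu.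
  by rewrite ge_min lexx.
- have ny : 0 < - y by rewrite oppr_gt0.
  have h := key _ ny; have hu : 1 - u <= (- y)^-1.
    apply: le_trans h; rewrite -xE /cot_angle -/y atanN; lra.
  rewrite -[leRHS](divff (lt0r_neq0 ny)) ler_pM2l//; apply: le_trans hu.
  by rewrite ge_min lexx orbT.
- by rewrite mul0r ler01.
Qed.

End Cotangent.

(** * The doubling map and convergence of the averages *)

Section Doubling.
Variable R : realType.
Local Notation mu := (@lebesgue_measure R).

Definition doubling (u : R) : R := if u < 2^-1 then 2 * u else 2 * u - 1.

Lemma doubling_itv u : 0 <= u < 1 -> 0 <= doubling u < 1.
Proof. by rewrite /doubling; case: (ltP u 2^-1) => hu uP; lra. Qed.

Lemma measurable_doubling : measurable_fun setT doubling.
Proof.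
apply: measurable_fun_if => //.
- exact: measurable_fun_ltr.
- by apply: measurable_funTS; apply: measurable_funB => //; exact: measurable_funM.
Qed.

Let munit : measurable (`[0, 1[%classic : set R) := measurable_itv `[0, 1[.

(** Within [[0, 1[] the preimage consists of two disjoint affine copies of [B], each of half its
    measure. Cutting [A] down to [B] first places the copies in the two halves of the unit
    interval. *)
Lemma doubling_preserves (A : set R) : measurable A ->
  mrestr mu munit (doubling @^-1` A) = mrestr mu munit A.
Proof.
move=> mA; rewrite /mrestr; set B := A `&` `[0, 1[.
have mB : measurable B by exact: measurableI.
have mpre (d : R) : measurable ((fun x : R => 2 * x + d) @^-1` B).
  rewrite -[X in measurable X]setTI.
  have mf : measurable_fun setT (fun x : R => 2 * x + d).
    by apply: measurable_funD => //; exact: measurable_funM.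
  exact: mf.
have -> : doubling @^-1` A `&` `[0, 1[ =
    ((fun x : R => 2 * x + 0) @^-1` B) `|` ((fun x : R => 2 * x + (-1)) @^-1` B).
  apply/seteqP; split => u; rewrite /B /doubling /= !in_itv/= addr0.
    by case: (ltP u 2^-1) => hu [Au u01]; [left|right]; split => //; lra.
  move=> [] [Au u01].
    by rewrite ifT; [split => //; lra|lra].
  by rewrite ifF; [split => //; lra|apply/negbTE; rewrite -leNgt; lra].
rewrite measureU; [|exact: mpre|exact: mpre|]; last first.
  apply/seteqP; split => u //=; rewrite /B /= !in_itv/= addr0.
  by move=> [[_ h1] [_ h2]]; exfalso; move: h1 h2; lra.
have E d := @lebesgue_measure_affine R 2 d B (ltr0n _ 2) mB.
rewrite [X in (X + _)%E]E [X in (_ + X)%E]E.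
rewrite -ge0_muleDl ?lee_fin ?invr_ge0//.
have -> : (2^-1%:E + 2^-1%:E = 1%:E :> \bar R)%E by rewrite -EFinD [in RHS](splitr 1) !div1r.
by rewrite mul1e.
Qed.

Lemma unit_measure_fin : (mrestr mu munit setT < +oo)%E.
Proof. by rewrite /mrestr setTI lebesgue_measure_itv/= lte_fin ltr01 -EFinD ltry. Qed.

Section Averages.
Variables (g : R -> R) (C : R).
Hypothesis cg : continuous g.
Hypothesis g0 : forall x, 0 <= g x.
(** Growth of order [|x|^(1/2)], in the dyadic form that the layers [E j] below require. *)
Hypothesis gC : forall (j : nat) x, `|x| <= 4 ^+ j -> g x <= C * 2 ^+ j.

Local Notation phi := (@cot_param R 1 0).
Local Notation psi := (@cot_angle R 1 0).

(** This is [g \o phi] on [[0, 1[] and 0 elsewhere; the split isolates the open interval, on which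
    [g \o phi] is continuous, from the endpoint 0, where [phi] takes its default value. *)
Let h (u : R) : R := ((fun u => g (phi u) - g 0) \_ `]0, 1[) u + g 0 * \1_(`[0, 1[%classic) u.

Let phi0 : phi 0 = 0.
Proof. by rewrite /cot_param mulr0 sin0 invr0 !mulr0 addr0. Qed.

Let hE u : 0 <= u < 1 -> h u = g (phi u).
Proof.
move=> uP; rewrite /h indicE mem_set ?mulr1; last by rewrite /= in_itv.
rewrite patchE; case: ifPn => [_|]; first by rewrite subrK.
rewrite notin_setE /= in_itv/= => nu.
have -> : u = 0 by apply/eqP; rewrite eq_le; move: uP nu; case: ltP => //=; lra.
by rewrite phi0 add0r.
Qed.

Let hE0 u : ~~ (0 <= u < 1) -> h u = 0.
Proof.
move=> uP; rewrite /h indicE memNset ?mulr0 ?addr0; last by rewrite /= in_itv; exact/negP.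
rewrite patchE; case: ifPn => // ; rewrite inE /= in_itv/= => /andP[u0 u1].
by move: uP; rewrite (ltW u0) u1.
Qed.

Let mh : measurable_fun setT h.
Proof.
apply: measurable_funD; last first.
  by apply: measurable_funM => //; exact: measurable_indic.
apply/(measurable_restrictT _ _).1 => //.
apply: measurable_funB => //.
apply: open_continuous_measurable_fun; first exact: interval_open.
move=> u; rewrite inE /= in_itv/= => /andP[u0 u1].
apply: (@continuous_comp _ _ _ phi g); last exact: cg.
have cpi : {for u, continuous (fun v : R => pi * v)}.
  by apply: cvgM; [exact: cvg_cst|exact: cvg_id].
apply: cvgD; first exact: cvg_cst.
apply: cvgM; first exact: cvg_cst.
apply: cvgM.
  exact: (continuous_comp cpi (@continuous_cos R _)).
apply: cvgV.
  rewrite gt_eqF// sin_gt0_pi// mulr_gt0 ?pi_gt0//=.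
  by rewrite gtr_pMr ?pi_gt0.
exact: (continuous_comp cpi (@continuous_sin R _)).
Qed.

Let C0 : 0 <= C.
Proof. by have := @gC 0 0; rewrite normr0 expr0 mulr1 ler01 => /(_ isT); exact: le_trans. Qed.

Let E (j : nat) : set R := `[0, 4 ^- j] `|` `[1 - 4 ^- j, 1].

Let mE j : measurable (E j).
Proof. by apply: measurableU. Qed.

(** If the distance from [u] to the endpoints lies between [4 ^- (j + 1)] and [4 ^- j], then [u] is
    in [E j] and [|phi u| <= 4 ^+ j.+1], so that the single term of index [j] already dominates
    [h u]. *)
Let hbound u : ((`|h u|)%:E <= \sum_(j <oo) ((2 * C * 2 ^+ j)%:E * (\1_(E j) u)%:E))%E.
Proof.
have t0 j : (0 <= (2 * C * 2 ^+ j)%:E * (\1_(E j) u)%:E)%E.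
  by rewrite -EFinM lee_fin !mulr_ge0// ?exprn_ge0.
have term j : ((2 * C * 2 ^+ j)%:E * (\1_(E j) u)%:E <=
    \sum_(j <oo) ((2 * C * 2 ^+ j)%:E * (\1_(E j) u)%:E))%E.
  have := @nneseries_lim_ge R (fun j => ((2 * C * 2 ^+ j)%:E * (\1_(E j) u)%:E)%E) xpredT 0 j.+1.
  move=> /(_ (fun n _ _ => t0 n)); apply: le_trans.
  by rewrite big_nat_recr//= leeDr// sume_ge0.
have [uP|/hE0 ->] := boolP (0 <= u < 1); last first.
  by rewrite normr0; apply: nneseries_ge0.
rewrite hE// ger0_norm//.
have [u0|un0] := eqVneq u 0.
  apply: le_trans (term 0%N); rewrite u0 phi0 indicE mem_set ?mule1.
    rewrite lee_fin; have := @gC 0 0; rewrite normr0 expr0 !mulr1 ler01 => /(_ isT).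
    have := C0; lra.
  by left; rewrite /= in_itv/= lexx /= expr0 invr1 ler01.
have uP1 : 0 < u < 1 by case/andP: uP => u1 ->; rewrite lt_neqAle eq_sym un0 u1.
set m := Num.min u (1 - u).
have m0 : 0 < m by rewrite /m lt_min; lra.
have m1 : m <= 2^-1 by rewrite /m ge_min; case: (leP u 2^-1) => //= ?; lra.
have exj : exists j : nat, m^-1 <= 4 ^+ j.
  exists (Num.truncn m^-1).+1; apply: ltW; apply: (lt_le_trans (truncnS_gt _)).
  by rewrite -natrX ler_nat ltnW// ltn_expl.
have [[|j] jm jmin] := ex_minnP exj.
  by exfalso; move: jm; rewrite expr0 invf_le1// => jm; lra.
have mj : m <= 4 ^- j.
  rewrite -[leLHS]invrK lef_pV2 ?posrE ?invr_gt0 ?exprn_gt0// leNgt.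
  by apply/negP => /ltW/jmin; rewrite ltnn.
apply: le_trans (term j); rewrite indicE mem_set ?mule1.
  rewrite lee_fin.
  have := @gC j.+1 (phi u); rewrite exprS => H; apply: (le_trans (H _)); last by rewrite exprS; lra.
  have := cot_param_bound 0 (@ltr01 R) uP1; rewrite subr0 => /le_trans; apply.
  by rewrite mul1r -exprS.
rewrite /E /= !in_itv/=.
move: mj; rewrite /m ge_min => /orP[mj|mj]; [left|right].
  by rewrite mj; lra.
lra.
Qed.

Let ih : intg (mrestr mu munit) h.
Proof.
apply/integrableP; split; first exact/measurable_EFinP.
have mi (j : nat) : measurable_fun setT (fun u : R => (\1_(E j) u)%:E).
  by apply/measurable_EFinP; exact: measurable_indic.
have mt (j : nat) : measurable_fun setT (fun u : R => ((2 * C * 2 ^+ j)%:E * (\1_(E j) u)%:E)%E).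
  by apply: measurable_funeM; exact: mi.
have t0 (j : nat) (u : R) : (0 <= (2 * C * 2 ^+ j)%:E * (\1_(E j) u)%:E)%E.
  by rewrite -EFinM lee_fin !mulr_ge0// ?exprn_ge0.
apply: (@le_lt_trans _ _ (\int[mrestr mu munit]_(u in setT)
   \sum_(j <oo) ((2 * C * 2 ^+ j)%:E * (\1_(E j) u)%:E))%E).
  apply: ge0_le_integral => //.
  - by apply: measurableT_comp => //; exact/measurable_EFinP.
  - have := @ge0_emeasurable_sum _ _ R setT
      (fun (j : nat) u => ((2 * C * 2 ^+ j)%:E * (\1_(E j) u)%:E)%E) xpredT.
    by apply => [j u _ _|j _]; [exact: t0|exact: mt].
  - by move=> u _; exact: hbound.
rewrite integral_nneseries//.
(* [E j] has measure at most [2 * 4 ^- j], and [2 * C * 2 ^+ j] times this is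
   [8 * C / 2 ^ (j + 1)]. *)
apply: (@le_lt_trans _ _ (\sum_(j <oo) ((8 * C) / (2 ^ (j + 1))%:R)%:E)%E); last first.
  have := @cvg_geometric_eseries_half R (8 * C) 0 => /cvg_lim ->//.
  exact: ltry.
apply: lee_nneseries => [j _ _|j _]; first exact: integral_ge0.
rewrite ge0_integralZl; [|exact: measurableT|exact: mi|by move=> u _; rewrite lee_fin|by rewrite lee_fin; apply: mulr_ge0; [exact: mulr_ge0|exact: exprn_ge0]].
rewrite integral_indic; [|exact: measurableT|exact: mE].
rewrite setIT.
have q0 : 0 < 4 ^- j :> R by rewrite invr_gt0 exprn_gt0.
have mu1 : (mrestr mu munit (E j) <= (2 * 4 ^- j)%:E)%E.
  rewrite /mrestr; apply: (@le_trans _ _ (mu (E j))).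
    apply: le_measure; [|rewrite inE; exact: mE|by move=> ? []].
    by rewrite inE; apply: measurableI; [exact: mE|exact: munit].
  apply: (@le_trans _ _ (mu `[0%R, (4 ^- j)%R] + mu `[(1 - 4 ^- j)%R, 1%R])%E).
    by apply: measureU2; exact: measurable_itv.
  rewrite !lebesgue_measure_itv/= !lte_fin q0 gtrBl q0 -!EFinD lee_fin; lra.
apply: (@le_trans _ _ ((2 * C * 2 ^+ j)%:E * (2 * 4 ^- j)%:E)%E).
  by rewrite lee_wpmul2l// lee_fin !mulr_ge0 ?exprn_ge0.
rewrite -EFinM lee_fin addn1 natrX exprS.
have -> : (4 : R) ^- j = (2 ^+ j)^-1 * (2 ^+ j)^-1 by rewrite -invfM -exprMn; congr (_ ^- _); lra.
have p0 : 2 ^+ j != 0 :> R by rewrite expf_neq0.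
rewrite le_eqVlt; apply/orP; left; apply/eqP; field; by rewrite p0.
Qed.

Let birkhoff_sumE n u : 0 <= u < 1 -> birkhoff_sum doubling h n u =
  \sum_(0 <= i < n) g (iter i (boolean_map 1 0) (phi u)).
Proof.
elim: n u => [|n IH] u uP /=; first by rewrite big_geq.
rewrite IH; last exact: doubling_itv.
rewrite big_nat_recl//= hE//; congr (_ + _); apply: eq_bigr => i _.
rewrite -iterS iterSr; congr (g (iter _ _ _)).
rewrite (boolean_map_cot 0 (@ltr01 R)) /doubling; case: ifP => // _.
by rewrite cot_param1.
Qed.

Lemma ae_cvg_averages : {ae mu, forall x : R,
  cvg ((fun N : nat => N%:R^-1 * \sum_(0 <= n < N) g (iter n (boolean_map 1 0) x)) @ \oo)}.
Proof.
have [A [mA A0 NA]] := birkhoff unit_measure_fin measurable_doubling doubling_preserves ih.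
have negA : mu.-negligible (A `&` `[0, 1[).
  by apply/negligibleP; [exact: measurableI|exact: A0].
(* [phi] is not Lipschitz near the endpoints, so the exceptional set is cut according to
   [|x| <= n]. *)
pose F (n : nat) := phi @` ((A `&` `[0, 1[) `&` (psi @` [set x | `|x| <= n%:R])).
have negF n : mu.-negligible (F n).
  apply: (@negligible_lipschitz_image R phi (1 * pi * (1 + (n%:R / 1) ^+ 2))) => //.
    by rewrite !mulr_ge0 ?pi_ge0// addr_ge0 ?sqr_ge0.
  move=> _ _ [x /= xn <-] [y /= yn <-].
  rewrite !cot_angleK//; apply: cot_angle_expand => //; by rewrite subr0.
apply: negligibleS (negligible_bigcup negF) => x /= nc.
exists (Num.truncn `|x|).+1 => //; exists (psi x); last exact: cot_angleK.
have /andP[p0 p1] := cot_angle_itv 1 0 x.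
split; last by exists x => //=; apply/ltW/truncnS_gt.
split; last by rewrite /= in_itv/= (ltW p0) p1.
apply: NA => /= cv; apply: nc.
rewrite (_ : (fun N => _) = (fun n : nat => n%:R^-1 * birkhoff_sum doubling h n (psi x)))//.
apply/funext => n; rewrite birkhoff_sumE ?(ltW p0) ?p1//.
by rewrite cot_angleK.
Qed.

End Averages.
End Doubling.

(** * Expansions that miss a digit block *)

Section Avoid.
Variable R : realType.
Local Notation mu := (@lebesgue_measure R).

(* The points of [0, 1[ none of whose first [K] base-[Q] digits is [j]. *)
Fixpoint avoid (Q j K : nat) : set R :=
  if K is K'.+1 then
    \big[setU/set0]_(i < Q) (if i == j :> nat then set0
      else (fun u : R => Q%:R * u - i%:R) @^-1` avoid Q j K')
  else `[0, 1[%classic.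

Lemma measurable_avoid Q j K : measurable (avoid Q j K).
Proof.
elim: K => [|K ih]; first exact: measurable_itv.
apply: bigsetU_measurable => i _; case: eqP => // _.
rewrite -[X in measurable X]setTI.
have mf : measurable_fun setT (fun u : R => Q%:R * u - i%:R).
  by apply: measurable_funB => //; exact: measurable_funM.
exact: mf.
Qed.

(** Each further digit replaces the set by [Q - 1] copies of itself scaled by [1 / Q]. *)
Lemma avoid_measure Q j K : (j < Q)%N ->
  (mu (avoid Q j K) <= ((1 - Q%:R^-1) ^+ K)%:E)%E.
Proof.
move=> jQ; have Q0 : 0 < Q%:R :> R by rewrite ltr0n (leq_ltn_trans _ jQ).
elim: K => [|K ih]; first by rewrite /= lebesgue_measure_itv/= lte_fin ltr01 expr0 -EFinD subr0.
set x := (1 - Q%:R^-1) ^+ K in ih.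
have x0 : 0 <= x.
  rewrite exprn_ge0// subr_ge0 invf_le1// -[leLHS]/(1%:R) ler_nat.
  exact: leq_ltn_trans jQ.
pose F (i : nat) : set R := if i == j then set0
      else (fun u : R => Q%:R * u - i%:R) @^-1` avoid Q j K.
have mF i : measurable (F i).
  rewrite /F; case: eqP => // _; rewrite -[X in measurable X]setTI.
  have mf : measurable_fun setT (fun u : R => Q%:R * u - i%:R).
    by apply: measurable_funB => //; exact: measurable_funM.
  by apply: mf => //; exact: measurable_avoid.
have muF i : (mu (F i) <= (if i == j then 0 else Q%:R^-1 * x)%:E)%E.
  rewrite /F; case: eqP => _; first by rewrite measure0.
  have -> := @lebesgue_measure_affine R Q%:R (- i%:R) _ Q0 (measurable_avoid Q j K).
  by rewrite EFinM lee_wpmul2l// lee_fin invr_ge0 ltW.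
rewrite [avoid _ _ _]/= -/(F _).
apply: (@le_trans _ _ (\sum_(i < Q) mu (F i))%E).
  have := @content_subadditive _ _ _ mu (\big[setU/set0]_(i < Q) F i) F Q.
  apply => //; first by move=> k _; exact: mF.
  by apply: bigsetU_measurable => i _; exact: mF.
apply: (@le_trans _ _ (\sum_(i < Q) (if i == j :> nat then 0 else Q%:R^-1 * x)%:E)%E).
  by apply: lee_sum => i _; exact: muF.
rewrite sumEFin lee_fin (bigD1 (Ordinal jQ))//= eqxx add0r.
rewrite (eq_bigr (fun _ => Q%:R^-1 * x)); last first.
  by move=> i ij; rewrite ifF//; apply/negbTE.
rewrite sumr_const cardC1 card_ord exprS -/x -[leLHS]mulr_natl.
have -> : Q.-1%:R = Q%:R - 1 :> R.
  by rewrite -[in RHS](ltn_predK jQ) -natr1 addrK.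
by rewrite mulrA mulrBl mul1r mulfV ?gt_eqF.
Qed.

(** If the leading digit is not [j], the fractional part of [Q * u] is treated instead. The integer
    shifts accumulate in [n], which is harmless because [cot_param] has period 1. *)
Lemma avoid_escape Q j K u : (j < Q)%N -> 0 <= u < 1 -> ~ avoid Q j K u ->
  exists2 k : nat, (k < K)%N & exists n : int,
    j%:R / Q%:R <= Q%:R ^+ k * u - n%:~R < j.+1%:R / Q%:R.
Proof.
move=> jQ; have Q0 : 0 < Q%:R :> R by rewrite ltr0n (leq_ltn_trans _ jQ).
elim: K u => [|K ih] u uP na; first by exfalso; apply: na; rewrite /= in_itv.
have Qu0 : 0 <= Q%:R * u by have [u0 _] := andP uP; rewrite mulr_ge0 // ltW.
set i := Num.truncn (Q%:R * u).
have iu : i%:R <= Q%:R * u by rewrite truncn_le.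
have ui : Q%:R * u < i.+1%:R by exact: truncnS_gt.
have [ij|ij] := eqVneq i j.
  exists 0%N => //; exists 0; rewrite mul1r subr0 ler_pdivrMr// ltr_pdivlMr// mulrC.
  by rewrite -ij iu ui.
have iQ : (i < Q)%N.
  by rewrite -(ltr_nat R) (le_lt_trans iu)// gtr_pMr//; lra.
have wP : 0 <= Q%:R * u - i%:R < 1 by move: ui; rewrite -natr1; lra.
have nw : ~ avoid Q j K (Q%:R * u - i%:R).
  move=> aw; apply: na; rewrite /= (bigD1 (Ordinal iQ))//=; left.
  by rewrite (negPf ij).
have [k kK [n nP]] := ih _ wP nw.
exists k.+1; first by rewrite ltnS.
exists (Q%:Z ^+ k * i%:Z + n); move: nP.
rewrite exprSr -mulrA rmorphD rmorphM rmorphXn /= mulrBr opprD !addrA.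
by rewrite !pmulrn.
Qed.

End Avoid.

Section Hitting.
Variable R : realType.
Local Notation mu := (@lebesgue_measure R).
Variables (a b : R) (g : R -> R).
Hypothesis a0 : 0 < a.
Hypothesis g0 : forall x, 0 <= g x.
Hypothesis cv : {ae mu, forall x : R,
  cvg ((fun N : nat => N%:R^-1 * \sum_(0 <= n < N) g (iter n (boolean_map a b) x)) @ \oo)}.
Local Notation phi := (cot_param a b).
Local Notation psi := (cot_angle a b).

(** Convergent averages are bounded, and the last of [n + 1] nonnegative terms is at most their
    sum. *)
Lemma orbit_linear_bound x :
  cvg ((fun N : nat => N%:R^-1 * \sum_(0 <= n < N) g (iter n (boolean_map a b) x)) @ \oo) ->
  exists C : R, forall n, g (iter n (boolean_map a b) x) <= C * n.+1%:R.
Proof.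
move=> cvx; have [M [_ HM]] := cvg_seq_bounded cvx.
exists (M + 1) => n.
have n0 : 0 < n.+1%:R :> R by rewrite ltr0n.
have M1 : M < M + 1 by rewrite ltrDl.
have /= h := HM _ M1 n.+1 I.
rewrite -ler_pdivrMr//; apply: le_trans h.
apply: le_trans (ler_norm _); rewrite mulrC ler_pM2l ?invr_gt0//.
rewrite big_nat_recr//= lerDr sumr_ge0//.
Qed.

Lemma null_cot_param (N : set R) : mu.-negligible N ->
  mu.-negligible [set u | 0 < u < 1 /\ N (phi u)].
Proof.
move=> negN; have L0 : 0 <= (a * pi)^-1 by rewrite invr_ge0 mulr_ge0 ?pi_ge0// ltW.
have := @negligible_lipschitz_image R psi (a * pi)^-1 N setT L0 _ negN.
move=> /(_ (fun x y _ _ => cot_angle_lip b a0 x y)).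
apply: negligibleS => u /= [uP Nu]; exists (phi u) => //.
exact: cot_paramK.
Qed.

(** Were it false, one point [u] could be chosen that visits a bad block at every level [i]. Its
    constant [C] is fixed before the level is picked, so no uniformity of [C] over orbits is
    needed. *)
Lemma hitting_bound : exists M : nat, forall m j : nat, (M <= m)%N -> (j < 2 ^ m)%N ->
  exists2 u : R, j%:R / (2 ^ m)%:R <= u < j.+1%:R / (2 ^ m)%:R & g (phi u) < 16 ^+ m.
Proof.
apply: contrapT => nM.
(* The level [i] uses blocks of length at least [i + 2]: the sets that miss them then have total
   measure at most 1/2, leaving room in []0, 1[]. *)
have ex (i : nat) : exists mj : nat * nat, [/\ (i.+2 <= mj.1)%N, (mj.2 < 2 ^ mj.1)%N &
   forall u : R, mj.2%:R / (2 ^ mj.1)%:R <= u < mj.2.+1%:R / (2 ^ mj.1)%:R -> 16 ^+ mj.1 <= g (phi u)].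
  apply: contrapT => nE; apply: nM; exists i.+2 => m j im jm.
  apply: contrapT => nu; apply: nE; exists (m, j); split => //= u uP.
  by rewrite leNgt; apply/negP => lt; apply: nu; exists u.
have [s sP] := choice ex.
pose A i := @avoid R (2 ^ (s i).1) (s i).2 (4 ^ (s i).1).
have mA i : measurable (A i) by exact: measurable_avoid.
have muA i : (mu (A i) <= (2^-1 / (2 ^ (i + 1))%:R)%:E)%E.
  have [im jm _] := sP i.
  apply: (le_trans (@avoid_measure R _ _ _ jm)); rewrite lee_fin.
  set m := (s i).1 in im jm *; set p : R := (2 ^ m)%:R^-1.
  have q0 : 0 < (2 ^ m)%:R :> R by rewrite ltr0n expn_gt0.
  have q1 : 1 <= (2 ^ m)%:R :> R by rewrite -[leLHS]/(1%:R) ler_nat expn_gt0.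
  have p0 : 0 < p by rewrite invr_gt0.
  have p1 : p <= 1 by rewrite invf_le1.
  (* Bernoulli's inequality with [(1 - p) ^+ K * (1 + p) ^+ K <= 1] gives
     [(1 - p) ^+ K <= (1 + p * K)^-1], and [p * 4 ^ m = 2 ^ m]. *)
  have bern (K : nat) : 1 + p * K%:R <= (1 + p) ^+ K.
    elim: K => [|K ih]; first by rewrite mulr0 addr0 expr0.
    rewrite exprS -natr1; apply: (@le_trans _ _ ((1 + p) * (1 + p * K%:R))).
      have : 0 <= p * (p * K%:R) by rewrite !mulr_ge0// ltW.
      nra.
    by rewrite ler_pM2l//; lra.
  have prod : (1 - p) ^+ (4 ^ m) * (1 + p * (4 ^ m)%:R) <= 1.
    apply: (@le_trans _ _ ((1 - p) ^+ (4 ^ m) * (1 + p) ^+ (4 ^ m))).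
      by rewrite ler_wpM2l ?exprn_ge0 ?subr_ge0.
    have pp := mulr_gt0 p0 p0; have pp1 : p * p <= 1 by rewrite mulr_ile1 // ltW.
    by rewrite -exprMn exprn_ile1//; lra.
  have e4 : p * (4 ^ m)%:R = (2 ^ m)%:R.
    by rewrite (_ : 4 = 2 * 2)%N// expnMn natrM /p mulrA mulVf ?mul1r// gt_eqF.
  rewrite e4 in prod.
  have x0 : 0 <= (1 - p) ^+ (4 ^ m) by rewrite exprn_ge0// subr_ge0.
  rewrite -ler_pdivlMr in prod; last by lra.
  have big : 2 * (2 ^ (i + 1))%:R <= 1 + (2 ^ m)%:R :> R.
    apply: (@le_trans _ _ (2 ^ m)%:R); last by rewrite lerDr.
    by rewrite addn1 -natrM -expnS ler_nat leq_exp2l.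
  have i0 : 0 < 2 * (2 ^ (i + 1))%:R :> R by rewrite -natrM ltr0n muln_gt0 expn_gt0.
  apply: (le_trans prod); rewrite div1r -invfM lef_pV2 ?posrE//.
have mUA : measurable (\bigcup_i A i) by apply: bigcup_measurable => k _; exact: mA.
have negB := null_cot_param cv.
have [B [mB B0 BN]] := negB.
have small : (mu (B `|` \bigcup_i A i) <= 2^-1%:E)%E.
  apply: (@le_trans _ _ (mu B + mu (\bigcup_i A i))%E).
    by exact: measureU2.
  rewrite [mu B](B0 : mu B = 0%E) add0e.
  apply: (le_trans (generalized_Boole_inequality mu mA mUA)).
  apply: (@le_trans _ _ (\sum_(i <oo) (2^-1 / (2 ^ (i + 1))%:R)%:E)%E).
    by apply: lee_nneseries => [i _ _|i _]; [exact: measure_ge0|exact: muA].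
  have := @cvg_geometric_eseries_half R 2^-1 0 => /cvg_lim ->//.
  by rewrite expr0 divr1.
have [u uP nu] : exists2 u : R, 0 < u < 1 & ~ (B `|` \bigcup_i A i) u.
  apply: contrapT => nE.
  have sub : `]0, 1[%classic `<=` B `|` \bigcup_i A i.
    move=> u /=; rewrite in_itv/= => uP; apply: contrapT => nu; apply: nE; by exists u.
  have : (mu `]0%R, 1%R[ <= mu (B `|` \bigcup_i A i))%E.
    apply: le_measure => //; rewrite inE; first exact: measurable_itv.
    by exact: measurableU.
  move=> /le_trans /(_ small); rewrite lebesgue_measure_itv/= lte_fin ltr01 -EFinD lee_fin; lra.
have cvu : cvg ((fun N : nat => N%:R^-1 * \sum_(0 <= n < N) g (iter n (boolean_map a b) (phi u))) @ \oo).
  apply: contrapT => nc; apply: nu; left; apply: BN; split => //.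
have [C HC] := orbit_linear_bound cvu.
have C0 : 0 <= C by have := le_trans (g0 _) (HC 0%N); rewrite mulr1.
pose i := (Num.truncn C).+1.
have [im jm gm] := sP i; set m := (s i).1 in im jm gm; set j := (s i).2 in jm gm.
have uP' : 0 <= u < 1 by lra.
have na : ~ @avoid R (2 ^ m) j (4 ^ m) u by move=> au; apply: nu; right; exists i.
have [k kK [n nP]] := avoid_escape jm uP' na.
have := HC (m * k)%N; rewrite iter_boolean_map_cot// exprM -natrX.
rewrite -(cot_paramN_int a b n) => h.
have {h gm}h := le_trans (gm _ nP) h.
have mk : ((m * k).+1 <= 8 ^ m)%N.
  apply: (@leq_ltn_trans (2 ^ m * k)%N).
    by rewrite leq_mul2r (ltnW (ltn_expl _ _)) ?orbT.
  by rewrite (_ : 8 = 2 * 4)%N// expnMn ltn_mul2l expn_gt0.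
have : 16 ^+ m <= C * 8 ^+ m.
  apply: (le_trans h); rewrite ler_wpM2l// -natrX ler_nat//.
have -> : (16 : R) = 2 * 8 by lra.
rewrite exprMn ler_pM2r ?exprn_gt0// leNgt => /negP; apply.
apply: (lt_le_trans (truncnS_gt C)); rewrite -/i -natrX ler_nat.
by rewrite (leq_trans _ (ltnW (ltn_expl m _)))// ltnW// ltnW.
Qed.

End Hitting.

(** * Ergodic averages on the critical line *)

Section CriticalLine.
Variable R : realType.
Variable zeta : R[i]^o -> R[i]^o.
Hypothesis zetaP : is_riemann_zeta zeta.

Lemma critical_line_neq1 (t : R) : 2^-1 +i* t != 1 :> R[i].
Proof. by rewrite eq_complex /=; apply/negP => /andP[/eqP h _]; lra. Qed.

Lemma continuous_zder_critical k :
  continuous (fun t : R => normc (zder zeta k (2^-1 +i* t))).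
Proof.
move=> t; apply/cvgrPdist_lt => e e0.
have [dl dl0 H] := cder_cont (cder_zder zetaP k (critical_line_neq1 t)) e0.
apply/nbhs_ballP; exists dl => // u /=; rewrite /ball /= => tu.
rewrite distrC; apply: (le_lt_trans (normc_lip _ _)).
have -> : 2^-1 +i* u = (2^-1 +i* t) + (0 +i* (u - t)) by apply: complex_ext => /=; ring.
by apply: H; apply: (le_lt_trans (normc_le _)); rewrite /= normr0 add0r distrC.
Qed.

Lemma zder_critical_bounded k (T : R) : exists M : R,
  forall t, `|t| <= T -> normc (zder zeta k (2^-1 +i* t)) <= M.
Proof.
have [T0|T0] := leP 0 T; last first.
  by exists 0 => t tT; have := normr_ge0 t; lra.
have on : cdiff_on (zder zeta k) 2^-1 2^-1 (- T) T.
  move=> x y /andP[x1 x2] _; have -> : x = 2^-1 by apply/eqP; rewrite eq_le x1 x2.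
  by eexists; apply: (cder_zder zetaP); exact: critical_line_neq1.
have [||M MP] := cdiff_on_bounded _ _ on; [exact: lexx|lra|].
by exists M => t; rewrite ler_norml => tP; apply: MP => //; rewrite lexx.
Qed.

Lemma lindelof_ae_cvg k l : (0 < l)%N -> lindelof_der zeta k ->
  {ae (@lebesgue_measure R), forall x : R,
    cvg ((fun N : nat => N%:R^-1 * \sum_(0 <= n < N)
      normc (zder zeta k (2^-1 +i* iter n (boolean_map 1 0) x)) ^+ (2 * l)) @ \oo)}.
Proof.
(* The exponent [1 / (4 * l)] becomes 1/2 after raising to the power [2 * l], and
   [|x|^(1/2) <= 2 ^+ j] for [|x| <= 4 ^+ j]; the range [|x| < t0] is left to the bound [M]. *)
move=> l0 /lindelof_derE LH; have lR : 0 < l%:R :> R by rewrite ltr0n.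
have e0 : 0 < (4 * l%:R)^-1 :> R by rewrite invr_gt0 mulr_gt0.
have [C [t0 [C0 t4 HC]]] := LH _ e0.
have [M MP] := zder_critical_bounded k t0.
have M0 : 0 <= M.
  by apply: le_trans (MP 0 _); [exact: normc_ge0|rewrite normr0; lra].
pose f (t : R) := normc (zder zeta k (2^-1 +i* t)).
apply: (@ae_cvg_averages R (fun t => f t ^+ (2 * l)) (C ^+ (2 * l) + M ^+ (2 * l))).
- move=> t; apply: (@continuous_comp _ _ _ f (fun y => y ^+ (2 * l))).
    exact: continuous_zder_critical.
  exact: exprn_continuous.
- by move=> t; rewrite exprn_ge0// normc_ge0.
move=> j x xj; have f0 : 0 <= f x by exact: normc_ge0.
have j1 : 1 <= 2 ^+ j :> R by rewrite exprn_ege1// ler1n.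
have Cl : 0 <= C ^+ (2 * l) by rewrite exprn_ge0.
have Ml : 0 <= M ^+ (2 * l) by rewrite exprn_ge0.
have [tx|xt] := leP t0 `|x|; last first.
  apply: (@le_trans _ _ (M ^+ (2 * l))).
    by apply: lerXn2r; rewrite ?nnegrE//; apply: MP; exact: ltW.
  by rewrite -[leLHS]mulr1 ler_pM// lerDr.
have x0 : 0 < `|x| by apply: lt_le_trans tx; lra.
apply: (@le_trans _ _ ((C * expR ((4 * l%:R)^-1 * ln `|x|)) ^+ (2 * l))).
  apply: lerXn2r; rewrite ?nnegrE//; first by rewrite mulr_ge0// expR_ge0.
  exact: HC.
rewrite exprMn ler_pM ?exprn_ge0 ?expR_ge0//; first by rewrite lerDl.
rewrite -expRM_natr -[leRHS]lnK; last by rewrite posrE exprn_gt0.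
rewrite ler_expR natrM.
have -> : (4 * l%:R)^-1 * ln `|x| * (2 * l%:R) = ln `|x| / 2 by field; rewrite gt_eqF.
rewrite ler_pdivrMr// mulr_natr -lnXn ?exprn_gt0//.
rewrite ler_ln ?posrE ?exprn_gt0//; apply: (le_trans xj).
by rewrite -exprM mulnC exprM (_ : 2 ^+ 2 = 4 :> R)//; lra.
Qed.

End CriticalLine.

Lemma cot_param_between (R : realType) (a b x y u : R) : 0 < a ->
  cot_angle a b y < u < cot_angle a b x -> x <= cot_param a b u <= y.
Proof.
move=> a0 /andP[yu ux].
have [y0 _] := andP (cot_angle_itv a b y); have [_ x1] := andP (cot_angle_itv a b x).
have uE : cot_angle a b (cot_param a b u) = u.
  by apply: cot_paramK => //; rewrite (lt_trans y0 yu) (lt_trans ux x1).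
apply/andP; split; rewrite leNgt; apply/negP => /ltW /(cot_angle_decr b a0).
  by rewrite uE leNgt ux.
by rewrite uE leNgt yu.
Qed.

Lemma dyadic_subinterval (R : realType) (x y : R) m : 0 <= x -> y <= 1 ->
  2 <= (2 ^ m)%:R * (y - x) -> exists2 j : nat, (j < 2 ^ m)%N &
  forall u, j%:R / (2 ^ m)%:R <= u < j.+1%:R / (2 ^ m)%:R -> x < u < y.
Proof.
move=> x0 y1 len; have q0 : 0 < (2 ^ m)%:R :> R by rewrite ltr0n expn_gt0.
set q := (2 ^ m)%:R in len q0 *.
have qx : 0 <= q * x by rewrite mulr_ge0// ltW.
have j1 : (Num.truncn (q * x))%:R <= q * x by rewrite truncn_le.
have j2 := truncnS_gt (q * x).
(* The first cell that starts strictly to the right of [x]; it ends by [x + 2 / q <= y]. *)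
move: j1 j2; set j := (Num.truncn (q * x)).+1; rewrite /j -natr1 => j1 j2.
have qy : q * y <= q by rewrite ler_piMr// ltW.
exists j; first by rewrite -(ltr_nat R) -/q -natr1; lra.
move=> u /andP[]; rewrite ler_pdivrMr// ltr_pdivlMr// -!natr1 => u1 u2.
by rewrite -(ltr_pM2l q0 x) -(ltr_pM2l q0 u); apply/andP; split; lra.
Qed.

(** * From convergent averages to the Lindelof bound *)

Section Converse.
Variable R : realType.
Variable zeta : R[i]^o -> R[i]^o.
Hypothesis zetaP : is_riemann_zeta zeta.
Variables (a b : R).
Hypothesis a0 : 0 < a.

(** The next derivative is at most [2 * K * |T|] within distance 1 of [T], so a window of radius
    [(2 * K * |T|)^-1] costs at most 1. *)
Lemma zder_critical_local k : exists2 K : R, 1 <= K & forall T t : R, 8 <= `|T| ->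
  `|t - T| <= (2 * K * `|T|)^-1 ->
  normc (zder zeta k (2^-1 +i* T)) - 1 <= normc (zder zeta k (2^-1 +i* t)).
Proof.
have [C C0 HC] := zder_growth zetaP k.+1; exists (C + 1); first by lra.
move=> T t T8 tT; set K := C + 1 in tT *.
have K1 : 1 <= K by rewrite /K; lra.
have p : 0 < 2 * K * `|T| by rewrite !mulr_gt0//; lra.
have d1 : (2 * K * `|T|)^-1 <= 1 by rewrite invf_le1//; nra.
have h : normc (zder zeta k ((2^-1 +i* T) + (0 +i* (t - T))) - zder zeta k (2^-1 +i* T))
    <= 2 * K * `|T| * normc (0 +i* (t - T)).
  apply: (@cder_mvt R (zder zeta k) (zder zeta k.+1)) => u uP.
  have -> : (2^-1 +i* T) + u%:C * (0 +i* (t - T)) = 2^-1 +i* (T + u * (t - T)).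
    by apply: complex_ext => /=; ring.
  split; first by apply: (cder_zder zetaP); exact: critical_line_neq1.
  have ub : `|u * (t - T)| <= 1.
    by rewrite normrM mulr_ile1//; [rewrite ger0_norm; lra|lra].
  have n1 := lerB_normD T (u * (t - T)); have n2 := ler_normD T (u * (t - T)).
  apply: (le_trans (HC _ _ _ _)); [lra|lra|].
  apply: (@le_trans _ _ (C * (2 * `|T|))); first by rewrite ler_wpM2l//; lra.
  rewrite /K; nra.
have e1 : normc (0 +i* (t - T)) = `|t - T| by rewrite /= expr0n add0r sqrtr_sqr.
have e2 : (2^-1 +i* T) + (0 +i* (t - T)) = 2^-1 +i* t by apply: complex_ext => /=; ring.
rewrite e1 e2 in h.
have h1 : 2 * K * `|T| * `|t - T| <= 1 by rewrite mulrC -ler_pdivlMr// div1r.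
have := normc_lip (zder zeta k (2^-1 +i* t)) (zder zeta k (2^-1 +i* T)).
by rewrite ler_norml => /andP[h2 _]; lra.
Qed.

(** The window has width of order [|T|^-1], and the derivative of [cot_angle] is at least of order
    [|T|^-2] there; the product explains the cube. *)
Lemma cot_angle_window K : 1 <= K -> exists2 c : R, 0 < c & forall T d : R,
  1 + `|b| <= `|T| -> d = (2 * K * `|T|)^-1 ->
  1 <= c * `|T| ^+ 3 * (cot_angle a b (T - d) - cot_angle a b (T + d)).
Proof.
move=> K1; have pi0 := @pi_gt0 R.
have A0 : 0 < a * pi by rewrite mulr_gt0.
have s0 : 0 <= 4 / a ^+ 2 by rewrite divr_ge0// exprn_ge0// ltW.
exists (K * (a * pi) * (1 + 4 / a ^+ 2)); first by rewrite !mulr_gt0//; lra.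
move=> T d TP dE; have b0 := normr_ge0 b.
have p : 0 < 2 * K * `|T| by rewrite !mulr_gt0//; lra.
have d0 : 0 < d by rewrite dE invr_gt0.
have d1 : d <= 1 by rewrite dE invf_le1//; nra.
have [|c cP ->] := @cot_angle_mvt R a b a0 (T - d) (T + d); first by lra.
have cb : `|c - b| <= 2 * `|T|.
  have -> : c - b = T + (c - T - b) by ring.
  apply: (le_trans (ler_normD _ _)).
  have : `|c - T - b| <= 1 + `|b|.
    by apply: (le_trans (ler_normB _ _)); rewrite lerD2r ler_norml; lra.
  lra.
have den : 1 + ((c - b) / a) ^+ 2 <= (1 + 4 / a ^+ 2) * `|T| ^+ 2.
  rewrite expr_div_n mulrDl mul1r; apply: lerD; first by rewrite exprn_ege1//; lra.
  rewrite [leRHS]mulrAC ler_pM2r ?invr_gt0 ?exprn_gt0//.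
  rewrite -[leLHS]ger0_norm ?sqr_ge0// normrX.
  have -> : 4 * `|T| ^+ 2 = (2 * `|T|) ^+ 2 by ring.
  by apply: lerXn2r; rewrite ?nnegrE//; lra.
have D0 : 0 < 1 + ((c - b) / a) ^+ 2 by rewrite ltr_pwDl ?sqr_ge0.
rewrite mulrA ler_pdivlMr ?mulr_gt0// mul1r.
have -> : T + d - (T - d) = 2 * d by ring.
apply: (@le_trans _ _ (a * pi * ((1 + 4 / a ^+ 2) * `|T| ^+ 2))).
  by rewrite ler_pM2l.
rewrite dE le_eqVlt; apply/orP; left; apply/eqP; field.
by rewrite !gt_eqF//; lra.
Qed.

Lemma ae_cvg_lindelof k :
  (forall l : nat, (0 < l)%N -> {ae (@lebesgue_measure R), forall x : R,
    cvg ((fun N : nat => N%:R^-1 * \sum_(0 <= n < N)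
      normc (zder zeta k (2^-1 +i* iter n (boolean_map a b) x)) ^+ (2 * l)) @ \oo)}) ->
  lindelof_der zeta k.
Proof.
move=> cv eps e0; apply: contrapT => nE.
pose f (t : R) := normc (zder zeta k (2^-1 +i* t)).
(* The factor 2 pays for the loss of 1 in [zder_critical_local], since [|T| ^ eps >= 1]. *)
have big t0 : exists2 T : R, t0 <= `|T| & 2 * `|T| `^ eps < f T.
  apply: contrapT => nT; apply: nE; exists 2, t0 => t tP.
  by rewrite leNgt; apply/negP => lt; apply: nT; exists t.
have [K K1 HK] := zder_critical_local k.
have [c c0 Hc] := cot_angle_window K1.
pose l := (Num.truncn (13 / eps)).+1.
have lP : 13 <= eps * (2 * l)%:R.
  have : 13 / eps < l%:R by exact: truncnS_gt.
  rewrite ltr_pdivrMr// => h; rewrite natrM; nra.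
have [M HM] := @hitting_bound R a b (fun t => f t ^+ (2 * l)) a0
  (fun t => exprn_ge0 _ (normc_ge0 _)) (cv l isT).
(* [|T|] must beat every constant below; a point near [T] is then reached through a
   dyadic arc of length about [|T|^-3], whence the exponent [13 > 4 * 3]. *)
pose B := 8 + (1 + `|b|) + (4 * c) ^+ 4 + (2 ^ M.+1)%:R / (4 * c).
have [T TB fT] := big B.
have b0 := normr_ge0 b.
have p4 : 0 < (4 * c) ^+ 4 by rewrite exprn_gt0// mulr_gt0.
have pM : 0 < (2 ^ M.+1)%:R / (4 * c) by rewrite divr_gt0 ?mulr_gt0// ltr0n expn_gt0.
have T8 : 8 <= `|T| by rewrite /B in TB; lra.
have Tb : 1 + `|b| <= `|T| by rewrite /B in TB; lra.
have T4 : (4 * c) ^+ 4 <= `|T| by rewrite /B in TB; lra.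
have TM : (2 ^ M.+1)%:R / (4 * c) <= `|T| by rewrite /B in TB; lra.
have T0 : 0 < `|T| by lra.
clear TB; clearbody l; clear B p4 pM.
pose d := (2 * K * `|T|)^-1; have win := Hc T d Tb erefl.
set L := cot_angle a b (T - d) - cot_angle a b (T + d) in win.
(* [m] will satisfy [2 ^ m <= Y < 2 * 2 ^ m]. The second inequality gives the arc length at least
   two cells, as [Y * L >= 4]; the first gives [16 ^+ m <= Y ^+ 4 = (4 * c) ^+ 4 * |T| ^+ 12], at
   most [|T| ^+ 13]. *)
pose Y := 4 * c * `|T| ^+ 3.
have T31 : `|T| <= `|T| ^+ 3 by rewrite -[leLHS]expr1 ler_weXn2l//; lra.
have YM : (2 ^ M.+1)%:R <= Y.
  rewrite ler_pdivrMr ?mulr_gt0// in TM; apply: (le_trans TM).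
  by rewrite mulrC /Y ler_pM2l// mulr_gt0.
have Y0 : 0 <= Y by apply: le_trans YM.
pose m := trunc_log 2 (Num.truncn Y).
have trM : (2 ^ M.+1 <= Num.truncn Y)%N by rewrite truncn_ge_nat.
have tr0 : (0 < Num.truncn Y)%N by apply: leq_trans trM; rewrite expn_gt0.
have mY : (2 ^ m)%:R <= Y.
  apply: (@le_trans _ _ (Num.truncn Y)%:R); last by rewrite truncn_le.
  by rewrite ler_nat trunc_logP.
have Ym : Y < 2 * (2 ^ m)%:R.
  apply: (lt_le_trans (truncnS_gt Y)); rewrite -natrM -expnS ler_nat.
  exact: trunc_log_ltn.
have Mm : (M <= m)%N by apply: trunc_log_max => //; apply: leq_trans trM; rewrite leq_exp2l.
have len : 2 <= (2 ^ m)%:R * L.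
  have L0 : 0 < L.
    have q0 : 0 < c * `|T| ^+ 3 by rewrite mulr_gt0// exprn_gt0.
    by rewrite -(pmulr_rgt0 _ q0); apply: lt_le_trans win.
  have : Y * L <= 2 * (2 ^ m)%:R * L by rewrite ler_pM2r// ltW.
  have -> : Y * L = 4 * (c * `|T| ^+ 3 * L) by rewrite /Y; ring.
  rewrite -mulrA; lra.
have [y0 y1] := andP (cot_angle_itv a b (T - d)).
have [x0 x1] := andP (cot_angle_itv a b (T + d)).
have [j jm jP] := dyadic_subinterval (ltW x0) (ltW y1) len.
have [u /jP uP] := HM m j Mm jm.
apply/negP; rewrite -leNgt; clear YM Ym len win trM TM jP jm Mm tr0 T31 L.
set t := cot_param a b u; have tT : `|t - T| <= d.
  rewrite ler_distl; exact: (cot_param_between a0 uP).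
have ft := HK T t T8 tT; rewrite -/(f T) -/(f t) in ft.
have P1 : 1 <= `|T| `^ eps.
  rewrite powR_expR// -[leLHS]expR0 ler_expR mulr_ge0 ?(ltW e0)// ln_ge0//; lra.
have ftT : `|T| `^ eps <= f t.
  by apply: le_trans ft; rewrite lerBrDr (le_trans _ (ltW fT))// mulr_natl mulr2n lerD2l.
apply: (@le_trans _ _ ((`|T| `^ eps) ^+ (2 * l))); last first.
  by apply: lerXn2r; rewrite ?nnegrE ?powR_ge0// (le_trans _ ftT) ?powR_ge0.
apply: (@le_trans _ _ (`|T| ^+ 13)); last first.
  rewrite powR_expR// -expRM_natr -[leLHS]lnK ?posrE ?exprn_gt0//.
  rewrite ler_expR lnXn// -[leLHS]mulr_natl.
  rewrite (_ : _ * _ * _ = eps * (2 * l)%:R * ln `|T|); last by ring.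
  by rewrite ler_wpM2r// ln_ge0//; lra.
have -> : (16 : R) = 2 ^+ 4 by ring.
rewrite -exprM mulnC exprM -natrX.
apply: (@le_trans _ _ (Y ^+ 4)); first by apply: lerXn2r; rewrite ?nnegrE.
by rewrite /Y exprMn -exprM exprS ler_pM2r// exprn_gt0.
Qed.

End Converse.

Theorem theorem2p3 (R : realType) (zeta : R[i]^o -> R[i]^o)
    (zetaP : is_riemann_zeta zeta) (k : nat) :
  lindelof_hypothesis zeta <->
  exists alpha beta : R, 0 < alpha /\
    forall l : nat, (0 < l)%N ->
    {ae (@lebesgue_measure R), forall x : R,
      cvg ((fun N : nat => N%:R^-1 *
        \sum_(0 <= n < N)
          ComplexField.Normc.normc
            (derive1n k zeta (2^-1 +i* iter n (boolean_map alpha beta) x))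
          ^+ (2 * l)) @ \oo)}.
Proof.
apply: (iff_trans (lindelof_hypothesisE zetaP k)); split => [LH|[a [b [a0 cv]]]].
  (* One pair suffices here, and Boole's original map is the simplest; the converse takes any
     pair. *)
  exists 1, 0; split=> [|l l0]; first exact: ltr01.
  exact: (lindelof_ae_cvg zetaP l0 LH).
exact: (ae_cvg_lindelof zetaP a0 cv).
Qed.
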